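(* Let $m,n\ge2$, $G=\mathrm{Sp}_{2m}\times\mathrm{Sp}_{2n}$ and $H=\mathrm{Sp}_{2m-2}\times\mathrm{Sp}_2\times\mathrm{Sp}_{2n-2}$, where $H\subset \mathrm{Sp}_{2m-2}\times\mathrm{Sp}_2\times\mathrm{Sp}_2\times\mathrm{Sp}_{2n-2}\subset G$ with the factor $\mathrm{Sp}_2$ of $H$ embedded diagonally. Then $$P^+_G(0)=\mathbb{N}(\varpi_1,\varpi_1')\oplus\mathbb{N}(\varpi_2,0)\oplus\mathbb{N}(0,\varpi_2').$$ Moreover, for $\ell\in\mathbb{N}$ and $\mu=(0,\ell\omega,0)\in P_H^+$, put $$B(\mu)=\{(\ell_1\varpi_1,\ell_2\varpi_1'):\ \ell_1,\ell_2\in\mathbb{N},\ \ell_1+\ell_2=\ell\}.$$ Then $P^+_G(\mu)=P^+_G(0)+B(\mu)$, and the addition map $P^+_G(0)\times B(\mu)\to P^+_G(\mu)$ is a bijection.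
   Context: Groups are over $\mathbb{C}$ and $\mathbb{N}=\{0,1,2,\dots\}$. $(\varpi_i,0)$ and $(0,\varpi_i')$ denote the fundamental weights of $G$ coming from $\mathrm{Sp}_{2m}$ and $\mathrm{Sp}_{2n}$ respectively (standard numbering, $\varpi_1$ being the highest weight of the standard representation), and $\omega$ is the fundamental weight of $\mathrm{Sp}_2$. The embeddings $\mathrm{Sp}_{2m-2}\times\mathrm{Sp}_2\subset\mathrm{Sp}_{2m}$ and $\mathrm{Sp}_2\times\mathrm{Sp}_{2n-2}\subset\mathrm{Sp}_{2n}$ are the standard ones. For $\mu\in P^+_H$, $P^+_G(\mu)=\{\lambda\in P^+_G:m^{G,H}_\lambda(\mu)=1\}$, where $m^{G,H}_\lambda(\mu)$ is the multiplicity of the irreducible $H$-representation of highest weight $\mu$ in the restriction to $H$ of the irreducible $G$-representation of highest weight $\lambda$. *)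

(* Defs.v *)
(* Mathematical Components, with classical sets and realType from
   MathComp-Analysis; the complex field is R[i] with R : realType. *)
From HB Require Import structures.
From mathcomp Require Import all_boot all_order all_algebra.
From mathcomp Require Import complex.
From mathcomp Require Import mpoly.
From mathcomp Require Import boolp classical_sets functions reals.

Set Implicit Arguments.
Unset Strict Implicit.
Unset Printing Implicit Defensive.

Import GRing.Theory.
Local Open Scope classical_set_scope.
Local Open Scope ring_scope.

Section RationalRepresentations.
Variable R : realType.
Local Notation C := (complex R).

(* A linear algebraic group is given by its set X of matrices in 'M_N.  Every
   group below lies in SL_N, so its regular functions are the restrictions of
   polynomials in the matrix entries (no inverse of the determinant). *)
Definition regular_on N (X : set 'M[C]_N) (f : 'M[C]_N -> C) : Prop :=
  exists p : {mpoly C[N * N]},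
    forall A, X A -> f A = p.@[fun k => mxvec A ord0 k].

(* Matrix form of a finite-dimensional rational representation of X on the
   column space 'cV_d.  Only the values of rho on X matter, so the same rho,
   used with a subgroup H of X, is the restriction of the representation. *)
Definition is_rep N d (X : set 'M[C]_N) (rho : 'M[C]_N -> 'M[C]_d) : Prop :=
  [/\ rho 1%:M = 1%:M,
      forall A B, X A -> X B -> rho (A *m B) = rho A *m rho B
    & forall i j, regular_on X (fun A => rho A i j)].

Definition invariant_sub N d (X : set 'M[C]_N) (rho : 'M[C]_N -> 'M[C]_d)
    (W : {vspace 'cV[C]_d}) : Prop :=
  forall A v, X A -> v \in W -> rho A *m v \in W.

Definition irreducible_sub N d (X : set 'M[C]_N) (rho : 'M[C]_N -> 'M[C]_d)
    (W : {vspace 'cV[C]_d}) : Prop :=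
  [/\ W <> 0%VS, invariant_sub X rho W
    & forall W' : {vspace 'cV[C]_d}, (W' <= W)%VS -> invariant_sub X rho W' ->
        W' = 0%VS \/ W' = W].

Definition irreducible_rep N d (X : set 'M[C]_N) (rho : 'M[C]_N -> 'M[C]_d)
    : Prop :=
  is_rep X rho /\ irreducible_sub X rho fullv.

(* The subrepresentation of rho on W is isomorphic to sigma; the isomorphism
   is v |-> F *m v. *)
Definition sub_iso N d e (X : set 'M[C]_N) (rho : 'M[C]_N -> 'M[C]_d)
    (W : {vspace 'cV[C]_d}) (sigma : 'M[C]_N -> 'M[C]_e) : Prop :=
  exists F : 'M[C]_(d, e),
    [/\ forall A, X A -> rho A *m F = F *m sigma A,
        injective (fun v : 'cV[C]_e => F *m v)
      & forall w : 'cV[C]_d, w \in W <-> exists v : 'cV[C]_e, w = F *m v].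

(* rho is a direct sum of irreducible subrepresentations, exactly k of which
   are isomorphic to sigma. *)
Definition has_multiplicity N d e (X : set 'M[C]_N)
    (rho : 'M[C]_N -> 'M[C]_d) (sigma : 'M[C]_N -> 'M[C]_e) (k : nat) : Prop :=
  exists (r : nat) (W : 'I_r -> {vspace 'cV[C]_d}),
    [/\ forall i, irreducible_sub X rho (W i),
        directv (\sum_(i < r) W i)%VS,
        (\sum_(i < r) W i)%VS = fullv
      & #|[pred i : 'I_r | `[< sub_iso X rho (W i) sigma >]]| = k].

End RationalRepresentations.

Section SymplecticGroups.
Variable R : realType.
Local Notation C := (complex R).

Definition symp_form r : 'M[C]_(r + r) := block_mx 0 1%:M (- 1%:M) 0.

(* Sp r is the group Sp_{2r} over C *)
Definition Sp r : set 'M[C]_(r + r) :=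
  [set A | A^T *m symp_form r *m A = symp_form r].
Arguments Sp : clear implicits.

(* The maximal torus of the diag(t_1, ..., t_r, t_1^-1, ..., t_r^-1), to be
   used with all t_i nonzero. *)
Definition torus_mx r (t : 'rV[C]_r) : 'M[C]_(r + r) :=
  block_mx (diag_mx t) 0 0 (diag_mx (map_mx GRing.inv t)).

(* The unipotent radical of the Borel subgroup stabilizing the flag
   <e_1> < <e_1, e_2> < ... < <e_1, ..., e_r>; its roots are the
   eps_i - eps_j (i < j), eps_i + eps_j and 2 eps_i. *)
Definition unipotent r : set 'M[C]_(r + r) :=
  [set A | [/\ Sp r A, dlsubmx A = 0
     & forall i j : 'I_r, (j <= i)%N -> ulsubmx A i j = (i == j)%:R]].
Arguments unipotent : clear implicits.

(* Weights of Sp r are written in the basis eps_1, ..., eps_r of characters of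
   the torus. *)
Definition weight_val r (lam : 'rV[int]_r) (t : 'rV[C]_r) : C :=
  \prod_(i < r) t ord0 i ^ lam ord0 i.

(* k-th fundamental weight eps_1 + ... + eps_k, for 1 <= k <= r *)
Definition fund_weight r (k : nat) : 'rV[int]_r := \row_(i < r) (i < k)%N%:R.

(* P^+ is the monoid generated by the fundamental weights *)
Definition dominant r (lam : 'rV[int]_r) : Prop :=
  exists c : 'I_r -> nat, lam = \sum_(i < r) fund_weight r i.+1 *+ c i.

(* Sp_{2k} x Sp_{2l} -> Sp_{2(k+l)}: orthogonal direct sum.  A acts on
   e_1, ..., e_k, f_1, ..., f_k and B on the remaining e_i, f_i. *)
Definition symp_sum k l (A : 'M[C]_(k + k)) (B : 'M[C]_(l + l)) :
    'M[C]_((k + l) + (k + l)) :=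
  block_mx (block_mx (ulsubmx A) 0 0 (ulsubmx B))
           (block_mx (ursubmx A) 0 0 (ursubmx B))
           (block_mx (dlsubmx A) 0 0 (dlsubmx B))
           (block_mx (drsubmx A) 0 0 (drsubmx B)).

Definition cast_symp k r (e : k = r) (A : 'M[C]_(k + k)) : 'M[C]_(r + r) :=
  castmx (congr1 (fun i => (i + i)%N) e, congr1 (fun i => (i + i)%N) e) A.

Lemma pred_addn1 m : (1 < m)%N -> (m.-1 + 1)%N = m.
Proof. by move=> m_gt1; rewrite addn1 prednK // ltnW. Qed.

Lemma add1n_pred n : (1 < n)%N -> (1 + n.-1)%N = n.
Proof. by move=> n_gt1; rewrite add1n prednK // ltnW. Qed.

End SymplecticGroups.
Arguments Sp R r _ : clear implicits.
Arguments unipotent R r _ : clear implicits.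

Section SphericalPair.
Variables (R : realType) (m n : nat).
Hypotheses (hm : (1 < m)%N) (hn : (1 < n)%N).
Local Notation C := (complex R).
Local Notation N := ((m + m) + (n + n))%N.

Definition G_mx (A : 'M[C]_(m + m)) (B : 'M[C]_(n + n)) : 'M[C]_N :=
  block_mx A 0 0 B.

Definition G : set 'M[C]_N := [set G_mx A B | A in Sp R m & B in Sp R n].

(* The middle Sp_2 occurs in both factors of G. *)
Definition H_mx (A : 'M[C]_(m.-1 + m.-1)) (B : 'M[C]_(1 + 1))
    (D : 'M[C]_(n.-1 + n.-1)) : 'M[C]_N :=
  G_mx (cast_symp (pred_addn1 hm) (symp_sum A B))
       (cast_symp (add1n_pred hn) (symp_sum B D)).

Definition H : set 'M[C]_N :=
  [set X | exists A B D,
     [/\ Sp R m.-1 A, Sp R 1 B, Sp R n.-1 D & X = H_mx A B D]].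

Definition weightG : zmodType := ('rV[int]_m * 'rV[int]_n)%type.
Definition weightH : zmodType :=
  ('rV[int]_m.-1 * 'rV[int]_1 * 'rV[int]_n.-1)%type.

Definition dominantG (lam : weightG) : Prop :=
  dominant lam.1 /\ dominant lam.2.

Definition highest_weightG d (rho : 'M[C]_N -> 'M[C]_d) (lam : weightG)
    : Prop :=
  exists v : 'cV[C]_d,
    [/\ v <> 0,
        forall A B, unipotent R m A -> unipotent R n B ->
          rho (G_mx A B) *m v = v
      & forall (s : 'rV[C]_m) (t : 'rV[C]_n),
          (forall i, s ord0 i != 0) -> (forall i, t ord0 i != 0) ->
          rho (G_mx (torus_mx s) (torus_mx t)) *m v =
            (weight_val lam.1 s * weight_val lam.2 t) *: v].

Definition highest_weightH d (sigma : 'M[C]_N -> 'M[C]_d) (mu : weightH)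
    : Prop :=
  exists v : 'cV[C]_d,
    [/\ v <> 0,
        forall A B D, unipotent R m.-1 A -> unipotent R 1 B ->
          unipotent R n.-1 D -> sigma (H_mx A B D) *m v = v
      & forall (s : 'rV[C]_m.-1) (t : 'rV[C]_1) (u : 'rV[C]_n.-1),
          (forall i, s ord0 i != 0) -> (forall i, t ord0 i != 0) ->
          (forall i, u ord0 i != 0) ->
          sigma (H_mx (torus_mx s) (torus_mx t) (torus_mx u)) *m v =
            (weight_val mu.1.1 s * weight_val mu.1.2 t * weight_val mu.2 u)
              *: v].

(* The irreducible representations rho and sigma are determined up to
   isomorphism by their highest weights. *)
Definition multiplicityGH (lam : weightG) (mu : weightH) (k : nat) : Prop :=
  exists (d e : nat) (rho : 'M[C]_N -> 'M[C]_d) (sigma : 'M[C]_N -> 'M[C]_e),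
    [/\ irreducible_rep G rho, highest_weightG rho lam,
        irreducible_rep H sigma, highest_weightH sigma mu
      & has_multiplicity H rho sigma k].

Definition PG (mu : weightH) : set weightG :=
  [set lam | dominantG lam /\ multiplicityGH lam mu 1].

End SphericalPair.
Arguments PG R {m n} hm hn mu _.

Section Weights.
Variables m n : nat.

Definition genG (abc : nat * nat * nat) : weightG m n :=
  ((fund_weight m 1, fund_weight n 1) : weightG m n) *+ abc.1.1
  + ((fund_weight m 2, 0) : weightG m n) *+ abc.1.2
  + ((0, fund_weight n 2) : weightG m n) *+ abc.2.

Definition muH (l : nat) : weightH m n := (0, fund_weight 1 1 *+ l, 0).

Definition Bmu (l : nat) : set (weightG m n) :=
  [set x | exists l1 l2 : nat, (l1 + l2)%N = l /\
     x = (fund_weight m 1 *+ l1, fund_weight n 1 *+ l2)].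

End Weights.
Arguments Bmu m n l _ : clear implicits.

(* Main.v *)
Require Import Defs.
From mathcomp Require Import all_boot all_order all_algebra.
From mathcomp Require Import complex mxtens mpoly ring zify.
From mathcomp Require Import boolp classical_sets functions reals.

Set Implicit Arguments.
Unset Strict Implicit.
Unset Printing Implicit Defensive.

Import Order.TTheory GRing.Theory Num.Theory.
Local Open Scope classical_set_scope.
Local Open Scope ring_scope.

(** Let w be an H-highest weight vector of weight (0, l omega, 0) in an
    irreducible representation rho of G, let xi be a functional that is
    semi-invariant of weight lambda under the opposite Borel subgroup B^-, and
    put f(g) = xi (rho(g) w). As w is fixed by Sp_{2m-2} x Sp_{2n-2} and is
    semi-invariant under the diagonal Borel subgroup of Sp_2, f(A, B) depends
    only on the images of a hyperbolic pair (e, f) under A and under B. Generic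
    pairs lie in the B^- -orbits of a one-parameter family of standard pairs.
    In the difference z of the two parameters, f is a polynomial, which the
    diagonal torus of Sp_2 forces to be a monomial c z^a with
    l + 2 a = p + p', where p and p' are the coefficients of varpi_1 and
    varpi_1' in lambda. Hence f is determined by its value at one base point
    g0, so w is unique up to a scalar. As f has no pole along a curve through a
    Weyl element of either copy of Sp_2, a <= p and a <= p' (Clebsch-Gordan),
    and the stabilizers of the standard pairs in the torus exclude all
    fundamental weights but the first two on each side.

    Conversely, the three generators of the weight monoid and the two standard
    representations come with explicit H-semi-invariant vectors whose
    coefficient at g0 is non-zero. Their tensor products are stable under the
    conjugate transpose. Orthogonal complements therefore split off an
    irreducible G-component of weight lambda with non-zero coefficient and
    decompose its restriction to H. By uniqueness of w the multiplicity is
    exactly one. *)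

(** Zariski density is replaced by polynomials in one variable: an identity that holds on a line
    [1 + t X] off the roots of a nonzero polynomial holds on the whole line. Density statements
    therefore become induction principles closed under such lines, and limits become values of
    polynomial curves at 0. Complete reducibility is obtained only where it is needed, from
    invariant complements in explicit representations stable under the conjugate transpose.

    The exponent a is the number of copies of (varpi_1, varpi_1') in lambda: up to scalars, the
    spherical function of this generator is z, while those of the other two generators and of the
    two standard representations do not depend on z. This leaves l_1 = p - a and l_2 = p' - a, whose
    sum is l. The relation l + 2 a = p + p' alone does not bound a by p and p'; the two curves
    through Weyl elements supply these bounds. The base point g0 has z = 1, where no monomial c z^a
    with c nonzero vanishes. *)

(** * Polynomial functions, polynomial curves of matrices and regular functions *)

Section PolynomialFunctions.
Variable F : numFieldType.
Implicit Types (h g : F -> F) (p q : {poly F}).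

Definition polyfun h := exists p, forall t, h t = p.[t].

Lemma eq_polyfun h g : h =1 g -> polyfun h -> polyfun g.
Proof. by move=> hg [p hp]; exists p => t; rewrite -hg. Qed.

Lemma polyfun_const c : polyfun (fun=> c).
Proof. by exists c%:P => t; rewrite hornerC. Qed.

Lemma polyfun_id : polyfun (fun t => t).
Proof. by exists 'X => t; rewrite hornerX. Qed.

Lemma polyfunD h g : polyfun h -> polyfun g -> polyfun (fun t => h t + g t).
Proof. by move=> [p hp] [q gq]; exists (p + q) => t; rewrite hornerD hp gq. Qed.

Lemma polyfunM h g : polyfun h -> polyfun g -> polyfun (fun t => h t * g t).
Proof. by move=> [p hp] [q gq]; exists (p * q) => t; rewrite hornerM hp gq. Qed.

Lemma polyfunX h n : polyfun h -> polyfun (fun t => h t ^+ n).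
Proof. by move=> [p hp]; exists (p ^+ n) => t; rewrite horner_exp hp. Qed.

Lemma polyfun_sum (I : Type) (r : seq I) (h : I -> F -> F) :
  (forall i, polyfun (h i)) -> polyfun (fun t => \sum_(i <- r) h i t).
Proof.
move=> ph; elim: r => [|i r IHr].
  by apply: eq_polyfun (polyfun_const 0) => t; rewrite big_nil.
by apply: eq_polyfun (polyfunD (ph i) IHr) => t; rewrite big_cons.
Qed.

Lemma polyfun_prod (I : Type) (r : seq I) (h : I -> F -> F) :
  (forall i, polyfun (h i)) -> polyfun (fun t => \prod_(i <- r) h i t).
Proof.
move=> ph; elim: r => [|i r IHr].
  by apply: eq_polyfun (polyfun_const 1) => t; rewrite big_nil.
by apply: eq_polyfun (polyfunM (ph i) IHr) => t; rewrite big_cons.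
Qed.

Lemma poly_eq0_infinite p : (forall t, p.[t] = 0) -> p = 0.
Proof.
move=> p0; apply/eqP/negPn/negP => pn0.
pose s := [seq i%:R : F | i <- iota 0 (size p)].
have us : uniq s.
  by rewrite map_inj_uniq ?iota_uniq //; apply: mulrIn; rewrite oner_eq0.
have rs : all (root p) s by apply/allP => x _; rewrite /root p0.
by have := max_poly_roots pn0 rs us; rewrite size_map size_iota ltnn.
Qed.

(** The one-variable form of density: the product of the two polynomials has every scalar as a root,
    so it is zero. *)
Lemma polyfun_eq0 h q : q != 0 -> polyfun h ->
  (forall t, q.[t] != 0 -> h t = 0) -> forall t, h t = 0.
Proof.
move=> qn0 [p hp] h0 t; suff p0 : p = 0 by rewrite hp p0 horner0.
have /eqP : p * q = 0.
  apply: poly_eq0_infinite => x; rewrite hornerM.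
  have [->|/h0] := eqVneq q.[x] 0; first by rewrite mulr0.
  by rewrite hp => ->; rewrite mul0r.
by rewrite mulf_eq0 (negPf qn0) orbF => /eqP.
Qed.

Lemma polyfun_eq h g q : q != 0 -> polyfun h -> polyfun g ->
  (forall t, q.[t] != 0 -> h t = g t) -> h =1 g.
Proof.
move=> qn0 ph pg hg t; apply/eqP; rewrite -subr_eq0; apply/eqP.
rewrite -mulN1r; apply: (@polyfun_eq0 (fun t => h t + -1 * g t) q) t => //.
  by apply: polyfunD => //; apply: polyfunM => //; apply: polyfun_const.
by move=> x xq; rewrite hg // mulN1r subrr.
Qed.

(* Compare degrees in p * 'X^n = 'X^n q(1/'X) with n >= deg q. *)
Lemma polyfun_inv_const h g : polyfun h -> polyfun g ->
  (forall t, t != 0 -> h t = g t^-1) -> forall t, h t = h 0 /\ g t = h 0.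
Proof.
move=> [p hp] [q gq] hg; pose n := size q.
have pq t : t != 0 -> p.[t] * t ^+ n = (\poly_(j < n.+1) q`_(n - j)).[t].
  move=> tn0; rewrite -hp hg // gq horner_poly (@horner_coef_wide _ n.+1) ?leqnSn //.
  rewrite mulr_suml [RHS](reindex_inj rev_ord_inj) /=; apply: eq_bigr => i _.
  have le_in : (i <= n)%N by rewrite -ltnS.
  rewrite subSS subKn // -mulrA; congr (_ * _).
  have -> : t ^+ n = t ^+ (n - i) * t ^+ i by rewrite -exprD subnK.
  by rewrite mulrCA exprVn mulVf ?mulr1 // expf_neq0.
have eqpq : p * 'X^n = \poly_(j < n.+1) q`_(n - j).
  apply/eqP; rewrite -subr_eq0; apply/eqP/poly_eq0_infinite => t.
  apply: (@polyfun_eq0 (fun t => (p * 'X^n - \poly_(j < n.+1) q`_(n - j)).[t]) 'X).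
  - by rewrite polyX_eq0.
  - by exists (p * 'X^n - \poly_(j < n.+1) q`_(n - j)).
  - by move=> x; rewrite hornerX => /pq; rewrite !hornerE => ->; rewrite subrr.
have sp : (size p <= 1)%N.
  have [->|pn0] := eqVneq p 0; first by rewrite size_poly0.
  have := size_poly n.+1 (fun j => q`_(n - j)); rewrite -eqpq size_mulXn //.
  by rewrite -addn1 leq_add2l.
have hc t : h t = h 0 by rewrite !hp (size1_polyC sp) !hornerC.
move=> t; split=> //.
apply: (@polyfun_eq g (fun=> h 0) 'X); first by rewrite polyX_eq0.
- by exists q.
- exact: polyfun_const.
by move=> x; rewrite hornerX => xn0; rewrite -[x]invrK -hg ?invr_eq0.
Qed.

End PolynomialFunctions.

Section PolynomialCurves.
Variable F : numFieldType.

Definition mxcurve a b (Gam : F -> 'M[F]_(a, b)) :=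
  forall i j, polyfun (fun t => Gam t i j).

Lemma eq_mxcurve a b (Gam Del : F -> 'M[F]_(a, b)) :
  Gam =1 Del -> mxcurve Gam -> mxcurve Del.
Proof. by move=> GD cG i j; apply: eq_polyfun (cG i j) => t; rewrite GD. Qed.

Lemma mxcurve_const a b (A : 'M[F]_(a, b)) : mxcurve (fun=> A).
Proof. by move=> i j; apply: polyfun_const. Qed.

Lemma mxcurveZ a b (h : F -> F) (A : 'M[F]_(a, b)) :
  polyfun h -> mxcurve (fun t => h t *: A).
Proof.
move=> ph i j; apply: eq_polyfun (polyfunM ph (polyfun_const (A i j))) => t.
by rewrite mxE.
Qed.

Lemma mxcurveD a b (Gam Del : F -> 'M[F]_(a, b)) :
  mxcurve Gam -> mxcurve Del -> mxcurve (fun t => Gam t + Del t).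
Proof.
move=> cG cD i j; apply: eq_polyfun (polyfunD (cG i j) (cD i j)) => t.
by rewrite mxE.
Qed.

Lemma mxcurveM a b c (Gam : F -> 'M[F]_(a, b)) (Del : F -> 'M[F]_(b, c)) :
  mxcurve Gam -> mxcurve Del -> mxcurve (fun t => Gam t *m Del t).
Proof.
move=> cG cD i j.
apply: eq_polyfun (polyfun_sum (index_enum _)
  (fun k => polyfunM (cG i k) (cD k j))) => t.
by rewrite mxE.
Qed.

Lemma mxcurve_affine a b (A B : 'M[F]_(a, b)) :
  mxcurve (fun t => A + t *: B).
Proof.
apply: mxcurveD; first exact: mxcurve_const.
exact: mxcurveZ (polyfun_id F).
Qed.

Lemma mxcurve_block a b c d (A : F -> 'M[F]_(a, b)) (B : F -> 'M[F]_(a, c))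
    (D : F -> 'M[F]_(d, b)) (E : F -> 'M[F]_(d, c)) :
  mxcurve A -> mxcurve B -> mxcurve D -> mxcurve E ->
  mxcurve (fun t => block_mx (A t) (B t) (D t) (E t)).
Proof.
move=> cA cB cD cE i j; rewrite -(splitK i) -(splitK j).
case: (fintype.split i) (fintype.split j) => [i'|i'] [j'|j'] /=.
- by apply: eq_polyfun (cA i' j') => t; rewrite block_mxEul.
- by apply: eq_polyfun (cB i' j') => t; rewrite block_mxEur.
- by apply: eq_polyfun (cD i' j') => t; rewrite block_mxEdl.
- by apply: eq_polyfun (cE i' j') => t; rewrite block_mxEdr.
Qed.

Lemma mxcurve_eq a b (Gam Del : F -> 'M[F]_(a, b)) q : q != 0 ->
  mxcurve Gam -> mxcurve Del ->
  (forall t, q.[t] != 0 -> Gam t = Del t) -> Gam =1 Del.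
Proof.
move=> qn0 cG cD GD t; apply/matrixP => i j.
by apply: (polyfun_eq qn0 (cG i j) (cD i j)) => x /GD ->.
Qed.

(** [Gam] and [Del] are the two charts of a map from the projective line to an affine space, which
    has to be constant. *)
Lemma mxcurve_inv_const a b (Gam Del : F -> 'M[F]_(a, b)) :
  mxcurve Gam -> mxcurve Del -> (forall t, t != 0 -> Gam t = Del t^-1) ->
  forall t, Gam t = Gam 0 /\ Del t = Gam 0.
Proof.
move=> cG cD GD t.
have E i j := polyfun_inv_const (cG i j) (cD i j)
  (fun t tn0 => congr1 (fun A : 'M_(a, b) => A i j) (GD t tn0)) t.
by split; apply/matrixP => i j; case: (E i j).
Qed.

Lemma polyfun_meval n (p : {mpoly F[n]}) (h : 'I_n -> F -> F) :
  (forall i, polyfun (h i)) -> polyfun (fun t => p.@[fun i => h i t]).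
Proof.
move=> ph; apply: eq_polyfun (polyfun_sum (msupp p) (fun m =>
  polyfunM (polyfun_const p@_m)
    (polyfun_prod (index_enum _) (fun i => polyfunX (m i) (ph i))))) => t.
by rewrite mevalE.
Qed.

End PolynomialCurves.

Section RegularFunctions.
Variable R : realType.
Local Notation C := (complex R).
Variables (N : nat) (X : set 'M[C]_N).

(** The analysis of a given representation uses its regularity only in this form, restricted to
    polynomial curves in the group. *)
Lemma regular_curve f (Gam : C -> 'M[C]_N) : regular_on X f -> mxcurve Gam ->
  (forall t, X (Gam t)) -> polyfun (fun t => f (Gam t)).
Proof.
move=> [p fp] cG XG.
suff /(polyfun_meval p) : forall k, polyfun (fun t => mxvec (Gam t) ord0 k).
  by apply: eq_polyfun => t; rewrite fp.
move=> k; case/mxvec_indexP: k => i j.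
by apply: eq_polyfun (cG i j) => t; rewrite mxvecE.
Qed.

Lemma eq_regular f g : (forall A, X A -> f A = g A) ->
  regular_on X f -> regular_on X g.
Proof. by move=> fg [p fp]; exists p => A XA; rewrite -fg // fp. Qed.

Lemma regular_const c : regular_on X (fun=> c).
Proof. by exists c%:MP => A _; rewrite mevalC. Qed.

Lemma regular_entry i j : regular_on X (fun A => A i j).
Proof. by exists 'X_(mxvec_index i j) => A _; rewrite mevalXU mxvecE. Qed.

Lemma regularD f g : regular_on X f -> regular_on X g ->
  regular_on X (fun A => f A + g A).
Proof.
by move=> [p fp] [q gq]; exists (p + q) => A XA; rewrite mevalD fp ?gq.
Qed.

Lemma regularM f g : regular_on X f -> regular_on X g ->
  regular_on X (fun A => f A * g A).
Proof.
by move=> [p fp] [q gq]; exists (p * q) => A XA; rewrite mevalM fp ?gq.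
Qed.

Lemma regular_sum (I : Type) (r : seq I) (f : I -> 'M[C]_N -> C) :
  (forall i, regular_on X (f i)) -> regular_on X (fun A => \sum_(i <- r) f i A).
Proof.
move=> rf; elim: r => [|i r IHr].
  by apply: eq_regular (regular_const 0) => A _; rewrite big_nil.
by apply: eq_regular (regularD (rf i) IHr) => A _; rewrite big_cons.
Qed.

Definition regular_mx a b (r : 'M[C]_N -> 'M[C]_(a, b)) :=
  forall i j, regular_on X (fun A => r A i j).

Lemma regular_mx_const a b (A : 'M[C]_(a, b)) : regular_mx (fun=> A).
Proof. by move=> i j; apply: regular_const. Qed.

Lemma regular_mxM a b c (r : 'M[C]_N -> 'M[C]_(a, b))
    (s : 'M[C]_N -> 'M[C]_(b, c)) :
  regular_mx r -> regular_mx s -> regular_mx (fun A => r A *m s A).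
Proof.
move=> rr rs i j; apply: eq_regular (regular_sum (index_enum _)
  (fun k => regularM (rr i k) (rs k j))) => A _.
by rewrite mxE.
Qed.

Lemma regular_mx_curve a b (r : 'M[C]_N -> 'M[C]_(a, b)) (Gam : C -> 'M[C]_N) :
  regular_mx r -> mxcurve Gam -> (forall t, X (Gam t)) ->
  mxcurve (fun t => r (Gam t)).
Proof. by move=> rr cG XG i j; apply: regular_curve (rr i j) cG XG. Qed.

End RegularFunctions.

(** * Symplectic matrices and root elements *)

Section SymplecticMatrices.
Variable R : realType.
Local Notation C := (complex R).
Local Notation J := (symp_form R).

Lemma symp_form_sqr k : J k *m J k = - 1%:M.
Proof.
rewrite /symp_form mulmx_block !mul0mx !mulmx0 !addr0 ?add0r mul1mx mulmx1 ?add0r.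
by rewrite (@scalar_mx_block _ k k) opp_block_mx !oppr0.
Qed.

Lemma symp_form_tr k : (J k)^T = - J k.
Proof.
by rewrite /symp_form tr_block_mx opp_block_mx raddfN /= !trmx0 trmx1 !oppr0 opprK.
Qed.

Lemma SpM k (A B : 'M[C]_(k + k)) : Sp R k A -> Sp R k B -> Sp R k (A *m B).
Proof.
rewrite /Sp /= => SA SB; rewrite trmx_mul -!mulmxA (mulmxA (J k)) (mulmxA A^T).
by rewrite (mulmxA A^T) SA !mulmxA.
Qed.

Lemma Sp1 k : Sp R k 1%:M.
Proof. by rewrite /Sp /= trmx1 mul1mx mulmx1. Qed.

Lemma Sp_left_inverse k (A : 'M[C]_(k + k)) :
  Sp R k A -> (- (J k *m A^T *m J k)) *m A = 1%:M.
Proof. by rewrite /Sp /= => SA; rewrite mulNmx -!mulmxA (mulmxA A^T) SA symp_form_sqr opprK. Qed.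

Lemma Sp_unit k (A : 'M[C]_(k + k)) : Sp R k A -> A \in unitmx.
Proof. by move=> /Sp_left_inverse /mulmx1_unit[]. Qed.

Lemma Sp_inv k (A : 'M[C]_(k + k)) : Sp R k A -> Sp R k (invmx A).
Proof.
move=> SA; have uA := Sp_unit SA; rewrite /Sp /= -{1}SA trmx_inv.
by rewrite !mulmxA mulVmx ?unitmx_tr // mul1mx -mulmxA mulmxV // mulmx1.
Qed.

Lemma Sp_tr k (A : 'M[C]_(k + k)) : Sp R k A -> Sp R k A^T.
Proof.
move=> SA; rewrite /Sp /= trmxK.
have /mulmx1C := Sp_left_inverse SA; rewrite mulmxN !mulmxA => E.
have : (- (A *m J k *m A^T *m J k)) *m J k = J k by rewrite E mul1mx.
by rewrite mulNmx -!mulmxA symp_form_sqr !mulmxN mulmx1 opprK.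
Qed.

Lemma Sp_block k (a b c d : 'M[C]_k) :
  a^T *m c = c^T *m a -> b^T *m d = d^T *m b -> a^T *m d - c^T *m b = 1%:M ->
  Sp R k (block_mx a b c d).
Proof.
move=> ac bd ad; rewrite /Sp /= /symp_form tr_block_mx !mulmx_block.
rewrite !mulmx0 !mulmxN !mulmx1 !add0r !addr0 !mulNmx.
have da : d^T *m a - b^T *m c = 1%:M.
  by rewrite -[RHS]trmx1 -ad linearB /= !trmx_mul !trmxK.
by congr block_mx; rewrite ?ac ?bd 1?addrC ?subrr // -opprB -?da // opprB addrC.
Qed.

Lemma Sp_torus k (t : 'rV[C]_k) :
  (forall i, t ord0 i != 0) -> Sp R k (torus_mx t).
Proof.
move=> tn0; apply: Sp_block; rewrite ?trmx0 ?mul0mx ?mulmx0 ?subr0 //.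
rewrite tr_diag_mx mulmx_diag; apply/matrixP => i j.
by rewrite !mxE mulfV.
Qed.

Lemma torus_mxM k (s t : 'rV[C]_k) :
  torus_mx s *m torus_mx t = torus_mx (\row_i (s ord0 i * t ord0 i)).
Proof.
rewrite /torus_mx mulmx_block !mul0mx !mulmx0 !addr0 !add0r !mulmx_diag.
by congr block_mx; congr diag_mx; apply/rowP => i; rewrite !mxE // invfM.
Qed.

Lemma unipotentE k (a b c d : 'M[C]_k) :
  unipotent R k (block_mx a b c d) <->
  [/\ Sp R k (block_mx a b c d), c = 0
    & forall i j : 'I_k, (j <= i)%N -> a i j = (i == j)%:R].
Proof. by rewrite /unipotent /= block_mxKdl block_mxKul. Qed.

Lemma unipotent1 k : unipotent R k 1%:M.
Proof.
rewrite (@scalar_mx_block _ k k); apply/unipotentE; split=> //.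
  by rewrite -scalar_mx_block; apply: Sp1.
by move=> i j _; rewrite mxE.
Qed.

Lemma unipotentM k (A B : 'M[C]_(k + k)) :
  unipotent R k A -> unipotent R k B -> unipotent R k (A *m B).
Proof.
rewrite -[A]submxK -[B]submxK => /unipotentE[SA A0 A1] /unipotentE[SB B0 B1].
have := SpM SA SB; rewrite mulmx_block A0 B0 !mul0mx !mulmx0 !addr0 !add0r => SAB.
apply/unipotentE; split=> // i j le_ji; rewrite mxE (bigD1 j) //=.
rewrite B1 // eqxx mulr1 A1 // big1 ?addr0 // => l nlj.
have [le_li|lt_il] := leqP l i.
  rewrite A1 //; have [eil|] := eqVneq i l; last by rewrite mul0r.
  by rewrite -eil in nlj *; rewrite B1 // (negPf nlj) mulr0.
by rewrite B1 ?(ltnW (leq_ltn_trans le_ji lt_il)) // (negPf nlj) mulr0.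
Qed.

Lemma unipotent_Sp k (A : 'M[C]_(k + k)) : unipotent R k A -> Sp R k A.
Proof. by case. Qed.

Definition upper_mx k (s : 'M[C]_k) : 'M[C]_(k + k) := block_mx 1%:M s 0 1%:M.

(** The image in the Levi subgroup GL_k of the transvection 1 + c d^T. When d^T c = 0, the lower
    block is its inverse transpose. *)
Definition levi_mx k (c d : 'cV[C]_k) : 'M[C]_(k + k) :=
  block_mx (1%:M + c *m d^T) 0 0 (1%:M - d *m c^T).

Lemma unipotent_upper k (s : 'M[C]_k) : s^T = s -> unipotent R k (upper_mx s).
Proof.
move=> sT; apply/unipotentE; split=> [|//|i j _]; last by rewrite mxE.
by apply: Sp_block; rewrite ?trmx0 ?trmx1 ?mul0mx ?mulmx0 ?mul1mx ?mulmx1 ?sT ?subr0.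
Qed.

Lemma levi_Sp k (c d : 'cV[C]_k) : d^T *m c = 0 -> Sp R k (levi_mx c d).
Proof.
move=> dc; apply: Sp_block; rewrite ?trmx0 ?mul0mx ?mulmx0 ?subr0 //.
have cd : c^T *m d = 0 by rewrite -[RHS]trmx0 -dc trmx_mul trmxK.
rewrite [_^T]raddfD /= trmx1 trmx_mul trmxK mulmxDl mul1mx mulmxBr mulmx1.
by rewrite !mulmxA -(mulmxA d) cd mulmx0 mul0mx subr0 subrK.
Qed.

Lemma levi_tr k (c d : 'cV[C]_k) : (levi_mx c d)^T = levi_mx d c.
Proof.
by rewrite /levi_mx tr_block_mx !trmx0 [_^T]raddfD [X in block_mx _ _ _ X]raddfB /= trmx1 !trmx_mul !trmxK.
Qed.

Lemma cV_mul_tr k (c d : 'cV[C]_k) i j : (c *m d^T) i j = c i ord0 * d j ord0.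
Proof. by rewrite mxE big_ord1 mxE. Qed.

Lemma unipotent_levi k (c d : 'cV[C]_k) :
  (forall i j : 'I_k, (j <= i)%N -> c i ord0 * d j ord0 = 0) ->
  unipotent R k (levi_mx c d).
Proof.
move=> cd; apply/unipotentE; split=> // [|i j le_ji].
  apply: levi_Sp; apply/matrixP => i j; rewrite !ord1 !mxE big1 // => l _.
  by rewrite !mxE mulrC cd.
by rewrite mxE cV_mul_tr cd // addr0 mxE.
Qed.

(** A symmetric matrix with prescribed i-th column v, zero outside row and column i. With it
    [upper_mx] sends f_i to f_i plus the vector v of the e-space. *)
Definition sym_col k (i : 'I_k) (v : 'cV[C]_k) : 'M[C]_k :=
  \matrix_(a, b) (if b == i then v a ord0 else if a == i then v b ord0 else 0).

Lemma sym_col_tr k i (v : 'cV[C]_k) : (sym_col i v)^T = sym_col i v.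
Proof. by apply/matrixP => a b; rewrite !mxE; case: (a =P i) => [?|_]; case: (b =P i) => [?|_]; subst. Qed.

Lemma sym_colE k i (v : 'cV[C]_k) : sym_col i v *m delta_mx i ord0 = v.
Proof. by rewrite -colE; apply/colP => a; rewrite !mxE eqxx. Qed.

End SymplecticMatrices.

Lemma scale_cancel (F : fieldType) (V : lmodType F) (a : F) (x y : V) :
  a != 0 -> x + a *: (- a^-1 *: (x - y)) = y.
Proof.
by move=> an0; rewrite scalerA mulrN mulfV // scaleN1r opprB addrC subrK.
Qed.

(** * Hyperbolic pairs modulo the opposite Borel subgroup *)

Section NormalForms.
Variable R : realType.
Local Notation C := (complex R).
Local Notation J := (symp_form R).

(** Transposition exchanges a Borel subgroup containing the diagonal torus with its opposite, so
    this is U^-. *)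
Definition lowuni k (A : 'M[C]_(k + k)) := unipotent R k A^T.

Definition omega k (x y : 'cV[C]_(k + k)) : C := (x^T *m J k *m y) ord0 ord0.

Lemma omega_Sp k (A : 'M[C]_(k + k)) x y :
  Sp R k A -> omega (A *m x) (A *m y) = omega x y.
Proof.
rewrite /Sp /= /omega => SA.
by rewrite trmx_mul -!mulmxA (mulmxA (J k)) (mulmxA A^T) (mulmxA A^T) SA !mulmxA.
Qed.

Lemma omega_col k (a b c d : 'cV[C]_k) :
  omega (col_mx a b) (col_mx c d) = (a^T *m d) ord0 ord0 - (b^T *m c) ord0 ord0.
Proof.
rewrite /omega /symp_form tr_col_mx mul_row_block mul_row_col.
by rewrite !mulmx0 mulmx1 mulmxN mulmx1 add0r addr0 mulNmx addrC !mxE.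
Qed.

Lemma mxE_delta k (i : 'I_k) (v : 'cV[C]_k) :
  ((delta_mx i ord0 : 'cV_k)^T *m v) ord0 ord0 = v i ord0.
Proof. by rewrite trmx_delta -rowE mxE. Qed.

Lemma lowuni1 k : lowuni (1%:M : 'M[C]_(k + k)).
Proof. by rewrite /lowuni trmx1; apply: unipotent1. Qed.

Lemma lowuniM k (A B : 'M[C]_(k + k)) : lowuni A -> lowuni B -> lowuni (A *m B).
Proof. by move=> uA uB; rewrite /lowuni trmx_mul; apply: unipotentM. Qed.

Lemma lowuni_Sp k (A : 'M[C]_(k + k)) : lowuni A -> Sp R k A.
Proof. by move=> /unipotent_Sp/Sp_tr; rewrite trmxK. Qed.

Lemma lowuni_upper k (s : 'M[C]_k) : s^T = s -> lowuni (upper_mx s)^T.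
Proof. by rewrite /lowuni trmxK; apply: unipotent_upper. Qed.

Lemma lowuni_levi k (c d : 'cV[C]_k) :
  (forall i j : 'I_k, (j <= i)%N -> d i ord0 * c j ord0 = 0) ->
  lowuni (levi_mx c d).
Proof. by rewrite /lowuni levi_tr; apply: unipotent_levi. Qed.

Lemma upper_col k (s : 'M[C]_k) (a b : 'cV_k) :
  upper_mx s *m col_mx a b = col_mx (a + s *m b) b.
Proof. by rewrite mul_block_col !mul1mx mul0mx add0r. Qed.

Lemma upper_tr_col k (s : 'M[C]_k) (a b : 'cV_k) :
  (upper_mx s)^T *m col_mx a b = col_mx a (s^T *m a + b).
Proof. by rewrite tr_block_mx !trmx1 trmx0 mul_block_col !mul1mx mul0mx addr0. Qed.

Lemma mul_dot k (c d a : 'cV[C]_k) :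
  c *m d^T *m a = (d^T *m a) ord0 ord0 *: c.
Proof. by rewrite -mulmxA {1}[d^T *m a]mx11_scalar mul_mx_scalar. Qed.

Lemma levi_col k (c d a b : 'cV[C]_k) :
  levi_mx c d *m col_mx a b =
  col_mx (a + (d^T *m a) ord0 ord0 *: c) (b - (c^T *m b) ord0 ord0 *: d).
Proof.
by rewrite mul_block_col !mul0mx addr0 add0r mulmxDl mulmxBl !mul1mx !mul_dot.
Qed.

Lemma torus_col k (t : 'rV[C]_k) (a b : 'cV_k) :
  torus_mx t *m col_mx a b =
  col_mx (\col_i (t ord0 i * a i ord0)) (\col_i ((t ord0 i)^-1 * b i ord0)).
Proof.
rewrite mul_block_col !mul0mx addr0 add0r !mul_diag_mx.
by congr col_mx; apply/colP => i; rewrite !mxE.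
Qed.

Lemma lowuni_top k (u : 'M[C]_(k + k)) (x : 'cV_(k + k)) :
  lowuni u -> usubmx (u *m x) = ulsubmx u *m usubmx x.
Proof.
move=> [_ ur0 _]; rewrite -{1}[u]submxK -{1}[x]vsubmxK mul_block_col col_mxKu.
suff -> : ursubmx u = 0 by rewrite mul0mx addr0.
by apply: trmx_inj; rewrite trmx_ursub ur0 trmx0.
Qed.

Lemma lowuni_ul k (u : 'M[C]_(k + k)) (i j : 'I_k) :
  lowuni u -> (i <= j)%N -> ulsubmx u i j = (i == j)%:R.
Proof.
by move=> [_ _ u1] /u1; rewrite eq_sym => <-; rewrite !mxE.
Qed.

Local Notation top x i := (usubmx x i ord0).

(** Elimination with pivot x_0: a lower Levi transvection clears the other e-coordinates, then a
    lower symmetric block clears all f-coordinates. *)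
Lemma normalize_first k (x : 'cV[C]_(k.+1 + k.+1)) : top x ord0 != 0 ->
  exists2 u, lowuni u & u *m x = col_mx (top x ord0 *: delta_mx ord0 ord0) 0.
Proof.
move: (usubmx x) (dsubmx x) (vsubmxK x) => xe xf <- xn0.
set a := xe ord0 ord0 in xn0 *; pose e0 : 'cV[C]_k.+1 := delta_mx ord0 ord0.
pose c := - a^-1 *: (xe - a *: e0).
pose xf' := xf - (c^T *m xf) ord0 ord0 *: e0.
pose s := sym_col ord0 (- a^-1 *: xf').
exists ((upper_mx s)^T *m levi_mx c e0).
  apply: lowuniM; first by apply/lowuni_upper/sym_col_tr.
  apply: lowuni_levi => i j le_ji; rewrite !mxE eqxx andbT.
  have [i0|] := eqVneq i ord0; last by rewrite mul0r.
  move: le_ji; rewrite i0 leqn0 => /eqP j0.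
  by rewrite (_ : j = ord0) ?eqxx ?mulr1 ?subrr ?mulr0 //; apply: val_inj.
rewrite -mulmxA levi_col mxE_delta -/a -/xf' upper_tr_col sym_col_tr.
rewrite scale_cancel //.
congr col_mx; rewrite -scalemxAr sym_colE scalerA mulrN mulfV // scaleN1r.
by rewrite addNr.
Qed.

(** The same elimination with pivot y_1, by elements that fix the line of e_0. The condition v_0 = 0
    gives [se0], so the first vector stays put; the price is that the f_0-coordinate of y cannot be
    cleared. *)
Lemma normalize_second k (a : C) (ye yf : 'cV[C]_k.+2) :
  let e0 := delta_mx ord0 ord0 : 'cV[C]_k.+2 in
  let i1 := lift ord0 ord0 : 'I_k.+2 in
  let e1 := delta_mx i1 ord0 : 'cV[C]_k.+2 in
  ye i1 ord0 != 0 ->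
  exists u, [/\ lowuni u, u *m col_mx (a *: e0) 0 = col_mx (a *: e0) 0 &
    u *m col_mx ye yf = 
      col_mx (ye ord0 ord0 *: e0 + ye i1 ord0 *: e1) (yf ord0 ord0 *: e0)].
Proof.
move=> e0 i1 e1; set b := ye ord0 ord0; set d := ye i1 ord0 => dn0.
pose c := - d^-1 *: (ye - (b *: e0 + d *: e1)).
have c0 : c ord0 ord0 = 0 by rewrite !mxE /= mulr1 mulr0 addr0 subrr mulr0.
have c1 : c i1 ord0 = 0 by rewrite !mxE /= mulr1 mulr0 add0r subrr mulr0.
pose yf' := yf - (c^T *m yf) ord0 ord0 *: e1.
pose v := - d^-1 *: (yf' - yf ord0 ord0 *: e0).
have v0 : v ord0 ord0 = 0.
  have yf'0 : yf' ord0 ord0 = yf ord0 ord0.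
    by rewrite mxE [X in _ + X]mxE [X in - X]mxE [e1 _ _]mxE mulr0 subr0.
  have t0 : (yf' - yf ord0 ord0 *: e0) ord0 ord0 = 0.
    by rewrite mxE yf'0 [X in _ + X]mxE [X in - X]mxE [e0 _ _]mxE mulr1 subrr.
  by rewrite /v; move: (- d^-1) => t; rewrite mxE t0 mulr0.
pose s := sym_col i1 v.
have se0 : s *m e0 = 0.
  rewrite /s /e0 -colE; move: (v) v0 => w w0; apply/colP => i; rewrite !mxE /=.
  by case: eqP.
exists ((upper_mx s)^T *m levi_mx c e1); split.
- apply: lowuniM; first by apply/lowuni_upper/sym_col_tr.
  apply: lowuni_levi => i j le_ji; rewrite !mxE eqxx andbT.
  have [i0|] := eqVneq i i1; last by rewrite mul0r.
  have [->|jn0] := eqVneq j ord0; first by move: c0; rewrite !mxE => ->; rewrite mulr0.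
  suff -> : j = i1 by move: c1; rewrite !mxE => ->; rewrite mulr0.
  apply: val_inj; move: le_ji jn0; rewrite i0 /= -val_eqE /=.
  by case: (val j) => [|[]].
- have ee : (e1^T *m e0) ord0 ord0 = 0 by rewrite mxE_delta mxE.
  rewrite -mulmxA levi_col mulmx0 -scalemxAr [X in X *: c]mxE ee mulr0 scale0r addr0.
  by rewrite [X in X *: e1]mxE scale0r subr0 upper_tr_col sym_col_tr -scalemxAr se0 scaler0 addr0.
- rewrite -mulmxA levi_col mxE_delta -/d -/yf' upper_tr_col sym_col_tr.
  rewrite scale_cancel //; congr col_mx.
  rewrite mulmxDr -!scalemxAr se0 scaler0 add0r sym_colE addrC.
  exact: scale_cancel.
Qed.

Local Notation i1 := (lift ord0 ord0).

(** The standard pair is x = e_0 and y = z e_0 + e_1 + f_0. Its parameter z is the ratio of the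
    e_0-coordinates of y and x, which B^- preserves. *)
Definition std_x k : 'cV[C]_(k.+2 + k.+2) := col_mx (delta_mx ord0 ord0) 0.
Definition std_y k (z : C) : 'cV[C]_(k.+2 + k.+2) :=
  col_mx (z *: delta_mx ord0 ord0 + delta_mx i1 ord0) (delta_mx ord0 ord0).

(** The value at the bivector of x and y of the U^- -invariant functional attached to the second
    fundamental weight. *)
Definition minor2 k (x y : 'cV[C]_(k.+2 + k.+2)) : C :=
  top x ord0 * top y i1 - top x i1 * top y ord0.

Lemma minor2_low k (u : 'M[C]_(k.+2 + k.+2)) x y :
  lowuni u -> minor2 (u *m x) (u *m y) = minor2 x y.
Proof.
move=> lu; rewrite /minor2 !lowuni_top //.
have topE (w : 'cV[C]_k.+2) : (ulsubmx u *m w) ord0 ord0 = w ord0 ord0.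
  rewrite mxE big_ord_recl lowuni_ul // mul1r big1 ?addr0 // => i _.
  by rewrite lowuni_ul // mul0r.
have secE (w : 'cV[C]_k.+2) :
  (ulsubmx u *m w) i1 ord0 = ulsubmx u i1 ord0 * w ord0 ord0 + w i1 ord0.
  rewrite mxE 2!big_ord_recl [X in _ + (X * _ + _)]lowuni_ul // mul1r big1 ?addr0 // => i _.
  by rewrite lowuni_ul // mul0r.
by rewrite !topE !secE; ring.
Qed.

(** The U^- -invariants x_0, y_0 and [minor2] determine the normal form. The one f-coordinate that
    survives is forced to be 1/x_0 by [omega x y = 1], exactly what a torus element with first entry
    x_0 produces. *)
Lemma normalize_pair k (x y : 'cV[C]_(k.+2 + k.+2)) :
  omega x y = 1 -> top x ord0 != 0 -> minor2 x y != 0 ->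
  exists2 u, lowuni u & forall t : 'rV[C]_k.+2,
    t ord0 ord0 = top x ord0 -> t ord0 i1 = minor2 x y / top x ord0 ->
    u *m x = torus_mx t *m std_x k /\
    u *m y = torus_mx t *m std_y k (top y ord0 / top x ord0).
Proof.
move=> xy1 xn0 Dn0; have [u lu ux] := normalize_first xn0.
have := minor2_low x y lu; have := omega_Sp x y (lowuni_Sp lu).
have : top (u *m y) ord0 = top y ord0.
  rewrite lowuni_top // mxE big_ord_recl lowuni_ul // mul1r big1 ?addr0 // => i _.
  by rewrite lowuni_ul // mul0r.
rewrite ux; set a := top x ord0 in xn0 ux *.
rewrite xy1; set ye := usubmx (u *m y); set yf := dsubmx (u *m y).
have Euy : u *m y = col_mx ye yf by rewrite vsubmxK.
rewrite /minor2 Euy omega_col !col_mxKu; clearbody ye yf => ye0.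
rewrite linearZ /= -scalemxAl mxE.
rewrite mxE_delta trmx0 mul0mx [X in _ - X]mxE subr0 => yf0.
set D := top x ord0 * _ - _ => Ea.
have {Ea} ye1 : ye i1 ord0 = D / a.
  by rewrite -Ea !mxE /= !mulr1 mulr0 mul0r subr0 mulrC mulKf.
have yf0' : yf ord0 ord0 = a^-1 by apply: (mulfI xn0); rewrite yf0 mulfV.
have yen0 : ye i1 ord0 != 0 by rewrite ye1 mulf_neq0 ?invr_eq0.
have [u2 [lu2 u2x u2y]] := @normalize_second k a ye yf yen0.
exists (u2 *m u); first exact: lowuniM.
move=> t t0 t1; rewrite -!mulmxA ux u2x; split.
  rewrite torus_col; congr col_mx; apply/colP => i; rewrite !mxE ?mulr0 //.
  by have [->|] := eqVneq i ord0; rewrite ?t0 ?mulr0.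
rewrite Euy u2y torus_col ye0 ye1 yf0' -/D.
move: (top y ord0) (D / a) t1 => b d t1; congr col_mx; apply/colP => i; rewrite !mxE.
  have [->|_] := eqVneq i ord0; first by rewrite t0 /= !mulr0 !addr0 !mulr1 mulrCA mulfV ?mulr1.
  have [->|_] := eqVneq i i1; first by rewrite t1 /= !mulr0 !add0r.
  by rewrite /= !mulr0 addr0 mulr0.
have [->|_] := eqVneq i ord0; first by rewrite t0.
by rewrite /= !mulr0.
Qed.

Lemma upper_affine k (s : 'M[C]_k) t :
  1%:M + t *: block_mx 0 s 0 0 = upper_mx (t *: s).
Proof.
by rewrite (@scalar_mx_block _ k k) scale_block_mx add_block_mx !scaler0 !addr0 add0r.
Qed.

Lemma levi_affine k (c d : 'cV[C]_k) t :
  1%:M + t *: block_mx (c *m d^T) 0 0 (- (d *m c^T)) = levi_mx (t *: c) d.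
Proof.
rewrite (@scalar_mx_block _ k k) scale_block_mx add_block_mx !scaler0 !addr0.
by rewrite /levi_mx -scalemxAl linearZ /= -scalemxAr scalerN.
Qed.

(** If x_0 = 0, some other coordinate of x is nonzero, and a suitable line in U adds t times it to
    x_0: a symmetric block for an f-coordinate, a Levi transvection for an e-coordinate. *)
Lemma move_first k (x : 'cV[C]_(k.+1 + k.+1)) : x != 0 ->
  exists (X : 'M[C]_(k.+1 + k.+1)) (q : {poly C}),
  [/\ q != 0, forall t, unipotent R k.+1 (1%:M + t *: X)
    & forall t, q.[t] != 0 -> top ((1%:M + t *: X) *m x) ord0 != 0].
Proof.
move=> xn0; have [xe0|xe0] := eqVneq (top x ord0) 0; last first.
  exists 0, 1; rewrite oner_eq0; split=> [//|t|t _].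
    by rewrite scaler0 addr0; apply: unipotent1.
  by rewrite scaler0 addr0 mul1mx.
move: (usubmx x) (dsubmx x) (vsubmxK x) xn0 xe0 => xe xf <- xn0 xe0.
have [xf0|/eqP/colP/existsNP[i /eqP]] := eqVneq xf 0; last first.
  rewrite mxE => xfi; pose s := sym_col ord0 (delta_mx i ord0 : 'cV[C]_k.+1).
  exists (block_mx 0 s 0 0), 'X; split=> [|t|t].
  - by rewrite polyX_eq0.
  - rewrite upper_affine; apply: unipotent_upper.
    by rewrite linearZ /= sym_col_tr.
  - rewrite hornerX upper_affine upper_col col_mxKu mxE xe0 add0r => tn0.
    rewrite -scalemxAl mxE mulf_neq0 // -mxE_delta mulmxA.
    by rewrite -[s]sym_col_tr -trmx_mul sym_colE mxE_delta.
have [i xei] : exists i, xe i ord0 != 0.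
  apply: contrapT => /forallNP xe00; move: xn0; rewrite xf0.
  suff -> : xe = 0 by rewrite col_mx0 eqxx.
  by apply/colP => i; rewrite mxE; apply: contrapT => /eqP/xe00.
have in0 : i != ord0 by apply: contraNneq xei => ->; rewrite xe0.
pose e j : 'cV[C]_k.+1 := delta_mx j ord0.
exists (block_mx (e ord0 *m (e i)^T) 0 0 (- (e i *m (e ord0)^T))), 'X; split=> [|t|t].
- by rewrite polyX_eq0.
- rewrite levi_affine; apply: unipotent_levi => a b le_ba; rewrite !mxE eqxx !andbT.
  have [a0|] := eqVneq a ord0; last by rewrite mulr0 mul0r.
  move: le_ba; rewrite a0 leqn0 => /eqP b0.
  by rewrite (_ : b = ord0) 1?eq_sym ?(negPf in0) ?mulr0 //; apply: val_inj.
- rewrite hornerX levi_affine levi_col col_mxKu mxE xe0 add0r mxE_delta => tn0.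
  by rewrite !mxE !eqxx mulr1 mulf_neq0.
Qed.

(** The root group of eps_1 + eps_2 fixes e_0 and adds t y_{f_0} to the e_1-coordinate of y. As a
    y_{f_0} = omega x y = 1, the minor becomes a y_1 + t, which is [q]. *)
Lemma move_second k (a : C) (y : 'cV[C]_(k.+2 + k.+2)) :
  let x : 'cV[C]_(k.+2 + k.+2) := col_mx (a *: delta_mx ord0 ord0) 0 in
  a != 0 -> omega x y = 1 ->
  exists (X : 'M[C]_(k.+2 + k.+2)) (q : {poly C}),
  [/\ q != 0, forall t, unipotent R k.+2 (1%:M + t *: X),
      forall t, (1%:M + t *: X) *m x = x
    & forall t, q.[t] != 0 -> minor2 x ((1%:M + t *: X) *m y) != 0].
Proof.
rewrite /=; set x := col_mx _ _.
move=> an0; move: (usubmx y) (dsubmx y) (vsubmxK y) => ye yf <-.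
rewrite omega_col linearZ /= -scalemxAl mxE mxE_delta trmx0 mul0mx [X in _ - X]mxE.
rewrite subr0 => yf0.
pose s := sym_col ord0 (delta_mx i1 ord0 : 'cV[C]_k.+2).
have si1 : s *m delta_mx i1 ord0 = delta_mx ord0 ord0 :> 'cV[C]_k.+2.
  rewrite /s -colE; apply/colP => j; rewrite !mxE /= eqxx andbT.
  by case: eqP.
exists (block_mx 0 s 0 0), ((a * ye i1 ord0)%:P + 'X); split=> [|t|t|t].
- by rewrite -size_poly_eq0 addrC size_XaddC.
- rewrite upper_affine; apply: unipotent_upper.
  by rewrite linearZ /= sym_col_tr.
- by rewrite upper_affine upper_col mulmx0 addr0.
rewrite !hornerE upper_affine upper_col /minor2 !col_mxKu.
have syf : (t *: s *m yf) i1 ord0 = t * yf ord0 ord0.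
  rewrite -scalemxAl mxE -[(s *m yf) _ _]mxE_delta mulmxA.
  by rewrite -[s]sym_col_tr -trmx_mul si1 mxE_delta.
have -> : (ye + t *: s *m yf) i1 ord0 = ye i1 ord0 + t * yf ord0 ord0.
  by rewrite mxE syf.
rewrite !mxE /= mulr1 mulr0 mul0r subr0 mulrDr.
by rewrite mulrCA yf0 mulr1.
Qed.

Lemma omega_neq0 k (x y : 'cV[C]_(k + k)) : omega x y = 1 -> x != 0.
Proof.
move=> xy1; apply/eqP => x0; move: xy1.
by rewrite x0 /omega trmx0 !mul0mx mxE => /eqP; rewrite eq_sym oner_eq0.
Qed.

(* Generic pairs lie in the B^- -orbits of the pairs (std_x, std_y z); the
   others are limits of generic ones along the lines 1 + t X. *)
Lemma symp_pair_ind k (Z : 'cV[C]_(k.+2 + k.+2) -> 'cV[C]_(k.+2 + k.+2) -> Prop) :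
  (forall X x y (q : {poly C}), q != 0 ->
     (forall t, unipotent R k.+2 (1%:M + t *: X)) ->
     (forall t, q.[t] != 0 -> Z ((1%:M + t *: X) *m x) ((1%:M + t *: X) *m y)) ->
     Z x y) ->
  (forall u x y, lowuni u -> Z (u *m x) (u *m y) -> Z x y) ->
  (forall (t : 'rV[C]_k.+2) z, (forall i, t ord0 i != 0) ->
     Z (torus_mx t *m std_x k) (torus_mx t *m std_y k z)) ->
  forall x y, omega x y = 1 -> Z x y.
Proof.
move=> Zline Zlow Zstd.
have generic x y : omega x y = 1 -> top x ord0 != 0 -> minor2 x y != 0 -> Z x y.
  move=> xy1 xn0 Dn0; have [u lu uxy] := normalize_pair xy1 xn0 Dn0.
  (* Standard pairs involve only the first two indices, so the remaining entries of t merely have to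
     be nonzero. *)
  pose t : 'rV[C]_k.+2 := \row_i (if i == ord0 then top x ord0 else
    minor2 x y / top x ord0).
  have [||ux uy] := uxy t; [by rewrite mxE..|].
  apply: Zlow lu _; rewrite ux uy; apply: Zstd => i; rewrite mxE.
  by case: (i == ord0); rewrite ?mulf_neq0 ?invr_eq0.
have first x y : omega x y = 1 -> top x ord0 != 0 -> Z x y.
  move=> xy1 xn0; have [u lu ux] := normalize_first xn0.
  apply: (Zlow _ _ _ lu); have := omega_Sp x y (lowuni_Sp lu); rewrite ux xy1 => uxy.
  have [X [q [qn0 uX Xx Dq]]] := move_second xn0 uxy.
  apply: (Zline X _ _ q qn0 uX) => t qtn0; apply: generic.
  - by rewrite omega_Sp //; apply: unipotent_Sp.
  - by rewrite Xx col_mxKu mxE [X in _ * X]mxE mulr1.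
  - by rewrite Xx; apply: Dq.
move=> x y xy1; have [X [q [qn0 uX topq]]] := move_first (omega_neq0 xy1).
apply: (Zline X _ _ q qn0 uX) => t qtn0; apply: first; last exact: topq.
by rewrite omega_Sp //; apply: unipotent_Sp.
Qed.

Lemma std_Sp k z : exists2 g, Sp R k.+2 g &
  g *m std_x k = std_x k /\ g *m std_y k 0 = std_y k z.
Proof.
pose s := sym_col ord0 (z *: delta_mx ord0 ord0 : 'cV[C]_k.+2).
exists (upper_mx s); first exact/unipotent_Sp/unipotent_upper/sym_col_tr.
by rewrite !upper_col mulmx0 addr0 sym_colE scale0r add0r addrC.
Qed.

Lemma Sp_transitive k (x y : 'cV[C]_(k.+2 + k.+2)) : omega x y = 1 ->
  exists g, [/\ Sp R k.+2 g, g *m x = std_x k & g *m y = std_y k 0].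
Proof.
move: x y; apply: symp_pair_ind.
- move=> X x y q qn0 uX Zq.
  have [t /Zq[g [Sg gx gy]]] : exists t, q.[t] != 0.
    apply: contrapT => /forallNP q0; move/eqP: qn0; apply; apply: poly_eq0_infinite => t.
    by apply: contrapT => /eqP; apply: q0.
  exists (g *m (1%:M + t *: X)); split; rewrite -?mulmxA //.
  exact: SpM Sg (unipotent_Sp (uX t)).
- move=> u x y lu [g [Sg gx gy]]; exists (g *m u); split; rewrite -?mulmxA //.
  exact: SpM Sg (lowuni_Sp lu).
- move=> t z tn0; have [g Sg [gx gy]] := std_Sp k z.
  have S' : Sp R k.+2 (torus_mx t *m g) by apply: SpM => //; apply: Sp_torus.
  exists (invmx (torus_mx t *m g)); split; first exact: Sp_inv.
    by rewrite -{1}gx (mulmxA (torus_mx t)) mulKmx ?Sp_unit.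
  by rewrite -gy (mulmxA (torus_mx t)) mulKmx ?Sp_unit.
Qed.

End NormalForms.

(** * Orthogonal decompositions and stabilizers of summands *)

Section Embeddings.
Variable R : realType.
Local Notation C := (complex R).
Local Notation J := (symp_form R).

(* P and Q are the inclusions of the two summands of an orthogonal
   decomposition C^{2r} = C^{2k} + C^{2l} compatible with the bases. *)
Definition symp_split k l r (P : 'M[C]_(r + r, k + k)) (Q : 'M[C]_(r + r, l + l))
    : Prop :=
  [/\ P^T *m P = 1%:M, Q^T *m Q = 1%:M, P^T *m Q = 0
    & [/\ P *m P^T + Q *m Q^T = 1%:M, J r *m P = P *m J k & J r *m Q = Q *m J l]].

Definition incl1 k l : 'M[C]_((k + l) + (k + l), k + k) :=
  block_mx (col_mx 1%:M 0) 0 0 (col_mx 1%:M 0).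
Definition incl2 k l : 'M[C]_((k + l) + (k + l), l + l) :=
  block_mx (col_mx 0 1%:M) 0 0 (col_mx 0 1%:M).

Let mxsimp := (mul0mx, mulmx0, mul1mx, mulmx1, addr0, add0r, trmx0, trmx1,
  @mul_row_col, mulNmx, mulmxN).

Lemma symp_sum_incl k l (A : 'M[C]_(k + k)) (B : 'M[C]_(l + l)) :
  symp_sum A B = incl1 k l *m A *m (incl1 k l)^T + incl2 k l *m B *m (incl2 k l)^T.
Proof.
rewrite /symp_sum -{5}[A]submxK -{5}[B]submxK /incl1 /incl2.
rewrite !tr_block_mx !tr_col_mx !mulmx_block !mxsimp !mul_col_mx !mxsimp.
rewrite !mul_mx_row !mxsimp add_block_mx !add_col_mx !mxsimp.
by rewrite -!block_mxEv.
Qed.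

Lemma incl_split k l : symp_split (incl1 k l) (incl2 k l).
Proof.
rewrite /symp_split /incl1 /incl2 !tr_block_mx !tr_col_mx !mulmx_block !mxsimp.
rewrite !mul_col_row !mxsimp add_block_mx !add_block_mx !mxsimp -!scalar_mx_block.
by split=> //; rewrite block_mx0.
Qed.

Lemma cast_symp_split k l r (e : (k + l)%N = r) : exists P Q,
  symp_split P Q /\ forall (A : 'M[C]_(k + k)) (B : 'M[C]_(l + l)),
    cast_symp e (symp_sum A B) = P *m A *m P^T + Q *m B *m Q^T.
Proof.
case: r / e; exists (incl1 k l), (incl2 k l); split; first exact: incl_split.
by move=> A B; rewrite /cast_symp castmx_id symp_sum_incl.
Qed.

Section Split.
Variables (k l r : nat).
Variables (P : 'M[C]_(r + r, k + k)) (Q : 'M[C]_(r + r, l + l)).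
Hypothesis PQ : symp_split P Q.

Definition symp_emb (A : 'M[C]_(k + k)) (B : 'M[C]_(l + l)) :=
  P *m A *m P^T + Q *m B *m Q^T.

Lemma split_QP : Q^T *m P = 0.
Proof.
by case: PQ => _ _ PQ0 _; rewrite -[RHS]trmx0 -PQ0 trmx_mul trmxK.
Qed.

Lemma symp_embP A B : symp_emb A B *m P = P *m A.
Proof.
case: PQ => PP QQ PQ0 _; rewrite mulmxDl -!mulmxA PP split_QP !mulmx0 addr0.
by rewrite mulmx1.
Qed.

Lemma symp_embQ A B : symp_emb A B *m Q = Q *m B.
Proof.
case: PQ => PP QQ PQ0 _; rewrite mulmxDl -!mulmxA PQ0 QQ !mulmx0 add0r.
by rewrite mulmx1.
Qed.

Lemma symp_embM A B A' B' :
  symp_emb A B *m symp_emb A' B' = symp_emb (A *m A') (B *m B').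
Proof.
rewrite [symp_emb A' B']/symp_emb mulmxDr !mulmxA symp_embP symp_embQ.
by rewrite /symp_emb !mulmxA.
Qed.

Lemma symp_emb1 : symp_emb 1%:M 1%:M = 1%:M.
Proof. by case: PQ => _ _ _ [PQ1 _ _]; rewrite /symp_emb !mulmx1. Qed.

Lemma symp_emb_tr A B : (symp_emb A B)^T = symp_emb A^T B^T.
Proof. by rewrite /symp_emb [_^T]raddfD /= !trmx_mul !trmxK !mulmxA. Qed.

Lemma split_form : J r = symp_emb (J k) (J l).
Proof.
case: PQ => _ _ _ [PQ1 JP JQ].
by rewrite -[LHS]mulmx1 -PQ1 mulmxDr !mulmxA JP JQ.
Qed.

Lemma symp_emb_Sp A B : Sp R k A -> Sp R l B -> Sp R r (symp_emb A B).
Proof.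
by rewrite /Sp /= => SA SB; rewrite symp_emb_tr split_form !symp_embM SA SB.
Qed.

Lemma symp_embK1 A B : P^T *m symp_emb A B *m P = A.
Proof. by case: PQ => PP _ _ _; rewrite -mulmxA symp_embP mulmxA PP mul1mx. Qed.

(** As g preserves the form, fixing the columns of Q also fixes the covectors that the form attaches
    to them, so Q^T g = Q^T. Both facts together make g block diagonal. *)
Lemma Sp_fix_summand g : Sp R r g -> g *m Q = Q ->
  exists2 A, Sp R k A & g = symp_emb A 1%:M.
Proof.
move=> Sg gQ; case: (PQ) => PP QQ PQ0 [PQ1 JP JQ].
have Qg : Q^T *m g = Q^T.
  have : (J r *m Q)^T *m g = (J r *m Q)^T.
    rewrite /Sp /= in Sg; rewrite trmx_mul symp_form_tr -{1}gQ trmx_mul -!mulmxA.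
    rewrite mulNmx !mulmxN; congr (- _).
    by rewrite (mulmxA g^T) Sg.
  rewrite JQ trmx_mul symp_form_tr mulNmx => /(congr1 (fun X => J l *m X)).
  by rewrite !mulNmx !mulmxN -!mulmxA !mulmxA symp_form_sqr !mulNmx mul1mx !opprK.
pose A := P^T *m g *m P; have gE : g = symp_emb A 1%:M.
  rewrite /symp_emb mulmx1 /A !mulmxA.
  have -> : P *m P^T = 1%:M - Q *m Q^T by rewrite -PQ1 addrK.
  rewrite -(mulmxA _ P) (_ : P *m P^T = 1%:M - Q *m Q^T) ?mulmxBr; last first.
    by rewrite -PQ1 addrK.
  rewrite mulmx1 !mulmxBl mul1mx -(mulmxA Q) Qg -!mulmxA.
  rewrite (mulmxA g) gQ (mulmxA Q^T) QQ mul1mx subrr subr0.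
  by rewrite subrK.
exists A => //; move: Sg; rewrite gE /Sp /= symp_emb_tr split_form !symp_embM.
move=> E; rewrite -[LHS](symp_embK1 _ (1%:M^T *m J l *m 1%:M)) E.
exact: symp_embK1.
Qed.

(** For l = 1 this says that the coset of g modulo the first summand is known from the image of the
    hyperbolic pair. *)
Lemma symp_emb_mulQ g g' : Sp R r g -> Sp R r g' -> g *m Q = g' *m Q ->
  exists2 A, Sp R k A & g' = g *m symp_emb A 1%:M.
Proof.
move=> Sg Sg' gg'; have := @Sp_fix_summand (invmx g *m g').
case; first exact: SpM (Sp_inv Sg) Sg'.
  by rewrite -mulmxA -gg' mulKmx ?Sp_unit.
by move=> A SA gA; exists A => //; rewrite -gA mulKVmx ?Sp_unit.
Qed.

End Split.

Lemma symp_split_sym k l r (P : 'M[C]_(r + r, k + k)) (Q : 'M[C]_(r + r, l + l)) :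
  symp_split P Q -> symp_split Q P.
Proof.
move=> PQ; have QP := split_QP PQ; case: PQ => PP QQ PQ0 [PQ1 JP JQ].
by split=> //; split=> //; rewrite addrC.
Qed.

End Embeddings.

(** * Big cell, contraction of U^- and vectors of highest weight zero *)

Section Density.
Variable R : realType.
Local Notation C := (complex R).
Local Notation J := (symp_form R).

Lemma unipotent_symp_sum k l (A : 'M[C]_(k + k)) (B : 'M[C]_(l + l)) :
  unipotent R k A -> unipotent R l B -> unipotent R (k + l) (symp_sum A B).
Proof.
move=> [SA A0 A1] [SB B0 B1]; apply/unipotentE; split.
- rewrite -/(symp_sum A B) symp_sum_incl.
  exact: (symp_emb_Sp (incl_split R k l)).
- by rewrite A0 B0 block_mx0.
move=> i j; rewrite -(splitK i) -(splitK j).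
case: (fintype.split i) (fintype.split j) => [i'|i'] [j'|j'] /= le_ji.
- by rewrite block_mxEul A1 // (inj_eq (@lshift_inj _ _)).
- by rewrite block_mxEur mxE eq_lrshift.
- by rewrite block_mxEdl mxE eq_rlshift.
- by rewrite block_mxEdr B1 ?(inj_eq (@rshift_inj _ _)) // -(leq_add2l k).
Qed.

Lemma tr_symp_sum k l (A : 'M[C]_(k + k)) (B : 'M[C]_(l + l)) :
  (symp_sum A B)^T = symp_sum A^T B^T.
Proof. by rewrite !symp_sum_incl symp_emb_tr. Qed.

Lemma torus_symp_sum k l (s : 'rV[C]_k) (t : 'rV[C]_l) :
  symp_sum (torus_mx s) (torus_mx t) = torus_mx (row_mx s t).
Proof.
rewrite /torus_mx /symp_sum !block_mxKul !block_mxKur !block_mxKdl !block_mxKdr.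
rewrite block_mx0 map_row_mx; congr block_mx.
  by rewrite diag_mx_row.
by rewrite diag_mx_row.
Qed.

Lemma unipotent_fixing_e k (y : 'cV[C]_(k.+1 + k.+1)) :
  let e : 'cV[C]_(k.+1 + k.+1) := col_mx (delta_mx ord0 ord0) 0 in
  omega e y = 1 ->
  exists n, [/\ unipotent R k.+1 n, n *m e = e &
    n *m col_mx 0 (delta_mx ord0 ord0) = y].
Proof.
move: (usubmx y) (dsubmx y) (vsubmxK y) => ye yf <- /=.
rewrite omega_col mxE_delta trmx0 mul0mx [X in _ - X]mxE subr0 => yf0.
pose e0 : 'cV[C]_k.+1 := delta_mx ord0 ord0; pose c := e0 - yf.
have c0 : c ord0 ord0 = 0 by rewrite !mxE yf0 subrr.
have dc (w : 'cV[C]_k.+1) : (w^T *m e0) ord0 ord0 = w ord0 ord0.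
  by rewrite /e0 -colE !mxE.
(* The Levi factor applied afterwards adds c^T v to the e_0-coordinate, so this amount is subtracted
   in advance; c_0 = 0 keeps it unchanged by the correction. *)
pose v := ye - (c^T *m ye) ord0 ord0 *: e0.
have cv : (c^T *m v) ord0 ord0 = (c^T *m ye) ord0 ord0.
  rewrite /v mulmxBr -scalemxAr; set w := c^T *m ye; set z := c^T *m e0.
  by rewrite mxE [X in _ + X]mxE [X in _ - X]mxE /z dc c0 mulr0 subr0.
exists (levi_mx e0 c *m upper_mx (sym_col ord0 v)); split.
- apply: unipotentM; last exact/unipotent_upper/sym_col_tr.
  apply: unipotent_levi => i j le_ji; rewrite mxE eqxx andbT.
  have [i0|] := eqVneq i ord0; last by rewrite mul0r.
  move: le_ji; rewrite i0 leqn0 => /eqP j0.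
  by rewrite (_ : j = ord0) ?c0 ?mulr0 //; apply: val_inj.
- by rewrite -mulmxA upper_col mulmx0 addr0 levi_col dc c0 scale0r addr0 mulmx0
    [X in X *: c]mxE scale0r subr0.
- rewrite -mulmxA upper_col add0r sym_colE levi_col mxE_delta [X in X *: c]mxE eqxx.
  by rewrite scale1r subKr cv subrK.
Qed.

(* Density of the big cell U^- T U in Sp_2k, phrased for predicates closed
   under limits along lines of unipotent elements. *)
Lemma big_cell_ind k (Z : 'M[C]_(k + k) -> Prop) :
  (forall X g (q : {poly C}), q != 0 -> Sp R k g ->
     (forall t, Sp R k (1%:M + t *: X)) ->
     (forall t, q.[t] != 0 -> Z ((1%:M + t *: X) *m g)) -> Z g) ->
  (forall u g, lowuni u -> Sp R k g -> Z (u *m g) -> Z g) ->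
  (forall (t : 'rV[C]_k) g, (forall i, t ord0 i != 0) -> Sp R k g ->
     Z (torus_mx t *m g) -> Z g) ->
  (forall u g, unipotent R k u -> Sp R k g -> Z (g *m u) -> Z g) ->
  Z 1%:M -> forall g, Sp R k g -> Z g.
Proof.
elim: k Z => [|k IHk] Z Zline Zlow Ztor Zup Z1 g Sg.
  by rewrite (_ : g = 1%:M) //; apply/matrixP => -[].
pose e : 'cV[C]_(k.+1 + k.+1) := col_mx (delta_mx ord0 ord0) 0.
pose f : 'cV[C]_(k.+1 + k.+1) := col_mx 0 (delta_mx ord0 ord0).
have omef : omega e f = 1.
  by rewrite omega_col mxE_delta trmx0 mul0mx !mxE subr0.
(* The induction hypothesis is applied to the stabilizer of the plane of e and f; the remaining
   steps bring a general element into this stabilizer. *)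
have Zsub (A : 'M[C]_(k + k)) : Sp R k A -> Z (symp_sum (1%:M : 'M_(1 + 1)) A).
  pose E (B : 'M[C]_(k + k)) : 'M[C]_(k.+1 + k.+1) :=
    symp_sum (1%:M : 'M[C]_(1 + 1)) B.
  have EM A' B' : E A' *m E B' = E (A' *m B').
    by rewrite /E !symp_sum_incl (symp_embM (incl_split R 1 k)) mul1mx.
  have ES A' : Sp R k A' -> Sp R k.+1 (E A').
    rewrite /E symp_sum_incl; apply: (symp_emb_Sp (incl_split R 1 k)); exact: Sp1.
  have E1 : E 1%:M = 1%:M.
    by rewrite /E symp_sum_incl; apply: (symp_emb1 (incl_split R 1 k)).
  have EL X t : E (1%:M + t *: X) = 1%:M + t *: symp_emb (incl1 R 1 k) (incl2 R 1 k) 0 X.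
    rewrite -E1 /E !symp_sum_incl /symp_emb mulmx0 mul0mx add0r -addrA; congr (_ + _).
    by rewrite mulmxDr mulmxDl -scalemxAr -scalemxAl.
  apply: (IHk (fun A => Z (E A))) => {A}.
  - move=> X A q qn0 SA SX ZX.
    apply: (Zline (symp_emb (incl1 R 1 k) (incl2 R 1 k) 0 X) _ q) => //.
    + exact: ES.
    + by move=> t; rewrite -EL; apply: ES.
    + by move=> t qt; rewrite -EL EM; apply: ZX.
  - move=> u A lu SA; rewrite -EM; apply: Zlow; last exact: ES.
    rewrite /lowuni (tr_symp_sum (1%:M : 'M[C]_(1 + 1)) u) trmx1.
    by apply: (unipotent_symp_sum (unipotent1 R 1) lu).
  - move=> t A tn0 SA; rewrite -EM.
    have -> : E (torus_mx t) = torus_mx (row_mx (const_mx 1 : 'rV_1) t).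
      have t1 : 1%:M = torus_mx (const_mx 1 : 'rV[C]_1).
        by rewrite /torus_mx map_const_mx invr1 !diag_const_mx -scalar_mx_block.
      rewrite /E t1.
      exact: (torus_symp_sum (const_mx 1 : 'rV[C]_1) t).
    apply: Ztor (ES _ SA) => i; rewrite -(@splitK 1 k i).
    case: (@fintype.split 1 k i) => j /=; first by rewrite (row_mxEl (const_mx 1 : 'rV[C]_1) t ord0 j) mxE oner_eq0.
    by rewrite (row_mxEr (const_mx 1 : 'rV[C]_1) t ord0 j).
  - move=> u A uu SA; rewrite -EM; apply: Zup; last exact: ES.
    exact: (unipotent_symp_sum (unipotent1 R 1) uu).
  - by rewrite E1.
have Zfix g' : Sp R k.+1 g' -> g' *m e = e -> g' *m f = f -> Z g'.
  move=> Sg' ge gf; have iE : incl1 R 1 k = row_mx e f.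
    rewrite /incl1 block_mxEh; congr row_mx; congr col_mx.
      by apply/matrixP => i j; rewrite ord1 -(@splitK 1 k i); case: (@fintype.split 1 k i) => l /=;
        rewrite ?col_mxEu ?col_mxEd !mxE ?ord1.
    by apply/matrixP => i j; rewrite ord1 -(@splitK 1 k i); case: (@fintype.split 1 k i) => l /=;
        rewrite ?col_mxEu ?col_mxEd !mxE ?ord1.
  have [|A SA ->] := Sp_fix_summand (symp_split_sym (incl_split R 1 k)) Sg'.
    by rewrite iE mul_mx_row ge gf.
  by rewrite /symp_emb addrC -symp_sum_incl; apply: Zsub.
have Ze g' : Sp R k.+1 g' -> g' *m e = e -> Z g'.
  move=> Sg' ge; have : omega e (invmx g' *m f) = 1.
    by rewrite -(omega_Sp _ _ Sg') mulKVmx ?Sp_unit // ge.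
  move=> /unipotent_fixing_e[n [un ne nf]]; apply: (Zup n) => //.
  apply: Zfix; first exact: SpM (unipotent_Sp un).
    by rewrite -mulmxA ne.
  by rewrite -mulmxA nf mulKVmx ?Sp_unit.
have Ztop g' : Sp R k.+1 g' -> usubmx (g' *m e) ord0 ord0 != 0 -> Z g'.
  move=> Sg' gn0; have [u lu ux] := normalize_first gn0.
  apply: (Zlow _ _ lu) => //; set a := usubmx (g' *m e) ord0 ord0 in gn0 ux.
  apply: (Ztor (const_mx a^-1)).
  - by move=> i; rewrite mxE invr_eq0.
  - exact: SpM (lowuni_Sp lu) Sg'.
  apply: Ze; first apply: SpM; first apply: Sp_torus.
  - by move=> i; rewrite mxE invr_eq0.
  - exact: SpM (lowuni_Sp lu) Sg'.
  rewrite -!mulmxA ux torus_col; congr col_mx; apply/colP => i; rewrite !mxE ?mulr0 //.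
  by rewrite mulKf.
have gen0 : g *m e != 0.
  by apply: (@omega_neq0 _ _ _ (g *m f)); rewrite omega_Sp.
have [X [q [qn0 uX topq]]] := move_first gen0.
apply: (Zline X g q) => // [t|t qt]; first exact/unipotent_Sp.
apply: Ztop; first exact: SpM (unipotent_Sp (uX t)) Sg.
by rewrite -mulmxA; apply: topq.
Qed.

End Density.

Section BlockIdentities.
Variables (F : fieldType) (k : nat).
Implicit Types a b c d s t : 'M[F]_k.

Lemma block_form_conj a b c d :
  - (block_mx 0 1%:M (- 1%:M) 0 *m block_mx a b c d *m block_mx 0 1%:M (- 1%:M) 0)
  = block_mx d (- c) (- b) a.
Proof.
rewrite !mulmx_block opp_block_mx !mul0mx !mulmx0 !add0r !addr0 !mul1mx.
by rewrite !mulmx1 !mulNmx !mulmxN !mul1mx !mulmx1 !opprK.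
Qed.

Lemma block_diag_conj s s' a b c d t t' :
  block_mx s 0 0 s' *m block_mx a b c d *m block_mx t 0 0 t' =
  block_mx (s *m a *m t) (s *m b *m t') (s' *m c *m t) (s' *m d *m t').
Proof. by rewrite !mulmx_block !mul0mx !mulmx0 !addr0 !add0r. Qed.

Lemma block_rot_conj a c d :
  block_mx 0 (- 1%:M) 1%:M 0 *m block_mx a 0 c d *m block_mx 0 1%:M (- 1%:M) 0
  = block_mx d (- c) 0 a.
Proof.
rewrite !mulmx_block !mul0mx !mulmx0 !addr0 !add0r !mul1mx !mulNmx !mul1mx.
by rewrite !mulmx1 !mulmxN !mulmx1 oppr0 opprK.
Qed.

(** The Bruhat decomposition of a lower unipotent of SL_2, arranged so that the factor outside the
    Borel subgroup is polynomial in 1/z. *)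
Lemma block_lower_bruhat (z : F) : z != 0 ->
  block_mx 1%:M 0 z%:M 1%:M =
  block_mx (z^-1)%:M (- 1%:M) 1%:M 0 *m
    (block_mx z%:M 0 0 (z^-1)%:M *m block_mx 1%:M (z^-1)%:M 0 1%:M) :> 'M_(k + k).
Proof.
move=> zn0; rewrite !mulmx_block !mul0mx !mulmx0 !addr0 !add0r !mulmx1 !mul1mx.
rewrite -!scalar_mxM mulfV // mulVf // mulr1 !mulNmx !mul1mx oppr0 addr0.
by rewrite subrr.
Qed.

End BlockIdentities.

Section Unipotent.
Variable R : realType.
Local Notation C := (complex R).
Local Notation J := (symp_form R).

Lemma Sp_invE k (A : 'M[C]_(k + k)) : Sp R k A ->
  invmx A = block_mx (drsubmx A)^T (- (ursubmx A)^T) (- (dlsubmx A)^T) (ulsubmx A)^T.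
Proof.
move=> SA; rewrite -[LHS]mul1mx -(Sp_left_inverse SA) mulmxK ?Sp_unit //.
by rewrite -{1}[A]submxK tr_block_mx block_form_conj.
Qed.

Lemma unitriangular_inv k (L d : 'M[C]_k) :
  (forall i j : 'I_k, (i <= j)%N -> L i j = (i == j)%:R) -> L *m d = 1%:M ->
  forall i j : 'I_k, (i <= j)%N -> d i j = (i == j)%:R.
Proof.
move=> L1 Ld i j; have [n] := ubnP (i : nat).
elim: n i => // n IHn i /ltnSE le_in le_ij.
have /matrixP/(_ i j) := Ld; rewrite !mxE (bigD1 i) //= L1 // eqxx mul1r.
rewrite big1 ?addr0 // => l nli; have [lt_li|le_il] := ltnP l i.
  rewrite IHn ?(leq_trans lt_li) // 1?ltnW ?(leq_trans lt_li) //.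
  have -> : (l == j) = false; last by rewrite mulr0.
  by apply/negbTE; rewrite -val_eqE neq_ltn (leq_trans lt_li).
by rewrite L1 // eq_sym (negPf nli) mul0r.
Qed.

Lemma unipotent_dr k (A : 'M[C]_(k + k)) (i j : 'I_k) :
  unipotent R k A -> (i <= j)%N -> drsubmx A i j = (i == j)%:R.
Proof.
move=> [SA A0 A1]; apply: (@unitriangular_inv _ (ulsubmx A)^T) => {i j}.
  by move=> i j le_ij; rewrite mxE A1 // eq_sym.
have := Sp_unit SA => /mulVmx; rewrite Sp_invE // -{5}[A]submxK A0.
rewrite mulmx_block (@scalar_mx_block _ k k) !trmx0 !oppr0 !mul0mx.
by move=> /eq_block_mx[_ _ _]; rewrite add0r.
Qed.

Lemma unipotentV k (A : 'M[C]_(k + k)) :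
  unipotent R k A -> unipotent R k (invmx A).
Proof.
move=> uA; have SA := unipotent_Sp uA; have := Sp_inv SA; rewrite Sp_invE //.
move=> SV; apply/unipotentE; split=> // [|i j le_ji].
  by case: uA => _ -> _; rewrite trmx0 oppr0.
by rewrite mxE unipotent_dr // eq_sym.
Qed.

Lemma lowuniV k (A : 'M[C]_(k + k)) : lowuni A -> lowuni (invmx A).
Proof. by rewrite /lowuni trmx_inv; apply: unipotentV. Qed.

Lemma torus_tr k (t : 'rV[C]_k) : (torus_mx t)^T = torus_mx t.
Proof. by rewrite /torus_mx tr_block_mx !trmx0 !tr_diag_mx. Qed.

Lemma torus1 k : torus_mx (const_mx 1 : 'rV[C]_k) = 1%:M.
Proof. by rewrite /torus_mx map_const_mx invr1 !diag_const_mx -scalar_mx_block. Qed.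

Lemma torus_inv k (t : 'rV[C]_k) : (forall i, t ord0 i != 0) ->
  invmx (torus_mx t) = torus_mx (map_mx GRing.inv t).
Proof.
move=> tn0; have Tt := Sp_unit (Sp_torus tn0).
rewrite -[LHS]mulmx1 -torus1; apply: (canLR (mulKmx Tt)); rewrite torus_mxM.
by congr torus_mx; apply/rowP => i; rewrite !mxE mulfV.
Qed.

Lemma unipotent_torus k (t : 'rV[C]_k) (A : 'M[C]_(k + k)) :
  (forall i, t ord0 i != 0) -> unipotent R k A ->
  unipotent R k (torus_mx t *m A *m invmx (torus_mx t)).
Proof.
move=> tn0 [SA A0 A1]; have St := Sp_torus tn0.
have := SpM (SpM St SA) (Sp_inv St); rewrite torus_inv // -[A]submxK A0.
rewrite block_diag_conj mulmx0 mul0mx => S'.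
apply/unipotentE; split=> // i j le_ji; rewrite mul_mx_diag mul_diag_mx !mxE.
have := A1 i j le_ji; rewrite !mxE => ->.
by have [->|] := eqVneq i j; rewrite ?mulr1 ?mulr0 ?mul0r ?mulfV.
Qed.

Lemma lowuni_torus k (t : 'rV[C]_k) (A : 'M[C]_(k + k)) :
  (forall i, t ord0 i != 0) -> lowuni A ->
  lowuni (torus_mx t *m A *m invmx (torus_mx t)).
Proof.
move=> tn0 lA; rewrite /lowuni !trmx_mul trmx_inv torus_tr.
have t'n0 i : (map_mx GRing.inv t) ord0 i != 0 by rewrite mxE invr_eq0.
have := unipotent_torus t'n0 lA; rewrite -torus_inv // invmxK mulmxA.
by [].
Qed.

(** A regular antidominant cocharacter: k - i is positive and strictly decreasing in i, so
    conjugation multiplies every root coordinate of U^- by a positive power of z. *)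
Definition contracting k (z : C) : 'rV[C]_k := \row_i (z^-1) ^+ (k - i).

Lemma contracting_pos k z : z != 0 -> forall i, contracting k z ord0 i != 0.
Proof. by move=> zn0 i; rewrite mxE expf_neq0 // invr_eq0. Qed.

Lemma contraction k (u : 'M[C]_(k + k)) : lowuni u ->
  exists U : C -> 'M[C]_(k + k), [/\ mxcurve U, U 0 = 1%:M &
    forall z, z != 0 -> U z =
      torus_mx (contracting k z) *m u *m invmx (torus_mx (contracting k z))].
Proof.
move=> lu; set a := ulsubmx u; set c := dlsubmx u; set d := drsubmx u.
have ur0 : ursubmx u = 0.
  by case: lu => _ u0 _; apply: trmx_inj; rewrite trmx_ursub u0 trmx0.
have a1 (i j : 'I_k) : (i <= j)%N -> a i j = (i == j)%:R by apply: lowuni_ul.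
have d1 (i j : 'I_k) : (j <= i)%N -> d i j = (i == j)%:R.
  by move=> le_ji; rewrite -[d]trmxK trmx_drsub mxE unipotent_dr // eq_sym.
have uE : u = block_mx a 0 c d by rewrite -[LHS]submxK ur0.
(* The truncated differences used as exponents below are harmless: wherever truncation occurs,
   unitriangularity makes the coefficient zero. *)
clearbody a c d; pose mono (A : 'M[C]_k) (e : 'I_k -> 'I_k -> nat) (z : C) : 'M[C]_k :=
  \matrix_(i, j) (A i j * z ^+ e i j).
have cmono A e : mxcurve (mono A e).
  move=> i j; apply: (@eq_polyfun _ (fun z => A i j * z ^+ e i j)).
    by move=> z; rewrite mxE.
  by apply: polyfunM (polyfun_const _) _; apply: polyfunX (polyfun_id _).
exists (fun z => block_mx (mono a (fun i j => i - j)%N z) 0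
  (mono c (fun i j => (k - i) + (k - j))%N z) (mono d (fun i j => j - i)%N z)).
split.
- by apply: mxcurve_block => //; apply: mxcurve_const.
- rewrite (@scalar_mx_block _ k k); congr block_mx; apply/matrixP => i j; rewrite !mxE.
  + rewrite expr0n subn_eq0; have [le_ij|lt_ji] := leqP i j; first by rewrite a1 // mulr1.
    by rewrite mulr0; case: eqP lt_ji => // ->; rewrite ltnn.
  + by rewrite expr0n addn_eq0 !subn_eq0 leqNgt ltn_ord mulr0.
  + rewrite expr0n subn_eq0; have [le_ji|lt_ij] := leqP j i; first by rewrite d1 // mulr1.
    by rewrite mulr0; case: eqP lt_ij => // ->; rewrite ltnn.
- move=> z zn0; rewrite torus_inv; last exact: contracting_pos.
  rewrite uE /torus_mx block_diag_conj mulmx0 mul0mx.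
  have key x p q : (p <= q)%N -> z^-1 ^+ p * x * (z^-1 ^+ q)^-1 = x * z ^+ (q - p).
    move=> le_pq; rewrite !exprVn invrK [_^-1 * x]mulrC -mulrA; congr (_ * _).
    by rewrite -{1}(subnK le_pq) exprD mulrCA mulVf ?mulr1 // expf_neq0.
  congr block_mx; apply/matrixP => i j; rewrite mul_mx_diag mul_diag_mx !mxE.
  + have [lt_ij|le_ji] := ltnP i j.
      by rewrite (a1 _ _ (ltnW lt_ij)) -val_eqE (ltn_eqF lt_ij) mulr0 !mul0r.
    rewrite key ?leq_sub2l //; congr (_ * _ ^+ _); have := ltn_ord i; lia.
  + by rewrite !exprVn !invrK exprD mulrC -mulrA mulrA mulrC mulrA [_ * c i j]mulrC -mulrA.
  + have [lt_ji|le_ij] := ltnP j i.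
      by rewrite (d1 _ _ (ltnW lt_ji)) -val_eqE (gtn_eqF lt_ji) mulr0 !mul0r.
    rewrite invrK [RHS]mulrC [_^-1 * _]mulrC mulrA key ?leq_sub2l //; congr (_ * _ ^+ _).
    have := ltn_ord j; lia.
Qed.

End Unipotent.

Section HighestWeightZero.
Variable R : realType.
Local Notation C := (complex R).

Definition curve_regular N (X : set 'M[C]_N) a b (r : 'M[C]_N -> 'M[C]_(a, b)) :=
  forall Gam, mxcurve Gam -> (forall t, X (Gam t)) -> mxcurve (r \o Gam).

(** w is fixed by B, so the orbit map factors through a complete variety. One projective line
    suffices: [L z] and [j z^-1] differ on the right by an element of B, so the orbit map is
    constant along both curves and the Weyl element [j 0] fixes w. It conjugates U^- into U, and the
    big cell finishes. *)
Lemma highest_weight0_fixed k e (sigma : 'M[C]_(k + k) -> 'M[C]_e) (w : 'cV[C]_e) :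
  curve_regular (Sp R k) sigma ->
  (forall A B, Sp R k A -> Sp R k B -> sigma (A *m B) = sigma A *m sigma B) ->
  (forall u, unipotent R k u -> sigma u *m w = w) ->
  (forall t : 'rV_k, (forall i, t ord0 i != 0) -> sigma (torus_mx t) *m w = w) ->
  forall g, Sp R k g -> sigma g *m w = w.
Proof.
move=> rsig sigM wU wT.
have wB (t : 'rV_k) u : (forall i, t ord0 i != 0) -> unipotent R k u ->
    sigma (torus_mx t *m u) *m w = w.
  move=> tn0 uu; rewrite sigM; [|exact: Sp_torus|exact: unipotent_Sp].
  by rewrite -mulmxA wU // wT.
have rw Gam : mxcurve Gam -> (forall t, Sp R k (Gam t)) ->
    mxcurve (fun t => sigma (Gam t) *m w).
  by move=> cG SG; apply: mxcurveM (mxcurve_const _); apply: rsig.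
pose L z : 'M[C]_(k + k) := block_mx 1%:M 0 z%:M 1%:M.
pose j z : 'M[C]_(k + k) := block_mx z%:M (- 1%:M) 1%:M 0.
have SL z : Sp R k (L z).
  by apply: Sp_block; rewrite ?trmx0 ?trmx1 ?tr_scalar_mx ?mul0mx ?mulmx0 ?mul1mx ?mulmx1 ?subr0.
have Sj z : Sp R k (j z).
  apply: Sp_block; rewrite ?[(- _)^T]raddfN /= ?tr_scalar_mx ?trmx1 ?trmx0.
  - by rewrite mul1mx mulmx1.
  - by rewrite mulmx0 mul0mx.
  - by rewrite mulmx0 sub0r mul1mx opprK.
have scurve : mxcurve (fun t : C => t%:M : 'M[C]_k).
  apply: (@eq_mxcurve _ _ _ (fun t => 0 + t *: 1%:M)); last exact: mxcurve_affine.
  by move=> t; rewrite add0r scale_scalar_mx mulr1.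
have cL : mxcurve L by apply: mxcurve_block => //; apply: mxcurve_const.
have cj : mxcurve j by apply: mxcurve_block => //; apply: mxcurve_const.
have Lj z : z != 0 -> sigma (L z) *m w = sigma (j z^-1) *m w.
  move=> zn0; have zi i : (const_mx z : 'rV[C]_k) ord0 i != 0 by rewrite mxE.
  have uu : unipotent R k (upper_mx z^-1%:M) by apply/unipotent_upper/tr_scalar_mx.
  have -> : L z = j z^-1 *m (torus_mx (const_mx z) *m upper_mx (z^-1)%:M).
    rewrite /torus_mx map_const_mx !diag_const_mx.
    exact: block_lower_bruhat.
  rewrite sigM -?mulmxA ?wB //.
  by apply: SpM; [apply: Sp_torus | apply: unipotent_Sp].
have [_ jw] := mxcurve_inv_const (rw _ cL SL) (rw _ cj Sj) Lj 0.
have L0 : L 0 = 1%:M by rewrite /L raddf0 -scalar_mx_block.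
have wj : sigma (j 0) *m w = w by rewrite jw L0 wU //; apply: unipotent1.
have wlow u : lowuni u -> sigma u *m w = w.
  move=> lu; pose u' := j 0 *m u *m invmx (j 0).
  have Su := lowuni_Sp lu.
  have Su' : Sp R k u' by apply: SpM (SpM _ _) (Sp_inv _).
  have uu' : unipotent R k u'.
    have ur0 : ursubmx u = 0.
      by case: lu => _ u0 _; apply: trmx_inj; rewrite trmx_ursub u0 trmx0.
    have j0 : j 0 = block_mx 0 (- 1%:M) 1%:M 0 by rewrite /j raddf0.
    have u'E : u' = block_mx (drsubmx u) (- dlsubmx u) 0 (ulsubmx u).
      rewrite /u' Sp_invE // j0 block_mxKul block_mxKur block_mxKdl block_mxKdr.
      rewrite !raddf0 raddfN /= !opprK trmx1 -{1}[u]submxK ur0.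
      exact: block_rot_conj.
    move: Su'; rewrite u'E => Su'; apply/unipotentE; split=> // i l le_li.
    by rewrite -[drsubmx u]trmxK trmx_drsub mxE unipotent_dr // eq_sym.
  have jV : sigma (invmx (j 0)) *m w = w.
    rewrite -{1}wj mulmxA -sigM //; last exact: Sp_inv.
    by rewrite mulVmx ?Sp_unit // wU //; apply: unipotent1.
  have -> : u = invmx (j 0) *m (u' *m j 0).
    by rewrite /u' mulmxKV ?Sp_unit // mulKmx ?Sp_unit.
  rewrite sigM; [|exact: Sp_inv|exact: SpM].
  by rewrite sigM // -!mulmxA wj wU.
apply: big_cell_ind => [X g q qn0 Sg SX wX|u g lu Sg|t g tn0 Sg|u g uu Sg|].
- have cX : mxcurve (fun t => (1%:M + t *: X) *m g).
    by apply: mxcurveM (mxcurve_const _); apply: mxcurve_affine.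
  have := mxcurve_eq qn0 (rw _ cX (fun t => SpM (SX t) Sg)) (mxcurve_const w) wX 0.
  by rewrite scale0r addr0 mul1mx.
- have Sl := lowuni_Sp lu; move=> uw.
  have := congr1 (mulmx (sigma (invmx u))) uw.
  rewrite (wlow _ (lowuniV lu)) mulmxA -sigM //; [|exact: Sp_inv|exact: SpM].
  by rewrite mulKmx ?Sp_unit.
- have St := Sp_torus tn0; move=> tw.
  have := congr1 (mulmx (sigma (invmx (torus_mx t)))) tw.
  rewrite mulmxA -sigM //; [|exact: Sp_inv|exact: SpM].
  rewrite mulKmx ?Sp_unit // => ->; rewrite torus_inv // wT // => i.
  by rewrite mxE invr_eq0.
- by rewrite sigM //; [rewrite -mulmxA wU | exact: unipotent_Sp].
- by rewrite wU //; apply: unipotent1.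
Qed.

End HighestWeightZero.

(** * Subspaces and functionals; the lowest weight functional *)

Section LinearAlgebra.
Variables (F : fieldType) (d : nat).

(** Among the subspaces contained in P take one of maximal dimension; adjoining a further vector of
    P would enlarge it. *)
Lemma linear_pred_vspace (P : 'cV[F]_d -> Prop) :
  P 0 -> (forall a x y, P x -> P y -> P (a *: x + y)) ->
  exists W : {vspace 'cV[F]_d}, forall x, x \in W <-> P x.
Proof.
move=> P0 Plin.
pose Q n := `[< exists2 W : {vspace 'cV[F]_d}, (forall x, x \in W -> P x) & \dim W = n >].
have exQ : exists n, Q n.
  by exists 0%N; apply/asboolP; exists 0%VS; rewrite ?dimv0 // => x /[!memv0] /eqP->.
have boundQ n : Q n -> (n <= \dim (fullv : {vspace 'cV[F]_d}))%N.
  by move=> /asboolP[W _ <-]; apply/dimvS/subvf.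
have [n /asboolP[W WP <-] maxW] := ex_maxnP exQ boundQ.
exists W => x; split=> [/WP //|Px]; apply: contrapT => /negP xW.
have /maxW : Q (\dim (W + <[x]>)).
  apply/asboolP; exists (W + <[x]>)%VS => // y /memv_addP[w wW [z /vlineP[c ->] ->]].
  by rewrite addrC; apply: Plin => //; apply: WP.
rewrite leqNgt => /negP; apply; rewrite ltn_neqAle dimvS ?addvSl // andbT.
apply: contraNneq xW => dimW; have : (W == W + <[x]>)%VS.
  by rewrite eqEdim addvSl -dimW leqnn.
by move=> /eqP->; apply: subvP (addvSr _ _) _ (memv_line x).
Qed.

Lemma linear_mx (f : {linear 'cV[F]_d -> 'cV[F]_d}) :
  exists A : 'M[F]_d, forall x, f x = A *m x.
Proof.
exists (\matrix_(i, j) f (delta_mx j ord0) i ord0) => x.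
apply/colP => i; rewrite [x in LHS]matrix_sum_delta linear_sum summxE mxE.
apply: eq_bigr => j _; rewrite big_ord1 linearZ !mxE mulrC.
by rewrite (_ : 0 = ord0) //; apply: val_inj.
Qed.

Lemma separating_functional (W : {vspace 'cV[F]_d}) v : v \notin W ->
  exists xi : 'rV[F]_d, (forall x, x \in W -> xi *m x = 0) /\ xi *m v != 0.
Proof.
move=> vW; have [A fA] := linear_mx (projv W).
have : A *m v - v != 0.
  by rewrite subr_eq0 -fA; apply: contraNneq vW => <-; apply: memv_proj.
move=> /eqP/colP/existsNP[i /eqP]; rewrite mxE => Avi.
exists (row i (A - 1%:M)); split=> [x xW|].
  have Ax : A *m x = x by rewrite -fA; apply: projv_id.
  by rewrite -row_mul mulmxBl mul1mx Ax subrr row0.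
apply: contraNneq Avi; rewrite -row_mul mulmxBl mul1mx => /rowP/(_ ord0).
by rewrite !mxE => ->.
Qed.

End LinearAlgebra.

Section PairRepresentations.
Variable R : realType.
Local Notation C := (complex R).
Variables m n d : nat.

Definition pair_rep (r : 'M[C]_(m + m) -> 'M[C]_(n + n) -> 'M[C]_d) : Prop :=
  [/\ r 1%:M 1%:M = 1%:M,
      forall A A' B B', Sp R m A -> Sp R m A' -> Sp R n B -> Sp R n B' ->
        r (A *m A') (B *m B') = r A B *m r A' B'
    & forall GA GB, mxcurve GA -> mxcurve GB -> (forall t, Sp R m (GA t)) ->
        (forall t, Sp R n (GB t)) -> mxcurve (fun t => r (GA t) (GB t))].

(** Irreducibility in dual form: the orbit of a nonzero vector spans, so only the zero functional
    annihilates it. *)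
Definition pair_irr (r : 'M[C]_(m + m) -> 'M[C]_(n + n) -> 'M[C]_d) : Prop :=
  forall (xi : 'rV[C]_d) (v : 'cV[C]_d), v != 0 ->
    (forall A B, Sp R m A -> Sp R n B -> xi *m r A B *m v = 0) -> xi = 0.

Definition torus_pos k (t : 'rV[C]_k) := forall i, t ord0 i != 0.

Variable r : 'M[C]_(m + m) -> 'M[C]_(n + n) -> 'M[C]_d.
Hypothesis rrep : pair_rep r.
Variables (v : 'cV[C]_d) (chi : 'rV[C]_m -> 'rV[C]_n -> C).
Hypothesis vU : forall A B, unipotent R m A -> unipotent R n B -> r A B *m v = v.
Hypothesis vT : forall s t, torus_pos s -> torus_pos t ->
  r (torus_mx s) (torus_mx t) *m v = chi s t *: v.

Lemma torus_pos1 k : torus_pos (const_mx 1 : 'rV[C]_k).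
Proof. by move=> i; rewrite mxE oner_eq0. Qed.

Lemma torus_posV k (t : 'rV[C]_k) : torus_pos t -> torus_pos (map_mx GRing.inv t).
Proof. by move=> tn0 i; rewrite mxE invr_eq0. Qed.

Lemma curve_affineM k (X g : 'M[C]_(k + k)) : mxcurve (fun t => (1%:M + t *: X) *m g).
Proof. by apply: mxcurveM (mxcurve_const _); apply: mxcurve_affine. Qed.

Let good (xi : 'rV[C]_d) :=
  forall u u', lowuni u -> lowuni u' -> xi *m r u u' *m v = 0.

Let good_left xi u0 u0' : lowuni u0 -> lowuni u0' -> good xi ->
  good (xi *m r u0 u0').
Proof.
have [_ rM _] := rrep; move=> l0 l0' gxi u u' lu lu'.
by rewrite -(mulmxA xi) -rM ?gxi //; (exact: lowuniM) || exact: lowuni_Sp.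
Qed.

Let good_torus xi s t : torus_pos s -> torus_pos t -> good xi ->
  good (xi *m r (torus_mx s) (torus_mx t)).
Proof.
have [_ rM _] := rrep; move=> sp tp gxi u u' lu lu'.
have Ss := Sp_torus sp; have St := Sp_torus tp.
have Su := lowuni_Sp lu; have Su' := lowuni_Sp lu'.
rewrite -(mulmxA xi) -rM //.
have -> : torus_mx s *m u = torus_mx s *m u *m invmx (torus_mx s) *m torus_mx s.
  by rewrite mulmxKV ?Sp_unit.
have -> : torus_mx t *m u' = torus_mx t *m u' *m invmx (torus_mx t) *m torus_mx t.
  by rewrite mulmxKV ?Sp_unit.
have L := lowuni_torus sp lu; have L' := lowuni_torus tp lu'.
rewrite rM //; [|exact: lowuni_Sp..].
by rewrite !mulmxA -mulmxA vT // -scalemxAr gxi // scaler0.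
Qed.

(** As v is an eigenvector of B, vanishing on U^- v spreads to the orbit of v under the big cell,
    and from there to the closure along lines. *)
Lemma big_cell_dense (xi : 'rV[C]_d) :
  (forall u u', lowuni u -> lowuni u' -> xi *m r u u' *m v = 0) ->
  forall A B, Sp R m A -> Sp R n B -> xi *m r A B *m v = 0.
Proof.
have [r1 rM rC] := rrep; move=> gxi A B SA SB.
(* Left translation by B^- is absorbed into the functional, so the induction must treat all good
   functionals at once. *)
pose ZB B := forall xi, good xi -> forall A, Sp R m A -> xi *m r A B *m v = 0.
suff : ZB B by apply.
have rcurve GA GB (eta : 'rV[C]_d) : mxcurve GA -> mxcurve GB -> (forall t, Sp R m (GA t)) ->
    (forall t, Sp R n (GB t)) -> mxcurve (fun t => eta *m r (GA t) (GB t) *m v).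
  move=> cA cB SA' SB'; apply: mxcurveM (mxcurve_const _).
  by apply: mxcurveM (mxcurve_const _) _; apply: rC.
have cst k (g : 'M[C]_(k + k)) : mxcurve (fun=> g) by apply: mxcurve_const.
move: B SB; apply: big_cell_ind => [X g q qn0 Sg SX ZX|u g lu Sg Z|t g tn0 Sg Z|u g uu Sg Z|].
- move=> eta geta A' SA'.
  have SXg t : Sp R n ((1%:M + t *: X) *m g) by apply: SpM.
  have := mxcurve_eq qn0 (rcurve _ _ eta (cst _ A') (curve_affineM X g) (fun=> SA') SXg)
    (mxcurve_const 0) (fun t qt => ZX t qt eta geta A' SA') 0.
  by rewrite scale0r addr0 mul1mx.
- move=> eta geta A' SA'; have Su := lowuni_Sp lu.
  have := Z _ (good_left (lowuni1 R m) (lowuniV lu) geta) A' SA'.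
  rewrite -(mulmxA eta) -rM //; [|exact: Sp1|exact: Sp_inv|exact: SpM].
  by rewrite mul1mx mulKmx ?Sp_unit.
- move=> eta geta A' SA'; have St := Sp_torus tn0.
  have := Z _ (good_torus (@torus_pos1 m) (torus_posV tn0) geta) A' SA'.
  rewrite torus1 -torus_inv // -(mulmxA eta) -rM //; [|exact: Sp1|exact: Sp_inv|exact: SpM].
  by rewrite mul1mx mulKmx ?Sp_unit.
- move=> eta geta A' SA'; have := Z eta geta A' SA'.
  rewrite -{1}[A']mulmx1 rM //; [|exact: Sp1|exact: unipotent_Sp].
  by rewrite !mulmxA -mulmxA vU //; apply: unipotent1.
move=> {xi gxi} eta geta {}A {}SA; move: A SA eta geta.
apply: big_cell_ind => [X g q qn0 Sg SX ZX|u g lu Sg Z|t g tn0 Sg Z|u g uu Sg Z|].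
- move=> eta geta.
  have SXg t : Sp R m ((1%:M + t *: X) *m g) by apply: SpM.
  have := mxcurve_eq qn0 (rcurve _ _ eta (curve_affineM X g) (cst _ _) SXg
    (fun=> Sp1 R n)) (mxcurve_const 0) (fun t qt => ZX t qt eta geta) 0.
  by rewrite scale0r addr0 mul1mx.
- move=> eta geta; have Su := lowuni_Sp lu.
  have := Z _ (good_left (lowuniV lu) (lowuni1 R n) geta).
  rewrite -(mulmxA eta) -rM //; [|exact: Sp_inv|exact: SpM|exact: Sp1|exact: Sp1].
  by rewrite mul1mx mulKmx ?Sp_unit.
- move=> eta geta; have St := Sp_torus tn0.
  have := Z _ (good_torus (torus_posV tn0) (@torus_pos1 n) geta).
  rewrite torus1 -torus_inv // -(mulmxA eta) -rM //; [|exact: Sp_inv|exact: SpM|exact: Sp1|exact: Sp1].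
  by rewrite mul1mx mulKmx ?Sp_unit.
- move=> eta geta; have := Z eta geta.
  rewrite -{1}[1%:M]mulmx1 rM //; [|exact: unipotent_Sp|exact: Sp1|exact: Sp1].
  by rewrite !mulmxA -mulmxA vU //; apply: unipotent1.
- by move=> eta geta; apply: geta; apply: lowuni1.
Qed.

Hypothesis rirr : pair_irr r.
Hypothesis vn0 : v != 0.
Hypothesis chi_n0 : forall s t, torus_pos s -> torus_pos t -> chi s t != 0.

(* The sum of the lower weight spaces consists of the vectors contracted to 0,
   relative to v, by the one-parameter subgroup (contracting z). *)
Lemma lowest_functional : exists xi : 'rV[C]_d,
  [/\ xi *m v != 0, forall u u', lowuni u -> lowuni u' -> xi *m r u u' = xi
    & forall s t, torus_pos s -> torus_pos t ->
        xi *m r (torus_mx s) (torus_mx t) = chi s t *: xi].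
Proof.
have [r1 rM rC] := rrep.
pose T z := r (torus_mx (contracting m z)) (torus_mx (contracting n z)).
pose X z := chi (contracting m z) (contracting n z).
have Xn0 z : z != 0 -> X z != 0.
  by move=> zn0; apply: chi_n0; apply: contracting_pos.
pose P (x : 'cV[C]_d) := exists Gam : C -> 'cV[C]_d,
  [/\ mxcurve Gam, Gam 0 = 0 & forall z, z != 0 -> T z *m x = X z *: Gam z].
have [W WP] : exists W : {vspace 'cV[C]_d}, forall x, x \in W <-> P x.
  apply: linear_pred_vspace.
    exists (fun=> 0); split=> // [|z _]; first exact: mxcurve_const.
    by rewrite mulmx0 scaler0.
  move=> a x y [Gx [cx x0 xT]] [Gy [cy y0 yT]].
  exists (fun z => a%:M *m Gx z + Gy z); split.
  - by apply: mxcurveD => //; apply: mxcurveM => //; apply: mxcurve_const.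
  - by rewrite x0 y0 mulmx0 addr0.
  - move=> z zn0; rewrite mulmxDr -scalemxAr xT // yT // mul_scalar_mx.
    by rewrite scalerDr !scalerA mulrC.
have vW : v \notin W.
  apply/negP => /WP[Gam [cG G0 GT]]; move/eqP: vn0; apply.
  rewrite -G0; apply: (@mxcurve_eq _ _ _ (fun=> v) Gam 'X) => [|||z] //.
  - by rewrite polyX_eq0.
  - exact: mxcurve_const.
  rewrite hornerX => zn0; apply: (@scalerI _ _ (X z)); first exact: Xn0.
  by rewrite -GT // /T vT //; apply: contracting_pos.
have [xi [xiW xiv]] := separating_functional vW.
(* Conjugation by the contracting torus tends to 1 on U^-, so r(u, u') v - v is contracted to 0
   relative to v. It thus lies in W, where xi vanishes. *)
have xiu u u' : lowuni u -> lowuni u' -> xi *m r u u' *m v = xi *m v.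
  move=> lu lu'; apply/eqP; rewrite -subr_eq0 -mulmxA -mulmxBr; apply/eqP/xiW/WP.
  have [U [cU U0 UE]] := contraction lu; have [U' [cU' U'0 U'E]] := contraction lu'.
  have lU z : lowuni (U z).
    have [->|zn0] := eqVneq z 0; first by rewrite U0; apply: lowuni1.
    by rewrite UE //; apply: lowuni_torus => //; apply: contracting_pos.
  have lU' z : lowuni (U' z).
    have [->|zn0] := eqVneq z 0; first by rewrite U'0; apply: lowuni1.
    by rewrite U'E //; apply: lowuni_torus => //; apply: contracting_pos.
  have SU z := lowuni_Sp (lU z); have SU' z := lowuni_Sp (lU' z).
  exists (fun z => r (U z) (U' z) *m v + - 1%:M *m v); split.
  - apply: mxcurveD; last exact: mxcurve_const.
    by apply: mxcurveM (mxcurve_const _); apply: rC.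
  - by rewrite U0 U'0 r1 mulNmx subrr.
  - move=> z zn0; have cm := @contracting_pos _ m _ zn0; have cn := @contracting_pos _ n _ zn0.
    have Sm := Sp_torus cm; have Sn := Sp_torus cn.
    rewrite mulmxBr [T z *m v]vT // mulNmx mul1mx scalerBr; congr (_ - _).
    rewrite mulmxA -rM ?lowuni_Sp //; [|exact: lowuni_Sp..].
    have -> : torus_mx (contracting m z) *m u = U z *m torus_mx (contracting m z).
      by rewrite UE // mulmxKV ?Sp_unit.
    have -> : torus_mx (contracting n z) *m u' = U' z *m torus_mx (contracting n z).
      by rewrite U'E // mulmxKV ?Sp_unit.
    by rewrite rM // -mulmxA vT // -scalemxAr.
(* By density and irreducibility a functional is determined by its values on U^- v. Both
   semi-invariance claims are checked there. *)
have xi_eq eta : (forall u u', lowuni u -> lowuni u' ->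
    eta *m r u u' *m v = xi *m r u u' *m v) -> eta = xi.
  move=> etaE; apply/eqP; rewrite -subr_eq0; apply/eqP/(rirr vn0).
  apply: big_cell_dense => u u' lu lu'.
  by rewrite !mulmxBl etaE // subrr.
exists xi; split=> // [u0 u0' l0 l0'|s t sp tp].
  apply: xi_eq => u u' lu lu'; rewrite -[xi *m _ *m r u u']mulmxA -rM; try exact: lowuni_Sp.
  by rewrite !xiu //; apply: lowuniM.
have xn0 := chi_n0 sp tp; apply: (@scalerI _ _ (chi s t)^-1).
  by rewrite invr_eq0.
rewrite scalerA mulVf // scale1r; apply: xi_eq => u u' lu lu'.
have Ss := Sp_torus sp; have St := Sp_torus tp.
have Su := lowuni_Sp lu; have Su' := lowuni_Sp lu'.
rewrite -!scalemxAl -[xi *m _ *m r u u']mulmxA -rM //.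
have -> : torus_mx s *m u = torus_mx s *m u *m invmx (torus_mx s) *m torus_mx s.
  by rewrite mulmxKV ?Sp_unit.
have -> : torus_mx t *m u' = torus_mx t *m u' *m invmx (torus_mx t) *m torus_mx t.
  by rewrite mulmxKV ?Sp_unit.
have L := lowuni_torus sp lu; have L' := lowuni_torus tp lu'.
rewrite rM //; [|exact: lowuni_Sp..].
by rewrite mulmxA -(mulmxA _ _ v) vT // -scalemxAr xiu // xiu // scalerA mulVf // scale1r.
Qed.

End PairRepresentations.

(** * Spherical functions and their exponents *)

Section Monomials.
Variable F : numClosedFieldType.

(** If e exceeded e', then h(t) t^(e - e') = b would extend to t = 0 and give b = 0. *)
Lemma polyfun_no_pole (h : F -> F) b e e' : polyfun h -> b != 0 ->
  (forall t, t != 0 -> h t * t ^+ e = b * t ^+ e') -> (e <= e')%N.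
Proof.
move=> ph bn0 hE; rewrite leqNgt; apply/negP => lt_e; move/eqP: bn0; apply.
have := @polyfun_eq _ (fun t => h t * t ^+ (e - e')) (fun=> b) 'X.
move=> /(_ _ _ _ _ 0) <-; rewrite ?polyX_eq0 //.
- by rewrite expr0n subn_eq0 leqNgt lt_e mulr0.
- by apply: polyfunM => //; apply/polyfunX/polyfun_id.
- exact: polyfun_const.
move=> t; rewrite hornerX => tn0; apply: (mulIf (expf_neq0 e' tn0)).
by rewrite -mulrA -exprD subnK 1?ltnW // hE.
Qed.

(* The relation determines h on squares, and evenness follows from t = -1. *)
Lemma polyfun_homogeneous (h : F -> F) l N : polyfun h -> h 1 != 0 ->
  (forall t, t != 0 -> t ^+ l * h 1 = t ^+ N * h (1 / t ^+ 2)) ->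
  exists a, (l + a.*2 = N)%N /\ forall w, w != 0 -> h w = h 1 * w ^+ a.
Proof.
move=> ph cn0; move: (h 1) cn0 => c cn0 hE.
have sqE t : t != 0 -> h (t ^+ 2) * t ^+ l = c * t ^+ N.
  move=> tn0; have := hE t^-1; rewrite invr_eq0 !exprVn div1r invrK => /(_ tn0) E.
  have -> : h (t ^+ 2) = t ^+ N * (t ^- l * c) by rewrite E mulVKf // expf_neq0.
  by rewrite -mulrA [X in _ * X]mulrAC mulVf ?expf_neq0 // mul1r mulrC.
have le_l : (l <= N)%N.
  apply: (@polyfun_no_pole (fun t => h (t ^+ 2)) c) => //.
  by have [q qE] := ph; exists (q \Po 'X^2) => t; rewrite horner_comp hornerXn qE.
set e := (N - l)%N; have h_e t : t != 0 -> h (t ^+ 2) = c * t ^+ e.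
  move=> tn0; apply: (mulIf (expf_neq0 l tn0)).
  by rewrite sqE // -mulrA -exprD subnK.
have h1 : h 1 = c by have := h_e 1 (oner_neq0 _); rewrite !expr1n mulr1.
have ev : ~~ odd e.
  have := h_e (-1); rewrite sqrrN expr1n oppr_eq0 oner_eq0 h1 => /(_ isT).
  rewrite -signr_odd; case: (odd e) => //; rewrite expr1 mulrN1 => /eqP.
  by rewrite -addr_eq0 -mulr2n mulrn_eq0 (negPf cn0).
have eE : e = e./2.*2 by rewrite -[LHS]odd_double_half (negPf ev).
exists e./2; split=> [|w wn0]; first by rewrite -eE /e subnKC.
have := h_e (sqrtC w); rewrite sqrtC_eq0 => /(_ wn0).
by rewrite sqrtCK {1}eE -mul2n exprM sqrtCK.
Qed.

End Monomials.

Section SphericalFunction.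
Variable R : realType.
Local Notation C := (complex R).
Local Notation J := (symp_form R).
Local Notation i1 := (lift ord0 ord0).

Definition borel2 (t z : C) : 'M[C]_(1 + 1) := block_mx t%:M z%:M 0 (t^-1)%:M.

Lemma Sp1_block (a b c d : C) : a * d - c * b = 1 ->
  Sp R 1 (block_mx a%:M b%:M c%:M d%:M).
Proof.
move=> det1; apply: Sp_block; rewrite !tr_scalar_mx -!scalar_mxM.
- by rewrite mulrC.
- by rewrite mulrC.
- by rewrite -raddfB /= det1.
Qed.

Lemma borel2_Sp t z : t != 0 -> Sp R 1 (borel2 t z).
Proof.
move=> tn0; have -> : borel2 t z = block_mx t%:M z%:M 0%:M (t^-1)%:M.
  by rewrite /borel2 raddf0.
by apply: Sp1_block; rewrite mul0r subr0 mulfV.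
Qed.

Lemma borel2M z w : borel2 1 z *m borel2 1 w = borel2 1 (z + w).
Proof.
rewrite /borel2 invr1 mulmx_block !mul0mx !mulmx0 !addr0 add0r !mul1mx !mulmx1.
by rewrite -raddfD /= addrC.
Qed.

Lemma borel2_1 : borel2 1 0 = 1%:M.
Proof. by rewrite /borel2 invr1 raddf0 -scalar_mx_block. Qed.

Definition col_e : 'cV[C]_(1 + 1) := col_mx 1%:M 0.
Definition col_f : 'cV[C]_(1 + 1) := col_mx 0 1%:M.

Lemma block2_e (a b c d : C) :
  block_mx a%:M b%:M c%:M d%:M *m col_e = a *: col_e + c *: col_f.
Proof.
rewrite mul_block_col !mulmx0 !mulmx1 !addr0 !scale_col_mx !scaler0 add_col_mx.
by rewrite !scale_scalar_mx !mulr1 addr0 add0r.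
Qed.

Lemma block2_f (a b c d : C) :
  block_mx a%:M b%:M c%:M d%:M *m col_f = b *: col_e + d *: col_f.
Proof.
rewrite mul_block_col !mulmx0 !mulmx1 !add0r !scale_col_mx !scaler0 add_col_mx.
by rewrite !scale_scalar_mx !mulr1 addr0 add0r.
Qed.

Lemma borel2_e t z : borel2 t z *m col_e = t *: col_e.
Proof.
have -> : borel2 t z = block_mx t%:M z%:M 0%:M (t^-1)%:M by rewrite /borel2 raddf0.
by rewrite block2_e scale0r addr0.
Qed.

Lemma borel2_f t z : borel2 t z *m col_f = z *: col_e + t^-1 *: col_f.
Proof.
have -> : borel2 t z = block_mx t%:M z%:M 0%:M (t^-1)%:M by rewrite /borel2 raddf0.
by rewrite block2_f.
Qed.

Lemma eq_mul_ef a (A B : 'M[C]_(a, 1 + 1)) :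
  A *m col_e = B *m col_e -> A *m col_f = B *m col_f -> A = B.
Proof.
move=> Ae Af; have ef : row_mx col_e col_f = 1%:M.
  by rewrite (@scalar_mx_block _ 1 1) block_mxEh.
by rewrite -[A]mulmx1 -[B]mulmx1 -ef !mul_mx_row Ae Af.
Qed.

(** Entries a and a^-1 give the e_1- and f_0-coordinates of [std_y] the same factor a^-1. The torus
    therefore rescales both standard vectors while moving z to a^2 z. *)
Definition std_torus k (a : C) : 'rV[C]_k.+2 :=
  \row_i (if i == ord0 then a else if i == i1 then a^-1 else 1).

Lemma std_torus_pos k a : a != 0 -> torus_pos (std_torus k a).
Proof.
move=> an0 i; rewrite mxE; do 2!case: ifP => // _; rewrite ?invr_eq0 //.
exact: oner_neq0.
Qed.

Lemma std_torus_x k a : torus_mx (std_torus k a) *m std_x R k = a *: std_x R k.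
Proof.
rewrite torus_col scale_col_mx scaler0; congr col_mx; apply/colP => i; rewrite !mxE ?mulr0 //.
by have [_|_] := eqVneq i ord0; rewrite ?mulr0.
Qed.

Lemma std_torus_y k a z : a != 0 ->
  torus_mx (std_torus k a) *m std_y k z = a^-1 *: std_y k (a ^+ 2 * z).
Proof.
move=> an0; rewrite torus_col scale_col_mx; congr col_mx; apply/colP => i; rewrite !mxE.
  have [->|_] := eqVneq i ord0; first by rewrite /= !mulr1 !addr0 mulrA expr2 mulKf.
  have [_|_] := eqVneq i i1; first by rewrite /= !mulr0 !add0r.
  by rewrite /= !mulr0 !addr0 !mulr0.
have [_|_] := eqVneq i ord0; first by [].
by rewrite /= !mulr0.
Qed.

Lemma std_torus_fix k (s : 'rV[C]_k.+2) z : s ord0 ord0 = 1 -> s ord0 i1 = 1 ->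
  torus_mx s *m std_x R k = std_x R k /\ torus_mx s *m std_y k z = std_y k z.
Proof.
move=> s0 s1; rewrite /std_x /std_y !torus_col; split; congr col_mx; apply/colP => i;
  rewrite !mxE ?mulr0 //.
- by have [->|] := eqVneq i ord0; rewrite ?mulr0 ?s0 ?mul1r.
- have [->|_] := eqVneq i ord0; first by rewrite s0 mul1r.
  have [->|_] := eqVneq i i1; first by rewrite s1 mul1r.
  by rewrite /= mulr0 addr0 mulr0.
- by have [->|] := eqVneq i ord0; rewrite ?mulr0 // s0 invr1 mul1r.
Qed.

Lemma std_y_add k z w : std_y k (z + w) = z *: std_x R k + std_y k w.
Proof.
by rewrite /std_x /std_y scale_col_mx scaler0 add_col_mx add0r addrA -scalerDl.
Qed.

Lemma omega_split k r (P : 'M[C]_(r + r, k + k)) (Q : 'M[C]_(r + r, 1 + 1)) :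
  symp_split P Q -> omega (Q *m col_e) (Q *m col_f) = 1.
Proof.
case=> _ QQ _ [_ _ JQ]; rewrite /omega trmx_mul -!mulmxA (mulmxA (J r)) JQ.
rewrite -!mulmxA (mulmxA Q^T) QQ mul1mx.
rewrite mulmxA -/(omega col_e col_f) omega_col trmx1 trmx0 mul1mx mul0mx !mxE.
by rewrite subr0.
Qed.

(** A line in SL_2 through a Weyl element at t = 0; its pair has parameter 1/t and so runs off to
    infinity there. *)
Definition hook2 (t : C) : 'M[C]_(1 + 1) := block_mx t%:M 1%:M (-1)%:M 0%:M.

Lemma hook2_Sp t : Sp R 1 (hook2 t).
Proof. by apply: Sp1_block; rewrite mulr0 sub0r mulN1r opprK. Qed.

Section EmbeddedSL2.
Variables (k r : nat) (P : 'M[C]_(r + r, k + k)) (Q : 'M[C]_(r + r, 1 + 1)).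
Hypothesis PQ : symp_split P Q.

Lemma emb_borel_e A t z :
  symp_emb P Q A (borel2 t z) *m (Q *m col_e) = t *: (Q *m col_e).
Proof. by rewrite mulmxA symp_embQ // -mulmxA borel2_e scalemxAr. Qed.

Lemma emb_borel_f A t z :
  symp_emb P Q A (borel2 t z) *m (Q *m col_f) = z *: (Q *m col_e) + t^-1 *: (Q *m col_f).
Proof.
by rewrite mulmxA symp_embQ // -mulmxA borel2_f mulmxDr !scalemxAr.
Qed.

Lemma emb_hook_e A t :
  symp_emb P Q A (hook2 t) *m (Q *m col_e) = t *: (Q *m col_e) - Q *m col_f.
Proof.
by rewrite mulmxA symp_embQ // -mulmxA block2_e scaleN1r mulmxBr -scalemxAr.
Qed.

Lemma emb_hook_f A t : symp_emb P Q A (hook2 t) *m (Q *m col_f) = Q *m col_e.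
Proof.
by rewrite mulmxA symp_embQ // -mulmxA block2_f scale1r scale0r addr0.
Qed.

End EmbeddedSL2.

Variables (m n : nat).
Variables (P1 : 'M[C]_(m.+2 + m.+2, m.+1 + m.+1)) (Q1 : 'M[C]_(m.+2 + m.+2, 1 + 1)).
Variables (P2 : 'M[C]_(n.+2 + n.+2, n.+1 + n.+1)) (Q2 : 'M[C]_(n.+2 + n.+2, 1 + 1)).
Hypotheses (PQ1 : symp_split P1 Q1) (PQ2 : symp_split P2 Q2).
Variables (s1 : 'M[C]_(m.+2 + m.+2)) (s2 : 'M[C]_(n.+2 + n.+2)).
Hypotheses (Ss1 : Sp R m.+2 s1) (Ss2 : Sp R n.+2 s2).
Hypotheses (s1e : s1 *m (Q1 *m col_e) = std_x R m)
           (s1f : s1 *m (Q1 *m col_f) = std_y m 0).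
Hypotheses (s2e : s2 *m (Q2 *m col_e) = std_x R n)
           (s2f : s2 *m (Q2 *m col_f) = std_y n 0).

Variables (l p p' : nat) (chi1 : 'rV[C]_m.+2 -> C) (chi2 : 'rV[C]_n.+2 -> C).

Definition spherical (f : 'M[C]_(m.+2 + m.+2) -> 'M[C]_(n.+2 + n.+2) -> C) : Prop :=
  [/\ forall GA GB, mxcurve GA -> mxcurve GB -> (forall t, Sp R m.+2 (GA t)) ->
        (forall t, Sp R n.+2 (GB t)) -> polyfun (fun t => f (GA t) (GB t)),
      forall u u' A B, lowuni u -> lowuni u' -> Sp R m.+2 A -> Sp R n.+2 B ->
        f (u *m A) (u' *m B) = f A B,
      forall s t A B, torus_pos s -> torus_pos t -> Sp R m.+2 A -> Sp R n.+2 B ->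
        f (torus_mx s *m A) (torus_mx t *m B) = chi1 s * chi2 t * f A B
    & forall A B A0 B0 t z, Sp R m.+2 A -> Sp R n.+2 B -> Sp R m.+1 A0 ->
        Sp R n.+1 B0 -> t != 0 ->
        f (A *m symp_emb P1 Q1 A0 (borel2 t z)) (B *m symp_emb P2 Q2 B0 (borel2 t z))
        = t ^+ l * f A B].

Hypotheses (chi1_1 : chi1 (const_mx 1) = 1) (chi2_1 : chi2 (const_mx 1) = 1).
Hypotheses (chi1_std : forall a, a != 0 -> chi1 (std_torus m a) = a ^+ p)
           (chi2_std : forall a, a != 0 -> chi2 (std_torus n a) = a ^+ p').

Definition shear1 z := s1 *m symp_emb P1 Q1 1%:M (borel2 1 z).
Definition shear2 z := s2 *m symp_emb P2 Q2 1%:M (borel2 1 z).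

Lemma shear1_Sp z : Sp R m.+2 (shear1 z).
Proof.
apply: SpM => //; apply: (symp_emb_Sp PQ1); first exact: Sp1.
by apply: borel2_Sp; apply: oner_neq0.
Qed.

Lemma shear2_Sp z : Sp R n.+2 (shear2 z).
Proof.
apply: SpM => //; apply: (symp_emb_Sp PQ2); first exact: Sp1.
by apply: borel2_Sp; apply: oner_neq0.
Qed.

Lemma shear1_e z : shear1 z *m (Q1 *m col_e) = std_x R m.
Proof.
by rewrite -[LHS]mulmxA emb_borel_e // scale1r.
Qed.

Lemma shear1_f z : shear1 z *m (Q1 *m col_f) = std_y m z.
Proof.
rewrite -[LHS]mulmxA emb_borel_f // invr1 scale1r mulmxDr -scalemxAr.
by rewrite s1e s1f -std_y_add addr0.
Qed.

Lemma shear2_e z : shear2 z *m (Q2 *m col_e) = std_x R n.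
Proof.
by rewrite -[LHS]mulmxA emb_borel_e // scale1r.
Qed.

Lemma shear2_f z : shear2 z *m (Q2 *m col_f) = std_y n z.
Proof.
rewrite -[LHS]mulmxA emb_borel_f // invr1 scale1r mulmxDr -scalemxAr.
by rewrite s2e s2f -std_y_add addr0.
Qed.

Variable f : 'M[C]_(m.+2 + m.+2) -> 'M[C]_(n.+2 + n.+2) -> C.
Hypothesis fsph : spherical f.

Lemma spherical_dep A A' B B' : Sp R m.+2 A -> Sp R m.+2 A' -> Sp R n.+2 B ->
  Sp R n.+2 B' -> A *m (Q1 *m col_e) = A' *m (Q1 *m col_e) ->
  A *m (Q1 *m col_f) = A' *m (Q1 *m col_f) ->
  B *m (Q2 *m col_e) = B' *m (Q2 *m col_e) ->
  B *m (Q2 *m col_f) = B' *m (Q2 *m col_f) -> f A B = f A' B'.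
Proof.
move=> SA SA' SB SB'; rewrite !mulmxA => Ae Af Be Bf; case: fsph => _ _ _ fR.
have [A0 SA0 ->] := symp_emb_mulQ PQ1 SA SA' (eq_mul_ef Ae Af).
have [B0 SB0 ->] := symp_emb_mulQ PQ2 SB SB' (eq_mul_ef Be Bf).
have := fR A B A0 B0 1 0 SA SB SA0 SB0 (oner_neq0 _).
by rewrite borel2_1 expr1n mul1r.
Qed.

Let psi z := f s1 (shear2 z).

(** The unipotent subgroup of the diagonal Sp_2 translates both parameters simultaneously, so only
    their difference matters. *)
Lemma psi_shear z w : f (shear1 z) (shear2 w) = psi (w - z).
Proof.
case: fsph => _ _ _ fR.
have := fR _ _ _ _ _ (- z) (shear1_Sp z) (shear2_Sp w) (Sp1 R _) (Sp1 R _) (oner_neq0 _).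
rewrite expr1n mul1r /shear1 /shear2 -!mulmxA (symp_embM PQ1) (symp_embM PQ2) !borel2M.
rewrite (mulmx1 (1%:M : 'M[C]_(m.+1 + m.+1))) (mulmx1 (1%:M : 'M[C]_(n.+1 + n.+1))).
by move=> <-; rewrite subrr borel2_1 (symp_emb1 PQ1) mulmx1.
Qed.

Lemma spherical_normal A B s t z w : Sp R m.+2 A -> Sp R n.+2 B ->
  torus_pos s -> torus_pos t ->
  A *m (Q1 *m col_e) = torus_mx s *m std_x R m ->
  A *m (Q1 *m col_f) = torus_mx s *m std_y m z ->
  B *m (Q2 *m col_e) = torus_mx t *m std_x R n ->
  B *m (Q2 *m col_f) = torus_mx t *m std_y n w ->
  f A B = chi1 s * chi2 t * psi (w - z).
Proof.
move=> SA SB sp tp Ae Af Be Bf; case: (fsph) => _ _ fT _.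
have S1 := shear1_Sp z; have S2 := shear2_Sp w.
rewrite -psi_shear -fT //; apply: spherical_dep => //.
- exact: SpM (Sp_torus sp) S1.
- exact: SpM (Sp_torus tp) S2.
- by rewrite -mulmxA shear1_e.
- by rewrite -mulmxA shear1_f.
- by rewrite -mulmxA shear2_e.
- by rewrite -mulmxA shear2_f.
Qed.

(** [spherical_normal] needs both pairs in standard position. Limits are taken in one variable at a
    time: in B while A is in standard position, then in A with B arbitrary. *)
Lemma psi_eq0 : (forall w, psi w = 0) ->
  forall A B, Sp R m.+2 A -> Sp R n.+2 B -> f A B = 0.
Proof.
move=> psi0; case: (fsph) => fC fL _ _.
have cst k (g : 'M[C]_(k + k)) : mxcurve (fun=> g) by apply: mxcurve_const.
have lineB A B X q : q != 0 -> Sp R m.+2 A -> Sp R n.+2 B ->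
    (forall t, unipotent R n.+2 (1%:M + t *: X)) ->
    (forall t, q.[t] != 0 -> f A ((1%:M + t *: X) *m B) = 0) -> f A B = 0.
  move=> qn0 SA SB uX f0.
  have SX t : Sp R n.+2 ((1%:M + t *: X) *m B) by apply: SpM SB; apply: unipotent_Sp.
  have := polyfun_eq0 qn0 (fC _ _ (cst _ A) (curve_affineM X B) (fun=> SA) SX) f0 0.
  by rewrite scale0r addr0 mul1mx.
have lineA A B X q : q != 0 -> Sp R m.+2 A -> Sp R n.+2 B ->
    (forall t, unipotent R m.+2 (1%:M + t *: X)) ->
    (forall t, q.[t] != 0 -> f ((1%:M + t *: X) *m A) B = 0) -> f A B = 0.
  move=> qn0 SA SB uX f0.
  have SX t : Sp R m.+2 ((1%:M + t *: X) *m A) by apply: SpM SA; apply: unipotent_Sp.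
  have := polyfun_eq0 qn0 (fC _ _ (curve_affineM X A) (cst _ B) SX (fun=> SB)) f0 0.
  by rewrite scale0r addr0 mul1mx.
have step A s z : Sp R m.+2 A -> torus_pos s ->
    A *m (Q1 *m col_e) = torus_mx s *m std_x R m ->
    A *m (Q1 *m col_f) = torus_mx s *m std_y m z ->
    forall B, Sp R n.+2 B -> f A B = 0.
  move=> SA sp Ae Af B SB.
  have om : omega (B *m (Q2 *m col_e)) (B *m (Q2 *m col_f)) = 1.
    by rewrite omega_Sp //; apply: omega_split PQ2.
  pose Z (x y : 'cV[C]_(n.+2 + n.+2)) := forall B, Sp R n.+2 B ->
    B *m (Q2 *m col_e) = x -> B *m (Q2 *m col_f) = y -> f A B = 0.
  suff ZZ : forall x y, omega x y = 1 -> Z x y by exact: ZZ om B SB erefl erefl.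
  apply: symp_pair_ind => [X x y q qn0 uX ZX B' SB' Be Bf|u x y lu Zu B' SB' Be Bf|t w tp B' SB' Be Bf].
  - apply: (lineB _ _ _ _ qn0 SA SB' uX) => t qt; apply: (ZX t qt).
    + by apply: SpM SB'; apply: unipotent_Sp.
    + by rewrite -mulmxA Be.
    + by rewrite -mulmxA Bf.
  - have := Zu (u *m B'); rewrite -!mulmxA Be Bf => <- //.
      by have := fL 1%:M u A B' (lowuni1 R _) lu SA SB'; rewrite mul1mx.
    exact: SpM (lowuni_Sp lu) SB'.
  - by rewrite (spherical_normal SA SB' sp tp Ae Af Be Bf) psi0 mulr0.
move=> A B SA SB.
pose Z (x y : 'cV[C]_(m.+2 + m.+2)) := forall A, Sp R m.+2 A ->
  A *m (Q1 *m col_e) = x -> A *m (Q1 *m col_f) = y -> f A B = 0.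
have om : omega (A *m (Q1 *m col_e)) (A *m (Q1 *m col_f)) = 1.
  by rewrite omega_Sp //; apply: omega_split PQ1.
suff ZZ : forall x y, omega x y = 1 -> Z x y by exact: ZZ om A SA erefl erefl.
apply: symp_pair_ind => [X x y q qn0 uX ZX A' SA' Ae Af|u x y lu Zu A' SA' Ae Af|t w tp A' SA' Ae Af].
- apply: (lineA _ _ _ _ qn0 SA' SB uX) => t qt; apply: (ZX t qt).
  + by apply: SpM SA'; apply: unipotent_Sp.
  + by rewrite -mulmxA Ae.
  + by rewrite -mulmxA Af.
- have := Zu (u *m A'); rewrite -!mulmxA Ae Af => <- //.
    by have := fL u 1%:M A' B lu (lowuni1 R _) SA' SB; rewrite mul1mx.
  exact: SpM (lowuni_Sp lu) SA'.
- exact: step SA' tp Ae Af B SB.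
Qed.

Lemma scalar_curve : mxcurve (fun z : C => z%:M : 'M[C]_1).
Proof.
apply: (@eq_mxcurve _ _ _ (fun t => 0 + t *: 1%:M)); last exact: mxcurve_affine.
by move=> t; rewrite add0r scale_scalar_mx mulr1.
Qed.

Lemma emb_curve k r (P : 'M[C]_(r + r, k + k)) (Q : 'M[C]_(r + r, 1 + 1))
    (g : 'M[C]_(r + r)) (B : C -> 'M[C]_(1 + 1)) :
  mxcurve B -> mxcurve (fun t => g *m symp_emb P Q 1%:M (B t)).
Proof.
move=> cB; apply: mxcurveM; first exact: mxcurve_const.
apply: mxcurveD; first exact: mxcurve_const.
by apply: mxcurveM (mxcurve_const _); apply: mxcurveM => //; apply: mxcurve_const.
Qed.

Lemma psi_poly : polyfun psi.
Proof.
case: (fsph) => fC _ _ _; apply: fC.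
- exact: mxcurve_const.
- apply: emb_curve; apply: mxcurve_block;
    [exact: mxcurve_const|exact: scalar_curve|exact: mxcurve_const|exact: mxcurve_const].
- by [].
- exact: shear2_Sp.
Qed.

(** Right translation by diag(t, 1/t) costs t^l. The pairs it produces are also the images under
    [std_torus t], on the left, of standard pairs with parameters divided by t^2, and this costs t^p
    t^p'. *)
Lemma psi_scale t w : t != 0 -> t ^+ l * psi w = t ^+ (p + p') * psi (w / t ^+ 2).
Proof.
move=> tn0; case: (fsph) => _ _ _ fR.
have SB1 : Sp R m.+2 (s1 *m symp_emb P1 Q1 1%:M (borel2 t 0)).
  by apply: SpM => //; apply: (symp_emb_Sp PQ1); [exact: Sp1 | exact: borel2_Sp].
have SB2 : Sp R n.+2 (shear2 w *m symp_emb P2 Q2 1%:M (borel2 t 0)).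
  apply: SpM; first exact: shear2_Sp.
  by apply: (symp_emb_Sp PQ2); [exact: Sp1 | exact: borel2_Sp].
rewrite -(fR _ _ _ _ _ 0 Ss1 (shear2_Sp w) (Sp1 R _) (Sp1 R _) tn0).
rewrite exprD -chi1_std // -chi2_std // -[w / _]subr0.
apply: spherical_normal => //; try exact: std_torus_pos.
- by rewrite -[LHS]mulmxA emb_borel_e // std_torus_x -scalemxAr s1e.
- rewrite -[LHS]mulmxA emb_borel_f // scale0r add0r std_torus_y // mulr0.
  by rewrite -scalemxAr s1f.
- by rewrite -[LHS]mulmxA emb_borel_e // std_torus_x -scalemxAr shear2_e.
- rewrite -[LHS]mulmxA emb_borel_f // scale0r add0r std_torus_y //.
  by rewrite mulrC divfK ?expf_neq0 // -scalemxAr shear2_f.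
Qed.

(** Square roots exist in C, so [psi_scale] at 1 reaches every nonzero parameter 1/t^2, and
    polynomiality reaches 0. *)
Lemma psi1_eq0 : psi 1 = 0 -> forall A B, Sp R m.+2 A -> Sp R n.+2 B -> f A B = 0.
Proof.
move=> psi1; apply: psi_eq0.
apply: (@polyfun_eq0 _ psi 'X) psi_poly _; first by rewrite polyX_eq0.
move=> w; rewrite hornerX => wn0; pose t := (sqrtC w)^-1.
have tn0 : t != 0 by rewrite invr_eq0 sqrtC_eq0.
have := psi_scale 1 tn0; rewrite psi1 mulr0 => /esym/eqP.
rewrite mulf_eq0 expf_eq0 (negPf tn0) andbF /= => /eqP.
by rewrite /t exprVn invrK sqrtCK mul1r.
Qed.

Lemma hook2_curve : mxcurve hook2.
Proof.
apply: mxcurve_block; [exact: scalar_curve|exact: mxcurve_const..].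
Qed.

(** The pair has x_0 = t, y_0 = 1 and minor 1, so its parameter is 1/t and its torus part has
    entries t and 1/t. *)
Lemma hook_normal k (x y : 'cV[C]_(k.+2 + k.+2)) (t : C) : t != 0 ->
  x = t *: std_x R k - std_y k 0 -> y = std_x R k ->
  exists2 u, lowuni u & u *m x = torus_mx (std_torus k t) *m std_x R k /\
    u *m y = torus_mx (std_torus k t) *m std_y k t^-1.
Proof.
move=> tn0 xE yE.
have usub_x : usubmx x = t *: delta_mx ord0 ord0 - delta_mx i1 ord0.
  by rewrite xE /std_x /std_y scale_col_mx opp_col_mx add_col_mx col_mxKu scale0r add0r.
have usub_y : usubmx y = delta_mx ord0 ord0 by rewrite yE col_mxKu.
have x0 : usubmx x ord0 ord0 = t by rewrite usub_x !mxE /= mulr1 subr0.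
have y0 : usubmx y ord0 ord0 = 1 by rewrite usub_y mxE.
have D : minor2 x y = 1.
  by rewrite /minor2 x0 y0 usub_x usub_y !mxE /= !mulr0 mulr1 !sub0r opprK.
have om : omega x y = 1.
  rewrite xE yE /std_x /std_y scale_col_mx opp_col_mx add_col_mx omega_col.
  rewrite mulmx0 [X in X - _]mxE scaler0 !sub0r [(- _)^T]raddfN /= mulNmx.
  by rewrite [X in - X]mxE opprK mxE_delta mxE.
have [||u lu uxy] := normalize_pair om; rewrite ?x0 ?D ?oner_neq0 //.
exists u => //; have := uxy (std_torus k t); rewrite x0 y0 D !mul1r; apply.
  by rewrite mxE.
by rewrite mxE.
Qed.

Lemma spherical_weights : (exists A B, [/\ Sp R m.+2 A, Sp R n.+2 B & f A B != 0]) ->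
  [/\ exists a, [/\ (l + a.*2 = p + p')%N, (a <= p)%N & (a <= p')%N],
      forall s, torus_pos s -> s ord0 ord0 = 1 -> s ord0 i1 = 1 -> chi1 s = 1
    & forall s, torus_pos s -> s ord0 ord0 = 1 -> s ord0 i1 = 1 -> chi2 s = 1].
Proof.
move=> [A [B [SA SB fAB]]]; case: (fsph) => fC fL fT _.
set c := psi 1; have cn0 : c != 0.
  by apply: contraNneq fAB => /psi1_eq0->.
have S1 := shear1_Sp 0; have S2 := shear2_Sp 1.
have fc : f (shear1 0) (shear2 1) = c by rewrite psi_shear subr0.
split; first last.
- move=> s sp s0 s1'; have [sx sy] := std_torus_fix 1 s0 s1'.
  apply: (mulIf cn0); rewrite mul1r -{2}fc.
  rewrite (@spherical_normal _ _ (const_mx 1) s 0 1 S1 S2 (@torus_pos1 _ _) sp).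
  + by rewrite chi1_1 mul1r subr0.
  + by rewrite torus1 mul1mx shear1_e.
  + by rewrite torus1 mul1mx shear1_f.
  + by rewrite sx shear2_e.
  + by rewrite sy; exact: shear2_f.
- move=> s sp s0 s1'; have [sx sy] := std_torus_fix 0 s0 s1'.
  apply: (mulIf cn0); rewrite mul1r -{2}fc.
  rewrite (@spherical_normal _ _ s (const_mx 1) 0 1 S1 S2 sp (@torus_pos1 _ _)).
  + by rewrite chi2_1 mulr1 subr0.
  + by rewrite sx shear1_e.
  + by rewrite sy shear1_f.
  + by rewrite torus1 mul1mx shear2_e.
  + by rewrite torus1 mul1mx; exact: shear2_f.
have [a [laE psiE]] := polyfun_homogeneous psi_poly (cn0 : psi 1 != 0) (fun t => @psi_scale t 1).
rewrite -/c in psiE; move: c cn0 psiE {fc} => c cn0 psiE.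
exists a; split=> //.
(* For nonzero t this is t^p psi(-1/t) = c (-1)^a t^(p - a); polynomiality at t = 0 excludes a pole.
   In the second factor the sign disappears, since the difference of parameters is 1/t. *)
- pose h t := f (s1 *m symp_emb P1 Q1 1%:M (hook2 t)) (shear2 0).
  have Sh t : Sp R m.+2 (s1 *m symp_emb P1 Q1 1%:M (hook2 t)).
    by apply: SpM => //; apply: (symp_emb_Sp PQ1); [exact: Sp1 | exact: hook2_Sp].
  have ph : polyfun h.
    apply: fC => [||//|t]; [exact: emb_curve hook2_curve|exact: mxcurve_const|].
    exact: shear2_Sp.
  apply: (@polyfun_no_pole _ h (c * (-1) ^+ a)) => //; first by rewrite mulf_neq0 ?signr_eq0.
  move=> t tn0; have := @hook_normal m _ _ t tn0 erefl erefl.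
  move=> [u lu [ux uy]]; have Su := lowuni_Sp lu.
  rewrite /h -(fL u 1%:M _ _ lu (lowuni1 R _) (Sh t) (shear2_Sp 0)) mul1mx.
  rewrite (@spherical_normal _ _ (std_torus m t) (const_mx 1) t^-1 0 (SpM Su (Sh t))
    (shear2_Sp 0) (@std_torus_pos _ _ tn0) (@torus_pos1 _ _)).
  + rewrite chi1_std // chi2_1 mulr1 sub0r psiE ?oppr_eq0 ?invr_eq0 //.
    by rewrite -mulrA -[c * _ * _]mulrA -exprMn mulNr mulVf // mulrC.
  + rewrite -!mulmxA emb_hook_e // (mulmxBr s1) -scalemxAr s1e s1f.
    by rewrite ux.
  + by rewrite -!mulmxA emb_hook_f // s1e uy.
  + by rewrite torus1 mul1mx shear2_e.
  + by rewrite torus1 mul1mx; exact: shear2_f.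
- pose h t := f (shear1 0) (s2 *m symp_emb P2 Q2 1%:M (hook2 t)).
  have Sh t : Sp R n.+2 (s2 *m symp_emb P2 Q2 1%:M (hook2 t)).
    by apply: SpM => //; apply: (symp_emb_Sp PQ2); [exact: Sp1 | exact: hook2_Sp].
  have ph : polyfun h.
    apply: fC => [|||//]; [exact: mxcurve_const|exact: emb_curve hook2_curve|].
    by move=> _; apply: shear1_Sp.
  apply: (@polyfun_no_pole _ h c) => // t tn0.
  have := @hook_normal n _ _ t tn0 erefl erefl.
  move=> [u lu [ux uy]]; have Su := lowuni_Sp lu.
  rewrite /h -(fL 1%:M u _ _ (lowuni1 R _) lu (shear1_Sp 0) (Sh t)) mul1mx.
  rewrite (@spherical_normal _ _ (const_mx 1) (std_torus n t) 0 t^-1 (shear1_Sp 0)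
    (SpM Su (Sh t)) (@torus_pos1 _ _) (@std_torus_pos _ _ tn0)).
  + rewrite chi2_std // chi1_1 mul1r subr0 psiE ?invr_eq0 //.
    by rewrite -mulrA -[c * _ * _]mulrA -exprMn mulVf // expr1n mulr1 mulrC.
  + by rewrite torus1 mul1mx shear1_e.
  + by rewrite torus1 mul1mx shear1_f.
  + rewrite -!mulmxA emb_hook_e // (mulmxBr s2) -scalemxAr s2e s2f.
    by rewrite ux.
  + by rewrite -!mulmxA emb_hook_f // s2e uy.
Qed.

End SphericalFunction.

(** * Weights evaluated on torus elements *)

Section WeightsOfTorus.
Variable R : realType.
Local Notation C := (complex R).
Local Notation i1 := (lift ord0 ord0).

Lemma weight_val_neq0 r (lam : 'rV[int]_r) (t : 'rV[C]_r) :
  torus_pos t -> weight_val lam t != 0.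
Proof. by move=> tn0; apply/prodf_neq0 => i _; rewrite expfz_neq0. Qed.

Lemma weight_val1 r (lam : 'rV[int]_r) : weight_val lam (const_mx 1 : 'rV[C]_r) = 1.
Proof. by rewrite /weight_val big1 // => i _; rewrite mxE exp1rz. Qed.

Lemma weight_val0 r (t : 'rV[C]_r) : weight_val 0 t = 1.
Proof. by rewrite /weight_val big1 // => i _; rewrite mxE expr0z. Qed.

Lemma weight_valD r (lam mu : 'rV[int]_r) (t : 'rV[C]_r) : torus_pos t ->
  weight_val (lam + mu) t = weight_val lam t * weight_val mu t.
Proof.
move=> tn0; rewrite /weight_val -big_split /=; apply: eq_bigr => i _.
by rewrite mxE expfzDr.
Qed.

Lemma weight_valMn r (lam : 'rV[int]_r) (t : 'rV[C]_r) k : torus_pos t ->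
  weight_val (lam *+ k) t = weight_val lam t ^+ k.
Proof.
move=> tn0; elim: k => [|k IHk]; first by rewrite mulr0n weight_val0 expr0.
by rewrite mulrS exprS weight_valD // IHk.
Qed.

Lemma weight_val_fund r k (t : 'rV[C]_r) :
  weight_val (fund_weight r k) t = \prod_(i < r | (i < k)%N) t ord0 i.
Proof.
rewrite /weight_val [RHS]big_mkcond; apply: eq_bigr => i _.
by rewrite mxE; case: (i < k)%N; rewrite ?expr1z ?expr0z.
Qed.

Lemma weight_val_fund1 k (t : 'rV[C]_k.+2) : weight_val (fund_weight k.+2 1) t = t ord0 ord0.
Proof.
rewrite weight_val_fund (bigD1 ord0) //= big1 ?mulr1 // => i /andP[].
by rewrite ltnS leqn0 -val_eqE /= => ->.
Qed.

Lemma weight_val_fund2 k (t : 'rV[C]_k.+2) :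
  weight_val (fund_weight k.+2 2) t = t ord0 ord0 * t ord0 i1.
Proof.
rewrite weight_val_fund (bigD1 ord0) //= (bigD1 i1) //= big1 ?mulr1 // => i.
by move=> /andP[/andP[]]; rewrite -!val_eqE /=; case: (val i) => [|[]].
Qed.

Lemma dominant_first_two r (c : 'I_r.+2 -> nat) :
  (forall i : 'I_r.+2, (1 < i)%N -> c i = 0%N) ->
  \sum_(i < r.+2) fund_weight r.+2 i.+1 *+ c i =
  fund_weight r.+2 1 *+ c ord0 + fund_weight r.+2 2 *+ c i1.
Proof.
move=> c0; rewrite 2!big_ord_recl /= [X in _ + (_ + X)]big1 ?addr0 //.
by move=> i _; rewrite (c0 (lift ord0 (lift ord0 i))) ?mulr0n.
Qed.

Lemma dominant_fund r c0 c1 :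
  dominant (fund_weight r.+2 1 *+ c0 + fund_weight r.+2 2 *+ c1).
Proof.
exists (fun i => if i == ord0 then c0 else if i == i1 then c1 else 0%N).
rewrite dominant_first_two //= => i.
by rewrite -!val_eqE /=; case: (val i) => [|[]].
Qed.

(** From the second fundamental weight on, the factors a and a^-1 cancel. *)
Lemma weight_val_std_torus r (c : 'I_r.+2 -> nat) (a : C) : a != 0 ->
  weight_val (\sum_(i < r.+2) fund_weight r.+2 i.+1 *+ c i) (std_torus r a) = a ^+ c ord0.
Proof.
move=> an0; have tp := @std_torus_pos R r a an0.
have fund_std k : (0 < k)%N -> weight_val (fund_weight r.+2 k) (std_torus r a) =
    if k == 1%N then a else 1.
  move=> k0; rewrite weight_val_fund (bigD1 ord0) //= mxE eqxx.
  case: eqP => [->|/eqP kn1].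
    rewrite big1 ?mulr1 // => i /andP[]; rewrite ltnS leqn0 -val_eqE /=.
    by move=> ->.
  have k1 : (1 < k)%N by case: k k0 kn1 => [|[]].
  rewrite (bigD1 i1) /= ?k1 // mxE /= big1 ?mulr1 ?mulfV // => i.
  by move=> /andP[/andP[_ i0 i1']]; rewrite mxE (negPf i0) (negPf i1').
rewrite big_ord_recl weight_valD // weight_valMn // fund_std // eqxx.
suff -> : weight_val (\sum_(i < r.+1) fund_weight r.+2 (lift ord0 i).+1 *+ c (lift ord0 i))
    (std_torus r a) = 1 by rewrite mulr1.
elim/big_ind: _ => [|x y|i _]; first exact: weight_val0.
  by rewrite weight_valD // => -> ->; rewrite mulr1.
by rewrite weight_valMn // fund_std //= expr1n.
Qed.

(** Test on the torus element with entry 2 at i and 1 elsewhere. All fundamental weights take values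
    2^0 or 2^1 there, so no cancellation can hide the factor 2^(c i). *)
Lemma trivial_on_tail r (c : 'I_r.+2 -> nat) :
  (forall s : 'rV[C]_r.+2, torus_pos s -> s ord0 ord0 = 1 -> s ord0 i1 = 1 ->
     weight_val (\sum_(i < r.+2) fund_weight r.+2 i.+1 *+ c i) s = 1) ->
  forall i : 'I_r.+2, (1 < i)%N -> c i = 0%N.
Proof.
move=> triv i i_gt1; pose s : 'rV[C]_r.+2 := \row_j (if j == i then 2 else 1).
have sp : torus_pos s.
  by move=> j; rewrite mxE; case: ifP => _; rewrite ?oner_eq0 // pnatr_eq0.
have s0 : s ord0 ord0 = 1 by rewrite mxE -val_eqE /=; case: (val i) i_gt1.
have s1 : s ord0 i1 = 1 by rewrite mxE -val_eqE /=; case: (val i) i_gt1 => [|[]].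
have fund_s k : weight_val (fund_weight r.+2 k) s = 2 ^+ (i < k)%N.
  rewrite weight_val_fund; case: (ltnP i k) => ik.
    rewrite (bigD1 i) //= mxE eqxx big1 ?mulr1 // => j /andP[_ /negPf nji].
    by rewrite mxE nji.
  rewrite big1 // => j jk; rewrite mxE; case: eqP => // ji.
  by move: jk; rewrite ji ltnNge ik.
have prod2 : exists N, weight_val (\sum_(j < r.+2 | j != i) fund_weight r.+2 j.+1 *+ c j) s
    = 2 ^+ N.
  elim/big_ind: _ => [|x y [a xa] [b yb]|j _].
  - by exists 0%N; rewrite weight_val0.
  - by exists (a + b)%N; rewrite weight_valD // xa yb exprD.
  - by exists ((i < j.+1)%N * c j)%N; rewrite weight_valMn // fund_s exprM.
have := triv s sp s0 s1; rewrite (bigD1 i) //= weight_valD // weight_valMn // fund_s ltnSn.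
have [N ->] := prod2; rewrite expr1 -exprD => /eqP.
rewrite -natrX (eqr_nat C _ 1) => /eqP/(congr1 (fun k => logn 2 k)).
by rewrite pfactorK // logn1 => /eqP; rewrite addn_eq0 => /andP[/eqP].
Qed.

Lemma weight_val_sl2 (t : 'rV[C]_1) l : weight_val (fund_weight 1 1 *+ l) t = t ord0 ord0 ^+ l.
Proof.
rewrite /weight_val big_ord1 mulmxnE mxE /=.
by rewrite mulr1n natz -exprnP.
Qed.

End WeightsOfTorus.

(** * The groups G and H, and the necessary condition on weights *)

Section GroupG.
Variables (R : realType) (m n : nat).
Local Notation C := (complex R).
Local Notation G := (@G R m.+2 n.+2).

Lemma mem_G A B : Sp R m.+2 A -> Sp R n.+2 B -> G (G_mx A B).
Proof. by move=> SA SB; exists A => //; exists B. Qed.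

Lemma G_P X : G X -> exists A B, [/\ Sp R m.+2 A, Sp R n.+2 B & X = G_mx A B].
Proof. by move=> [A SA [B SB <-]]; exists A, B. Qed.

Lemma G_mxM (A A' : 'M[C]_(m.+2 + m.+2)) (B B' : 'M[C]_(n.+2 + n.+2)) :
  G_mx A B *m G_mx A' B' = G_mx (A *m A') (B *m B').
Proof. by rewrite /G_mx mulmx_block !mul0mx !mulmx0 !addr0 add0r. Qed.

Lemma G_mx1 : G_mx 1%:M 1%:M = 1%:M :> 'M[C]_((m.+2 + m.+2) + (n.+2 + n.+2)).
Proof. by rewrite /G_mx -scalar_mx_block. Qed.

Lemma G_mx_curve (GA : C -> 'M[C]_(m.+2 + m.+2)) (GB : C -> 'M[C]_(n.+2 + n.+2)) :
  mxcurve GA -> mxcurve GB -> mxcurve (fun t => G_mx (GA t) (GB t)).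
Proof. by move=> cA cB; apply: mxcurve_block => //; apply: mxcurve_const. Qed.

Section Restriction.
Variables (d : nat) (rho : 'M[C]_((m.+2 + m.+2) + (n.+2 + n.+2)) -> 'M[C]_d).
Hypothesis rrho : is_rep G rho.

Lemma rep_pair : pair_rep (fun A B => rho (G_mx A B)).
Proof.
case: (rrho) => r1 rM rreg; split.
- by rewrite G_mx1.
- by move=> A A' B B' SA SA' SB SB'; rewrite -G_mxM rM //; apply: mem_G.
- move=> GA GB cA cB SA SB; apply: regular_mx_curve rreg _ _.
    exact: G_mx_curve.
  by move=> t; apply: mem_G.
Qed.

(** The vectors whose whole orbit is annihilated by xi form an invariant subspace; it contains v, so
    it is everything. *)
Lemma irreducible_pair : irreducible_sub G rho fullv ->
  pair_irr (fun A B => rho (G_mx A B)).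
Proof.
case: (rrho) => r1 rM _ [_ _ irr] xi v vn0 xiv.
pose P (x : 'cV[C]_d) := forall A B, Sp R m.+2 A -> Sp R n.+2 B ->
  xi *m rho (G_mx A B) *m x = 0.
have [W WP] : exists W : {vspace 'cV[C]_d}, forall x, x \in W <-> P x.
  apply: linear_pred_vspace => [A B _ _|a x y Px Py A B SA SB]; first by rewrite mulmx0.
  by rewrite mulmxDr -scalemxAr Px // Py // scaler0 addr0.
have invW : invariant_sub G rho W.
  move=> X x /G_P[A [B [SA SB ->]]] /WP Px; apply/WP => A' B' SA' SB'.
  rewrite mulmxA -(mulmxA xi) -rM; try exact: mem_G.
  by rewrite G_mxM Px //; apply: SpM.
have /WP vW : P v by [].
case: (irr W (subvf W) invW) => [W0|WT].
  by move: vW vn0; rewrite W0 memv0 => /eqP->; rewrite eqxx.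
apply/rowP => i; rewrite mxE.
have /WP/(_ 1%:M 1%:M (Sp1 R _) (Sp1 R _)) : delta_mx i ord0 \in W by rewrite WT memvf.
by rewrite G_mx1 r1 mulmx1 -colE => /colP/(_ ord0); rewrite !mxE.
Qed.

End Restriction.

End GroupG.

Section GroupH.
Variables (R : realType) (m n : nat) (hm : (1 < m.+2)%N) (hn : (1 < n.+2)%N).
Local Notation C := (complex R).
Local Notation G := (@G R m.+2 n.+2).
Local Notation H := (@H R m.+2 n.+2 hm hn).

(** The common Sp_2 is the last summand of Sp_2m but the first of Sp_2n. Swapping the summands in
    the latter makes Q1 and Q2 its two inclusions, so both factors are treated alike. *)
Lemma H_splitting : exists (P1 : 'M[C]_(m.+2 + m.+2, m.+1 + m.+1))
    (Q1 : 'M[C]_(m.+2 + m.+2, 1 + 1)) (P2 : 'M[C]_(n.+2 + n.+2, n.+1 + n.+1))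
    (Q2 : 'M[C]_(n.+2 + n.+2, 1 + 1)),
  [/\ symp_split P1 Q1, symp_split P2 Q2 & forall A B D,
    H_mx hm hn A B D = G_mx (symp_emb P1 Q1 A B) (symp_emb P2 Q2 D B)].
Proof.
have [P1 [Q1 [PQ1 E1]]] := cast_symp_split R (pred_addn1 hm).
have [Q2 [P2 [PQ2 E2]]] := cast_symp_split R (add1n_pred hn).
exists P1, Q1, P2, Q2; split=> //; first exact: symp_split_sym.
by move=> A B D; rewrite /H_mx E1 E2 /symp_emb [X in G_mx _ X]addrC.
Qed.

Lemma mem_H A B D : Sp R m.+1 A -> Sp R 1 B -> Sp R n.+1 D -> H (H_mx hm hn A B D).
Proof. by move=> SA SB SD; exists A, B, D. Qed.

Lemma H_mxM A A' B B' D D' : H_mx hm hn A B D *m H_mx hm hn A' B' D' =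
  H_mx hm hn (A *m A') (B *m B') (D *m D') :> 'M[C]__.
Proof.
have [P1 [Q1 [P2 [Q2 [PQ1 PQ2 HE]]]]] := H_splitting.
by rewrite !HE G_mxM (symp_embM PQ1) (symp_embM PQ2).
Qed.

Lemma H_sub_G X : H X -> G X.
Proof.
have [P1 [Q1 [P2 [Q2 [PQ1 PQ2 HE]]]]] := H_splitting.
move=> [A [B [D [SA SB SD ->]]]]; rewrite HE.
by apply: mem_G; [apply: (symp_emb_Sp PQ1) | apply: (symp_emb_Sp PQ2)].
Qed.

Lemma H_mx_curve (GA : C -> 'M[C]_(m.+1 + m.+1)) B (GD : C -> 'M[C]_(n.+1 + n.+1)) :
  mxcurve GA -> mxcurve GD -> mxcurve (fun t => H_mx hm hn (GA t) B (GD t)).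
Proof.
have [P1 [Q1 [P2 [Q2 [_ _ HE]]]]] := H_splitting.
move=> cA cD; apply: (@eq_mxcurve _ _ _ (fun t =>
  G_mx (symp_emb P1 Q1 (GA t) B) (symp_emb P2 Q2 (GD t) B))) => [t|].
  by rewrite HE.
apply: G_mx_curve; apply: mxcurveD; try exact: mxcurve_const.
  by apply: mxcurveM (mxcurve_const _); apply: mxcurveM => //; apply: mxcurve_const.
by apply: mxcurveM (mxcurve_const _); apply: mxcurveM => //; apply: mxcurve_const.
Qed.

End GroupH.

Section NecessaryCondition.
Variables (R : realType) (m n : nat) (hm : (1 < m.+2)%N) (hn : (1 < n.+2)%N).
Local Notation C := (complex R).
Local Notation G := (@G R m.+2 n.+2).
Local Notation H := (@H R m.+2 n.+2 hm hn).
Local Notation N := ((m.+2 + m.+2) + (n.+2 + n.+2))%N.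

(** For nonzero w this is the same as being a highest weight vector of weight (0, l omega, 0), with
    the trivial action of the outer factors already built in. *)
Definition H_semi_invariant l d (rho : 'M[C]_N -> 'M[C]_d) (w : 'cV[C]_d) : Prop :=
  forall A D t z, Sp R m.+1 A -> Sp R n.+1 D -> t != 0 ->
    rho (H_mx hm hn A (borel2 t z) D) *m w = t ^+ l *: w.

Lemma borel2_torus (t z : C) : t != 0 ->
  borel2 t z = torus_mx (const_mx t) *m upper_mx (z / t)%:M.
Proof.
move=> tn0; rewrite /torus_mx map_const_mx !diag_const_mx /upper_mx mulmx_block.
rewrite !mul0mx !mulmx0 !addr0 !add0r !mulmx1 -scalar_mxM.
by rewrite mulrC divfK.
Qed.

Lemma highest_weight_semi_invariant l e (sigma : 'M[C]_N -> 'M[C]_e) :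
  is_rep H sigma -> highest_weightH hm hn sigma (muH m.+2 n.+2 l) ->
  exists2 w, w != 0 & H_semi_invariant l sigma w.
Proof.
move=> [s1 sM sreg] [w [wn0 wU wT]]; exists w; first exact/eqP.
have S1k k := Sp1 R k; have p1 k := @torus_pos1 R k.
have wA A : Sp R m.+1 A -> sigma (H_mx hm hn A 1%:M 1%:M) *m w = w.
  move: A; apply: (@highest_weight0_fixed _ _ _ (fun A => sigma (H_mx hm hn A 1%:M 1%:M))).
  - move=> Gam cG SG; apply: regular_mx_curve sreg _ _.
      by apply: H_mx_curve => //; apply: mxcurve_const.
    by move=> t; apply: mem_H.
  - move=> A B SA SB; rewrite -sM; [|exact: mem_H..].
    by rewrite H_mxM !mulmx1.
  - by move=> u uu; apply: wU => //; apply: unipotent1.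
  - move=> t tp; have := wT t (const_mx 1) (const_mx 1) tp (p1 _) (p1 _).
    by rewrite !torus1 /= !weight_val0 weight_val_sl2 mxE expr1n !mulr1 scale1r.
have wD D : Sp R n.+1 D -> sigma (H_mx hm hn 1%:M 1%:M D) *m w = w.
  move: D; apply: (@highest_weight0_fixed _ _ _ (fun A => sigma (H_mx hm hn 1%:M 1%:M A))).
  - move=> Gam cG SG; apply: regular_mx_curve sreg _ _.
      by apply: H_mx_curve => //; apply: mxcurve_const.
    by move=> t; apply: mem_H.
  - move=> A B SA SB; rewrite -sM; [|exact: mem_H..].
    by rewrite H_mxM !mulmx1.
  - by move=> u uu; apply: wU => //; apply: unipotent1.
  - move=> t tp; have := wT (const_mx 1) (const_mx 1) t (p1 _) (p1 _) tp.
    by rewrite !torus1 /= !weight_val0 weight_val_sl2 mxE expr1n !mulr1 scale1r.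
move=> A D t z SA SD tn0; have tp : torus_pos (const_mx t : 'rV[C]_1).
  by move=> i; rewrite mxE.
have uu : unipotent R 1 (upper_mx (z / t)%:M) by apply/unipotent_upper/tr_scalar_mx.
have -> : H_mx hm hn A (borel2 t z) D = H_mx hm hn A 1%:M 1%:M *m
    (H_mx hm hn 1%:M (torus_mx (const_mx t)) 1%:M *m
    (H_mx hm hn 1%:M (upper_mx (z / t)%:M) 1%:M *m H_mx hm hn 1%:M 1%:M D)).
  rewrite (borel2_torus z tn0); move: (torus_mx _) (upper_mx _) => T U.
  rewrite (H_mxM hm hn 1%:M 1%:M U 1%:M 1%:M D) (mulmx1 U) !mul1mx.
  by rewrite (H_mxM hm hn 1%:M 1%:M T U 1%:M D) !mul1mx
    (H_mxM hm hn A 1%:M 1%:M (T *m U) 1%:M D) !mul1mx mulmx1.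
have Su := unipotent_Sp uu; have St := Sp_torus tp.
have HM X Y : H X -> H Y -> H (X *m Y).
  move=> [A1 [B1 [D1 [SA1 SB1 SD1 ->]]]] [A2 [B2 [D2 [SA2 SB2 SD2 ->]]]].
  by rewrite H_mxM; apply: mem_H; apply: SpM.
have h1 := mem_H hm hn SA (S1k 1%N) (S1k n.+1).
have h2 := mem_H hm hn (S1k m.+1) St (S1k n.+1).
have h3 := mem_H hm hn (S1k m.+1) Su (S1k n.+1).
have h4 := mem_H hm hn (S1k m.+1) (S1k 1%N) SD.
have e1 := wA A SA; have e4 := wD D SD.
have e3 := wU _ _ _ (unipotent1 R m.+1) uu (unipotent1 R n.+1).
have := wT (const_mx 1) (const_mx t) (const_mx 1) (p1 _) tp (p1 _).
rewrite !torus1 /= !weight_val0 weight_val_sl2 mxE mul1r mulr1 => e2.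
move: h1 h2 h3 h4 e1 e2 e3 e4.
move: (H_mx hm hn A 1%:M 1%:M) (H_mx hm hn 1%:M (torus_mx (const_mx t)) 1%:M).
move: (H_mx hm hn 1%:M (upper_mx (z / t)%:M) 1%:M) (H_mx hm hn 1%:M 1%:M D).
move=> X3 X4 X1 X2 h1 h2 h3 h4 e1 e2 e3 e4.
have h34 := HM _ _ h3 h4; have h234 := HM _ _ h2 h34.
rewrite (sM _ _ h1 h234) (sM _ _ h2 h34) (sM _ _ h3 h4) -!mulmxA e4 e3 e2.
by rewrite -scalemxAr e1.
Qed.

Lemma coefficient_spherical l d (rho : 'M[C]_N -> 'M[C]_d) (xi : 'rV[C]_d) (w : 'cV[C]_d) chi1 chi2
    P1 Q1 P2 Q2 :
  (forall A B D, H_mx hm hn A B D = G_mx (symp_emb P1 Q1 A B) (symp_emb P2 Q2 D B)) ->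
  is_rep G rho -> H_semi_invariant l rho w ->
  (forall u u', lowuni u -> lowuni u' -> xi *m rho (G_mx u u') = xi) ->
  (forall s t, torus_pos s -> torus_pos t ->
     xi *m rho (G_mx (torus_mx s) (torus_mx t)) = (chi1 s * chi2 t) *: xi) ->
  spherical P1 Q1 P2 Q2 l chi1 chi2
    (fun A B => (xi *m rho (G_mx A B) *m w) ord0 ord0).
Proof.
move=> HE rrho wH xiU xiT; case: (rep_pair rrho) => _ rM rC; split.
- move=> GA GB cA cB SA SB; have : mxcurve (fun t => xi *m rho (G_mx (GA t) (GB t)) *m w).
    apply: mxcurveM (mxcurve_const _); apply: mxcurveM (mxcurve_const _) _.
    exact: rC.
  by apply.
- move=> u u' A B lu lu' SA SB.
  by rewrite (rM _ _ _ _ (lowuni_Sp lu) SA (lowuni_Sp lu') SB) mulmxA xiU.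
- move=> s t A B sp tp SA SB.
  rewrite (rM _ _ _ _ (Sp_torus sp) SA (Sp_torus tp) SB) mulmxA xiT //.
  by rewrite -!scalemxAl mxE.
- move=> A B A0 B0 t z SA SB SA0 SB0 tn0; case: rrho => _ rhoM _.
  have Sb := borel2_Sp z tn0; have := H_sub_G (mem_H hm hn SA0 Sb SB0).
  rewrite -G_mxM -HE => h; rewrite rhoM //; last exact: mem_G.
  by rewrite mulmxA -(mulmxA _ _ w) wH // -scalemxAr mxE.
Qed.

Lemma irreducible_coefficient d (rho : 'M[C]_N -> 'M[C]_d) (xi : 'rV[C]_d) (w : 'cV[C]_d) :
  irreducible_rep G rho -> xi != 0 -> w != 0 ->
  exists A B, [/\ Sp R m.+2 A, Sp R n.+2 B &
    (xi *m rho (G_mx A B) *m w) ord0 ord0 != 0].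
Proof.
move=> [rrho irr] xn0 wn0; apply: contrapT => none; move/eqP: xn0; apply.
apply: (irreducible_pair rrho irr wn0) => A B SA SB.
apply: contrapT => /eqP AB; apply: none; exists A, B; split=> //.
apply: contraNneq AB => AB; apply/eqP/matrixP => i j.
by rewrite !ord1 AB mxE.
Qed.

Lemma multiplicity_weights l (lam : weightG m.+2 n.+2) :
  dominantG lam -> multiplicityGH R hm hn lam (muH m.+2 n.+2 l) 1 ->
  exists abc l1 l2, (l1 + l2)%N = l /\
    lam = genG m.+2 n.+2 abc + (fund_weight m.+2 1 *+ l1, fund_weight n.+2 1 *+ l2).
Proof.
move=> [[c1 lam1] [c2 lam2]] [d [e [rho [sigma [irho [v [vn0 vU vT]] [rsig _] hws mult]]]]].
have [w0 w0n0 w0H] := highest_weight_semi_invariant rsig hws.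
have [r [W [_ _ _ card1]]] := mult.
have [i0] : exists i, i \in [pred i : 'I_r | `[< sub_iso H rho (W i) sigma >]].
  apply/existsP; rewrite -[[exists _, _]]negbK negb_exists; apply/negP => /forallP none.
  by move: card1; rewrite eq_card0 // => i; apply/negbTE/none.
move=> /asboolP[F [FH Finj _]].
pose w := F *m w0; have wn0 : w != 0.
  apply: contraNneq w0n0 => w_0; apply/eqP/Finj; rewrite mulmx0; exact: w_0.
have wH : H_semi_invariant l rho w.
  move=> A D t z SA SD tn0; rewrite /w mulmxA FH; last first.
    by apply: mem_H => //; apply: borel2_Sp.
  by rewrite -mulmxA w0H // -scalemxAr.
have [P1 [Q1 [P2 [Q2 [PQ1 PQ2 HE]]]]] := H_splitting R hm hn.
have [s1 [Ss1 s1e s1f]] := Sp_transitive (omega_split PQ1).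
have [s2 [Ss2 s2e s2f]] := Sp_transitive (omega_split PQ2).
have [rrho irr] := irho; have /eqP vn0' := vn0.
have chi_n0 s t : torus_pos s -> torus_pos t ->
    weight_val lam.1 s * weight_val lam.2 t != 0 :> C.
  by move=> sp tp; rewrite mulf_neq0 ?weight_val_neq0.
have [xi [xiv xiU xiT]] := lowest_functional (rep_pair rrho) vU vT
  (irreducible_pair rrho irr) vn0' chi_n0.
have xin0 : xi != 0 by apply: contraNneq xiv => ->; rewrite mul0mx.
have fsph := coefficient_spherical HE rrho wH xiU xiT.
have std1 a : a != 0 -> weight_val lam.1 (std_torus m a) = a ^+ c1 ord0 :> C.
  by move=> an0; rewrite lam1 weight_val_std_torus.
have std2 a : a != 0 -> weight_val lam.2 (std_torus n a) = a ^+ c2 ord0 :> C.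
  by move=> an0; rewrite lam2 weight_val_std_torus.
have [[a [la ap ap']] triv1 triv2] := spherical_weights PQ1 PQ2 Ss1 Ss2 s1e s1f s2e s2f
  (weight_val1 R lam.1) (weight_val1 R lam.2) std1 std2 fsph
  (irreducible_coefficient irho xin0 wn0).
rewrite lam1 in triv1; rewrite lam2 in triv2.
have c1_0 := trivial_on_tail triv1; have c2_0 := trivial_on_tail triv2.
(* The exponent a counts copies of (varpi_1, varpi_1'); the bounds on a make both truncated
   differences exact. *)
exists (a, c1 (lift ord0 ord0), c2 (lift ord0 ord0)), (c1 ord0 - a)%N, (c2 ord0 - a)%N.
split; first by lia.
rewrite [lam]surjective_pairing lam1 lam2 !dominant_first_two // /genG /=.
congr pair; rewrite /= !pairMnE /=.
  by rewrite mul0rn addr0 addrAC -mulrnDr subnKC.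
by rewrite mul0rn addr0 addrAC -mulrnDr subnKC.
Qed.

End NecessaryCondition.

(** * Subrepresentations, orthogonal complements and complete reducibility *)

Section Coordinates.
Variables (F : fieldType) (d : nat) (W : {vspace 'cV[F]_d}).

Lemma subspace_coordinates : exists (B : 'M[F]_(d, \dim W)) (K : 'M[F]_(\dim W, d)),
  [/\ K *m B = 1%:M, forall y, B *m y \in W & forall x, x \in W -> B *m (K *m x) = x].
Proof.
pose b := vbasis W; pose B := \matrix_(i, j) (b`_j : 'cV[F]_d) i ord0 : 'M_(d, \dim W).
pose K := \matrix_(j, i) coord b j (delta_mx i ord0 : 'cV[F]_d) : 'M_(\dim W, d).
have BE y : B *m y = \sum_j y j ord0 *: b`_j.
  apply/colP => i; rewrite mxE summxE; apply: eq_bigr => j _.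
  by rewrite !mxE mulrC.
have KE x j : (K *m x) j ord0 = coord b j x.
  rewrite [x in RHS]matrix_sum_delta linear_sum mxE; apply: eq_bigr => i _.
  by rewrite big_ord1 linearZ mxE mulrC.
have BW y : B *m y \in W.
  rewrite BE; apply: memv_suml => j _; apply: memvZ; apply: vbasis_mem.
  by apply: mem_nth; rewrite size_tuple.
have BK x : x \in W -> B *m (K *m x) = x.
  move=> xW; rewrite BE [RHS](coord_vbasis xW); apply: eq_bigr => j _.
  by rewrite KE.
exists B, K; split=> //; apply/matrixP => i j.
pose ej : 'cV[F]_(\dim W) := delta_mx j ord0.
have -> : (K *m B) i j = (K *m (B *m ej)) i ord0 by rewrite mulmxA -colE [RHS]mxE.
rewrite KE; have -> : B *m ej = b`_j.
  rewrite BE (bigD1 j) //= mxE !eqxx scale1r big1 ?addr0 // => j' nj.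
  by rewrite mxE (negPf nj) scale0r.
by rewrite coord_free ?mxE 1?eq_sym //; apply: basis_free (vbasisP W).
Qed.

End Coordinates.

Section Unitarity.
Variable R : realType.
Local Notation C := (complex R).

Definition adj a b (A : 'M[C]_(a, b)) : 'M[C]_(b, a) := (map_mx Num.conj A)^T.

Lemma adjM a b c (A : 'M[C]_(a, b)) (B : 'M[C]_(b, c)) : adj (A *m B) = adj B *m adj A.
Proof. by rewrite /adj map_mxM trmx_mul. Qed.

Lemma adjK a b (A : 'M[C]_(a, b)) : adj (adj A) = A.
Proof. by apply/matrixP => i j; rewrite !mxE conjCK. Qed.

Lemma adj_scale a b c (A : 'M[C]_(a, b)) : adj (c *: A) = c^* *: adj A.
Proof. by apply/matrixP => i j; rewrite !mxE rmorphM. Qed.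

Lemma adj_sqr_eq0 d (x : 'cV[C]_d) : adj x *m x = 0 -> x = 0.
Proof.
move=> /matrixP/(_ ord0 ord0); rewrite !mxE => /eqP; rewrite psumr_eq0 => [/allP x0|i _].
  apply/colP => i; rewrite mxE; have := x0 i (mem_index_enum i).
  by rewrite !mxE mulrC mul_conjC_eq0 => /eqP.
by rewrite !mxE mulrC mul_conjC_ge0.
Qed.

Variables (N : nat) (X : set 'M[C]_N).

(** P is the Gram matrix of an anisotropic sesquilinear form. Carrying it along lets the notion pass
    to a subspace in any basis B, with Gram matrix [adj B *m P *m B]. *)
Definition unitary_rep d (P : 'M[C]_d) (rho : 'M[C]_N -> 'M[C]_d) : Prop :=
  (forall A, X A -> X (adj A) /\ adj (rho A) *m P = P *m rho (adj A)) /\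
  forall x : 'cV_d, adj x *m P *m x = 0 -> x = 0.

Section OneRep.
Variables (d : nat) (rho : 'M[C]_N -> 'M[C]_d).
Hypothesis rrho : is_rep X rho.

Section Subrep.
Variables (W : {vspace 'cV[C]_d}) (e : nat) (B : 'M[C]_(d, e)) (K : 'M[C]_(e, d)).
Hypotheses (KB : K *m B = 1%:M) (BW : forall y, B *m y \in W)
  (BK : forall x, x \in W -> B *m (K *m x) = x).
Hypothesis invW : invariant_sub X rho W.

Definition subrep (A : 'M[C]_N) := K *m rho A *m B.

Lemma eq_mx_cols a b (A A' : 'M[C]_(a, b)) :
  (forall y : 'cV_b, A *m y = A' *m y) -> A = A'.
Proof.
move=> AA; apply/matrixP => i j; have /colP/(_ i) := AA (delta_mx j ord0).
by rewrite -!colE !mxE.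
Qed.

Lemma subrepE A : X A -> rho A *m B = B *m subrep A.
Proof.
move=> XA; apply: eq_mx_cols => y; rewrite /subrep -!mulmxA BK //.
exact: invW.
Qed.

Lemma subrep_rep : is_rep X subrep.
Proof.
case: rrho => r1 rM rreg; split.
- by rewrite /subrep r1 mulmx1.
- move=> A A' XA XA'; rewrite /subrep rM // !mulmxA -mulmxA subrepE //.
  by rewrite /subrep !mulmxA.
- by apply: regular_mxM (regular_mx_const _ _); apply: regular_mxM => //; apply: regular_mx_const.
Qed.

Lemma subrep_irreducible : irreducible_sub X rho W -> irreducible_sub X subrep fullv.
Proof.
move=> [Wn0 _ irr]; split.
- move=> full0; apply: Wn0; apply/eqP; rewrite -subv0; apply/subvP => x xW.
  rewrite -(BK xW); have : K *m x \in fullv by apply: memvf.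
  by rewrite full0 !memv0 => /eqP->; rewrite mulmx0.
- by move=> A v _ _; apply: memvf.
move=> W' _ invW'; pose Q x := x \in W /\ K *m x \in W'.
have [W2 W2P] : exists W2 : {vspace 'cV[C]_d}, forall x, x \in W2 <-> Q x.
  apply: linear_pred_vspace; first by split; rewrite ?mulmx0 mem0v.
  move=> a x y [xW Kx] [yW Ky]; split; first by rewrite memvD ?memvZ.
  by rewrite mulmxDr -scalemxAr memvD ?memvZ.
have sub : (W2 <= W)%VS by apply/subvP => x /W2P[].
have inv2 : invariant_sub X rho W2.
  move=> A x XA /W2P[xW Kx]; apply/W2P; split; first exact: invW.
  by rewrite -(BK xW) !mulmxA -/(subrep A) -mulmxA; apply: invW'.
have BW2 y : y \in W' -> B *m y \in W2.
  by move=> yW; apply/W2P; split=> //; rewrite mulmxA KB mul1mx.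
case: (irr W2 sub inv2) => W2E.
  left; apply/eqP; rewrite -subv0; apply/subvP => y /BW2.
  rewrite W2E !memv0 => /eqP By0.
  by rewrite -[y]mul1mx -KB -mulmxA By0 mulmx0.
right; apply/vspaceP => y; rewrite memvf.
have : B *m y \in W2 by rewrite W2E.
by move=> /W2P[_]; rewrite mulmxA KB mul1mx.
Qed.

Lemma subrep_iso : sub_iso X rho W subrep.
Proof.
exists B; split.
- by move=> A XA; apply: subrepE.
- move=> y y' /(congr1 (mulmx K)).
  by rewrite !mulmxA KB !mul1mx.
- move=> w; split=> [wW|[y ->]//].
  by exists (K *m w); rewrite BK.
Qed.

Lemma subrep_unitary P : unitary_rep P rho -> unitary_rep (adj B *m P *m B) subrep.
Proof.
move=> [adjP Ppos]; split.
  move=> A XA; have [XA' rA] := adjP A XA; split=> //.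
  rewrite -!mulmxA -subrepE // !mulmxA -adjM -subrepE // adjM -!mulmxA.
  by rewrite (mulmxA (adj (rho A))) rA -!mulmxA.
move=> y; rewrite !mulmxA -adjM -mulmxA => /Ppos By0.
by rewrite -[y]mul1mx -KB -mulmxA By0 mulmx0.
Qed.

(** A vector in the kernel of the Gram matrix would be isotropic. *)
Lemma gram_unit P : unitary_rep P rho -> adj B *m P *m B \in unitmx.
Proof.
move=> /subrep_unitary[_ pos]; rewrite unitmxE unitfE -det_tr.
apply/negP => /det0P[v vn0 vM]; move/eqP: vn0; apply; apply: trmx_inj.
rewrite trmx0; apply: pos; apply: trmx_inj.
by rewrite trmx0 -mulmxA trmx_mul trmx_mul trmxK vM mul0mx.
Qed.

End Subrep.

Lemma invariant_complement P (U W : {vspace 'cV[C]_d}) : unitary_rep P rho ->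
  invariant_sub X rho U -> invariant_sub X rho W -> (W <= U)%VS ->
  exists W2 : {vspace 'cV[C]_d},
    [/\ invariant_sub X rho W2, (W + W2)%VS = U & (W :&: W2)%VS = 0%VS].
Proof.
move=> uP invU invW sWU; have [adjP Ppos] := uP.
have [B [K [KB BW BK]]] := subspace_coordinates W.
pose Q x := x \in U /\ forall y, y \in W -> adj y *m P *m x = 0.
have [W2 W2P] : exists W2 : {vspace 'cV[C]_d}, forall x, x \in W2 <-> Q x.
  apply: linear_pred_vspace; first by split=> [|y _]; rewrite ?mem0v ?mulmx0.
  move=> a x y [xW Kx] [yW Ky]; split=> [|z zW]; first by rewrite memvD ?memvZ.
  by rewrite mulmxDr -scalemxAr Kx // Ky // scaler0 addr0.
exists W2; split.
- move=> A x XA /W2P[xU xW]; apply/W2P; split; first exact: invU.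
  move=> y yW; have [XA' _] := adjP A XA; have [_ rA] := adjP _ XA'.
  rewrite -mulmxA (mulmxA P) -[A]adjK -rA -!mulmxA mulmxA -adjM mulmxA xW //.
  exact: invW.
- apply/eqP; rewrite eqEsubv; apply/andP; split.
    by rewrite subv_add sWU; apply/subvP => x /W2P[].
  apply/subvP => u uU; have Mu := gram_unit KB BW BK invW uP.
  set M := adj B *m P *m B in Mu.
  (* The orthogonal projection of u onto W; the inverse Gram matrix accounts for the basis not being
     orthonormal. *)
  pose w := B *m (invmx M *m (adj B *m (P *m u))).
  have wW : w \in W by apply: BW.
  rewrite -(subrK w u) addrC memv_add //; apply/W2P; split.
    by apply: memvB => //; apply: (subvP sWU).
  move=> y yW; rewrite -(BK y yW) adjM -!mulmxA mulmxBr mulmxBr.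
  have -> : adj B *m (P *m w) = adj B *m (P *m u).
    by rewrite /w !mulmxA -/M mulmxV // mul1mx.
  by rewrite subrr mulmx0.
- apply/eqP; rewrite -subv0; apply/subvP => x; rewrite memv_cap memv0.
  by move=> /andP[xW /W2P[_ /(_ x xW)/Ppos->]].
Qed.

Lemma irreducible_decomposition P : unitary_rep P rho ->
  exists (r : nat) (W : 'I_r -> {vspace 'cV[C]_d}),
    [/\ forall i, irreducible_sub X rho (W i), directv (\sum_(i < r) W i)%VS
      & (\sum_(i < r) W i)%VS = fullv].
Proof.
move=> uP.
(* Directness is tracked as an equality of dimensions, which is additive under concatenation of the
   lists of summands. *)
suff main n : forall U : {vspace 'cV[C]_d}, (\dim U <= n)%N -> invariant_sub X rho U ->
    exists s : seq {vspace 'cV[C]_d}, [/\ forall W, W \in s -> irreducible_sub X rho W,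
      (\sum_(W <- s) W)%VS = U & \dim U = (\sum_(W <- s) \dim W)%N].
  have [s [irr sumU dimU]] := main _ fullv (leqnn _) (fun A v _ _ => memvf _).
  rewrite big_tnth in sumU; rewrite big_tnth in dimU.
  exists (size s), (tnth (in_tuple s)); split=> //.
    by move=> i; apply: irr; apply: mem_tnth.
  by rewrite directvE /= sumU dimU.
elim: n => [|n IHn] U leUn invU.
  have -> : U = 0%VS by apply/eqP; rewrite -dimv_eq0 -leqn0.
  by exists [::]; split=> //; rewrite !big_nil ?dimv0.
have [->|Un0] := eqVneq U 0%VS.
  by exists [::]; split=> //; rewrite !big_nil ?dimv0.
have [irrU|notirr] := pselect (irreducible_sub X rho U).
  by exists [:: U]; split=> [W|//|//]; rewrite ?big_seq1 // inE => /eqP->.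
have [W [sWU invW Wn0 WnU]] : exists W : {vspace 'cV[C]_d},
    [/\ (W <= U)%VS, invariant_sub X rho W, W != 0%VS & W != U].
  apply: contrapT => none; apply: notirr; split=> // [|W sWU invW]; first exact/eqP.
  have [->|Wn0] := eqVneq W 0%VS; [by left | right].
  by apply: contrapT => /eqP WnU; apply: none; exists W.
have [W2 [inv2 addU cap0]] := invariant_complement uP invU invW sWU.
have dimU : \dim U = (\dim W + \dim W2)%N.
  by rewrite -(dimv_disjoint_sum cap0) addU.
have ltW : (\dim W < \dim U)%N.
  by rewrite ltn_neqAle dimvS // andbT; apply: contra WnU => /eqP dW; rewrite eqEdim sWU dW leqnn.
have W_gt0 : (0 < \dim W)%N by rewrite lt0n dimv_eq0.
have [|s1 [irr1 sum1 dim1]] := IHn W _ invW; first by rewrite -ltnS (leq_trans ltW).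
have [|s2 [irr2 sum2 dim2]] := IHn W2 _ inv2.
  by rewrite -ltnS (leq_trans _ leUn) // dimU -addn1 addnC leq_add2r.
exists (s1 ++ s2); split.
- by move=> V; rewrite mem_cat => /orP[/irr1|/irr2].
- by rewrite big_cat /= sum1 sum2.
- by rewrite big_cat /= -dim1 -dim2.
Qed.

End OneRep.
End Unitarity.

(** * Explicit representations with semi-invariant vectors *)

Section TensorVectors.
Variable R : comPzRingType.

Lemma tens_scalel a b c d (k : R) (A : 'M[R]_(a, b)) (B : 'M[R]_(c, d)) :
  (k *: A) *t B = k *: (A *t B).
Proof. by apply/matrixP => i j; rewrite !mxE mulrA. Qed.

Lemma tens_scaler a b c d (k : R) (A : 'M[R]_(a, b)) (B : 'M[R]_(c, d)) :
  A *t (k *: B) = k *: (A *t B).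
Proof. by apply/matrixP => i j; rewrite !mxE mulrCA. Qed.

(** The SL_2-invariant of the tensor square of C^2, with bases (x, y) and (x', y') of the two
    copies. For equal pairs it is the bivector of x and y. *)
Definition twedge a b (x y : 'cV[R]_a) (x' y' : 'cV[R]_b) : 'cV[R]_(a * b) :=
  x *t y' - y *t x'.

Lemma twedge_mul a b c d (A : 'M[R]_(c, a)) (B : 'M[R]_(d, b)) x y x' y' :
  (A *t B) *m twedge x y x' y' = twedge (A *m x) (A *m y) (B *m x') (B *m y').
Proof. by rewrite mulmxBr (tensmx_mul A B x y') (tensmx_mul A B y x'). Qed.

Lemma twedge_borel a b (t z s : R) (x y : 'cV[R]_a) (x' y' : 'cV[R]_b) :
  twedge (t *: x) (z *: x + s *: y) (t *: x') (z *: x' + s *: y') =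
  (t * s) *: twedge x y x' y'.
Proof. by apply/matrixP => i j; rewrite !mxE; ring. Qed.

Lemma twedge_shear a b (z : R) (x y : 'cV[R]_a) (x' y' : 'cV[R]_b) :
  twedge x (y + z *: x) x' (y' + z *: x') = twedge x y x' y'.
Proof. by apply/matrixP => i j; rewrite !mxE; ring. Qed.

Lemma twedge_scale a b (t s : R) (x y : 'cV[R]_a) (x' y' : 'cV[R]_b) :
  twedge (t *: x) (s *: y) (t *: x') (s *: y') = (t * s) *: twedge x y x' y'.
Proof. by apply/matrixP => i j; rewrite !mxE; ring. Qed.

Lemma twedge_pair a b (f : 'rV[R]_a) (f' : 'rV[R]_b) (x y : 'cV[R]_a) (x' y' : 'cV[R]_b) :
  ((f *t f' : 'M_(1, a * b)) *m twedge x y x' y') ord0 ord0 =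
  (f *m x) ord0 ord0 * (f' *m y') ord0 ord0 - (f *m y) ord0 ord0 * (f' *m x') ord0 ord0.
Proof.
rewrite mulmxBr (tensmx_mul f f' x y') (tensmx_mul f f' y x').
move: (f *m x) (f *m y) (f' *m x') (f' *m y') => p q r s.
by rewrite !mxE !ord1.
Qed.

Lemma tens11 a b : (1%:M : 'M[R]_a) *t (1%:M : 'M[R]_b) = 1%:M.
Proof.
apply/matrixP => i j; case: (mxtens_indexP i) => i0 i1; case: (mxtens_indexP j) => j0 j1.
rewrite tensmxE !mxE (can_eq (@mxtens_indexK _ _)) xpair_eqE.
by rewrite -natrM mulnb.
Qed.

End TensorVectors.

Section Data.
Variables (R : realType) (m n : nat) (hm : (1 < m.+2)%N) (hn : (1 < n.+2)%N).
Local Notation C := (complex R).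
Local Notation G := (@G R m.+2 n.+2).
Local Notation H := (@H R m.+2 n.+2 hm hn).
Local Notation N := ((m.+2 + m.+2) + (n.+2 + n.+2))%N.
Local Notation i1 := (lift ord0 ord0).

Definition star_rep d (rho : 'M[C]_N -> 'M[C]_d) : Prop :=
  is_rep G rho /\ forall X, rho (adj X) = adj (rho X).

Definition is_highest d (rho : 'M[C]_N -> 'M[C]_d) (lam : weightG m.+2 n.+2)
    (v : 'cV[C]_d) : Prop :=
  (forall A B, unipotent R m.+2 A -> unipotent R n.+2 B -> rho (G_mx A B) *m v = v) /\
  forall s t, torus_pos s -> torus_pos t ->
    rho (G_mx (torus_mx s) (torus_mx t)) *m v =
      (weight_val lam.1 s * weight_val lam.2 t) *: v.

Variable g0 : 'M[C]_N.

(** Irreducibility is left out on purpose, so that data can be multiplied. As rho respects adjoints,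
    [adj v] is a B^- -semi-invariant functional, and the last condition is that its coefficient with
    w is nonzero at g0. *)
Definition datum (lam : weightG m.+2 n.+2) (l : nat) : Prop :=
  exists d (rho : 'M[C]_N -> 'M[C]_d) (v w : 'cV[C]_d),
    [/\ star_rep rho, is_highest rho lam v, H_semi_invariant hm hn l rho w
      & (adj v *m rho g0 *m w) ord0 ord0 != 0].

Lemma adj_tens a b c d (A : 'M[C]_(a, b)) (B : 'M[C]_(c, d)) :
  adj (A *t B) = adj A *t adj B.
Proof. by rewrite /adj map_mxT trmx_tens. Qed.

Lemma star_rep_tens d d' (rho : 'M[C]_N -> 'M[C]_d) (rho' : 'M[C]_N -> 'M[C]_d') :
  star_rep rho -> star_rep rho' -> star_rep (fun X => rho X *t rho' X).
Proof.
move=> [[r1 rM rreg] rs] [[r1' rM' rreg'] rs']; split; last first.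
  by move=> X; rewrite rs rs' adj_tens.
split.
- by rewrite r1 r1' tens11.
- by move=> A B XA XB; rewrite rM // rM' // tensmx_mul.
- move=> i j; apply: eq_regular (regularM (rreg _ _) (rreg' _ _)) => A _.
  by rewrite mxE.
Qed.

Lemma datum0 : datum 0 0.
Proof.
exists 1%N, (fun=> 1%:M), (1%:M), (1%:M); split.
- split; last by move=> X; rewrite /adj map_mx1 trmx1.
  split=> // [A B _ _|]; first by rewrite mulmx1.
  exact: regular_mx_const.
- by split=> [A B _ _|s t _ _]; rewrite mul1mx // !weight_val0 mulr1 scale1r.
- by move=> A D t z _ _ _; rewrite mul1mx expr0 scale1r.
- by rewrite !mulmx1 /adj map_mx1 trmx1 mxE oner_neq0.
Qed.

(** In a tensor product weights add and the coefficient at g0 is the product of the two, hence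
    nonzero. *)
Lemma datumD lam l lam' l' : datum lam l -> datum lam' l' ->
  datum (lam + lam') (l + l').
Proof.
move=> [d [rho [v [w [rs [vU vT] wH c]]]]] [d' [rho' [v' [w' [rs' [vU' vT'] wH' c']]]]].
exists (d * d')%N, (fun X => rho X *t rho' X), (v *t v'), (w *t w'); split.
- exact: star_rep_tens.
- split=> [A B uA uB|s t sp tp].
    by rewrite [LHS](tensmx_mul _ _ v v') vU // vU'.
  rewrite [LHS](tensmx_mul _ _ v v') vT // vT' // tens_scalel tens_scaler scalerA.
  by rewrite !weight_valD // mulrACA.
- move=> A D t z SA SD tn0; rewrite [LHS](tensmx_mul _ _ w w') wH // wH' //.
  by rewrite tens_scalel tens_scaler scalerA exprD.
- have -> : adj (v *t v') *m (rho g0 *t rho' g0) *m (w *t w') =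
      (adj v *m rho g0 *m w) *t (adj v' *m rho' g0 *m w') :> 'M_(1, 1).
    by rewrite -!tensmx_mul -adj_tens.
  by rewrite mxE mulf_neq0 // !ord1.
Qed.

Lemma datumMn lam l k : datum lam l -> datum (lam *+ k) (l * k).
Proof.
move=> D; elim: k => [|k IHk]; first by rewrite mulr0n muln0; apply: datum0.
by rewrite mulrS mulnS; apply: datumD.
Qed.

Section Factor.
Variable k : nat.

Definition second_e : 'cV[C]_(k.+2 + k.+2) := col_mx (delta_mx i1 ord0) 0.

Lemma unipotent_std_x (A : 'M[C]_(k.+2 + k.+2)) :
  unipotent R k.+2 A -> A *m std_x R k = std_x R k.
Proof.
move=> [_ A0 A1]; rewrite -{1}[A]submxK A0 mul_block_col !mulmx0 !mul0mx !addr0.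
congr col_mx; rewrite -colE; apply/colP => i; rewrite mxE A1 // mxE eqxx andbT.
by rewrite eq_sym.
Qed.

Lemma unipotent_second_e (A : 'M[C]_(k.+2 + k.+2)) : unipotent R k.+2 A ->
  exists a, A *m second_e = second_e + a *: std_x R k.
Proof.
move=> [_ A0 A1]; exists (ulsubmx A ord0 i1).
rewrite -{1}[A]submxK A0 mul_block_col !mulmx0 !mul0mx !addr0.
rewrite /second_e /std_x scale_col_mx add_col_mx scaler0 addr0; congr col_mx.
move: (ulsubmx A) A1 => a A1; rewrite -colE; apply/colP => i; rewrite !mxE eqxx !andbT.
have [->|in0] := eqVneq i ord0; first by rewrite mulr1 add0r.
by rewrite mulr0 addr0 A1 // lt0n.
Qed.

Lemma torus_std_x (t : 'rV[C]_k.+2) : torus_mx t *m std_x R k = t ord0 ord0 *: std_x R k.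
Proof.
rewrite torus_col scale_col_mx scaler0; congr col_mx; apply/colP => i; rewrite !mxE ?mulr0 //.
by have [->|_] := eqVneq i ord0; rewrite ?mulr0.
Qed.

Lemma torus_second_e (t : 'rV[C]_k.+2) : torus_mx t *m second_e = t ord0 i1 *: second_e.
Proof.
rewrite torus_col scale_col_mx scaler0; congr col_mx; apply/colP => i; rewrite !mxE ?mulr0 //.
by have [->|_] := eqVneq i i1; rewrite ?mulr0.
Qed.

Lemma adj_std_xM (x : 'cV[C]_(k.+2 + k.+2)) :
  adj (std_x R k) *m x = (usubmx x ord0 ord0)%:M.
Proof.
rewrite -[x in LHS]vsubmxK /adj map_col_mx tr_col_mx mul_row_col map_delta_mx.
rewrite map_mx0 trmx0 mul0mx addr0; apply/matrixP => i j.
by rewrite !ord1 mxE_delta [RHS]mxE eqxx mulr1n.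
Qed.

Lemma adj_second_eM (x : 'cV[C]_(k.+2 + k.+2)) :
  adj second_e *m x = (usubmx x i1 ord0)%:M.
Proof.
rewrite -[x in LHS]vsubmxK /adj map_col_mx tr_col_mx mul_row_col map_delta_mx.
rewrite map_mx0 trmx0 mul0mx addr0; apply/matrixP => i j.
by rewrite !ord1 mxE_delta [RHS]mxE eqxx mulr1n.
Qed.

(** The standard representation of one of the two factors of G, abstracted so that both are handled
    at once: u selects the torus component, (x, y) is the hyperbolic pair of the diagonal Sp_2, and
    z0 is the parameter of its image under g0. *)
Definition symp_factor (pi : 'M[C]_N -> 'M[C]_(k.+2 + k.+2))
    (u : 'rV[C]_m.+2 -> 'rV[C]_n.+2 -> 'rV[C]_k.+2) (x y : 'cV[C]_(k.+2 + k.+2))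
    (z0 : C) : Prop :=
  [/\ star_rep pi,
      forall A B, unipotent R m.+2 A -> unipotent R n.+2 B -> unipotent R k.+2 (pi (G_mx A B)),
      forall s t, pi (G_mx (torus_mx s) (torus_mx t)) = torus_mx (u s t),
      forall A D t z, Sp R m.+1 A -> Sp R n.+1 D -> t != 0 ->
        pi (H_mx hm hn A (borel2 t z) D) *m x = t *: x /\
        pi (H_mx hm hn A (borel2 t z) D) *m y = z *: x + t^-1 *: y
    & pi g0 *m x = std_x R k /\ pi g0 *m y = std_y k z0].

Lemma datum_standard pi u x y z0 lam : symp_factor pi u x y z0 ->
  (forall s t, torus_pos s -> torus_pos t ->
     weight_val lam.1 s * weight_val lam.2 t = u s t ord0 ord0) ->
  datum lam 1.
Proof.
move=> [rs hU hT hH [h0x h0y]] lamE.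
exists (k.+2 + k.+2)%N, pi, (std_x R k), x; split=> //.
- split=> [A B uA uB|s t sp tp]; first by apply: unipotent_std_x; apply: hU.
  by rewrite hT torus_std_x lamE.
- by move=> A D t z SA SD tn0; have [-> _] := hH A D t z SA SD tn0; rewrite expr1.
- by rewrite -mulmxA h0x adj_std_xM col_mxKu !mxE oner_neq0.
Qed.

Lemma datum_wedge pi u x y z0 lam : symp_factor pi u x y z0 ->
  (forall s t, torus_pos s -> torus_pos t ->
     weight_val lam.1 s * weight_val lam.2 t = u s t ord0 ord0 * u s t ord0 i1) ->
  datum lam 0.
Proof.
move=> [rs hU hT hH [h0x h0y]] lamE; pose e0 := std_x R k; pose e1 := second_e.
exists ((k.+2 + k.+2) * (k.+2 + k.+2))%N, (fun X => pi X *t pi X),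
  (twedge e0 e1 e0 e1), (twedge x y x y); split.
- exact: star_rep_tens.
- split=> [A B uA uB|s t sp tp]; rewrite twedge_mul.
    have u1 := hU A B uA uB; have [a e1E] := unipotent_second_e u1.
    by rewrite [pi _ *m e0](unipotent_std_x u1) [pi _ *m e1]e1E; apply: twedge_shear.
  rewrite hT [torus_mx _ *m e0]torus_std_x [torus_mx _ *m e1]torus_second_e lamE //.
  exact: twedge_scale.
- move=> A D t z SA SD tn0; have [hx hy] := hH A D t z SA SD tn0.
  by rewrite twedge_mul hx hy twedge_borel mulfV.
- have -> : adj (twedge e0 e1 e0 e1) =
      (adj e0 *t adj e1 - adj e1 *t adj e0 : 'M_(1, _)).
    by rewrite -!adj_tens /adj /twedge map_mxB [_^T]raddfB.
  rewrite -mulmxA twedge_mul h0x h0y mulmxBl.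
  move: (twedge_pair (adj e0) (adj e1) (std_x R k) (std_y k z0) (std_x R k) (std_y k z0)).
  move: (twedge_pair (adj e1) (adj e0) (std_x R k) (std_y k z0) (std_x R k) (std_y k z0)).
  move: (_ *m twedge _ _ _ _) (_ *m twedge _ _ _ _) => p q pE qE.
  have -> : (p - q) ord0 ord0 = p ord0 ord0 - q ord0 ord0 by rewrite !mxE.
  rewrite pE qE !adj_std_xM !adj_second_eM.
  rewrite /std_y /std_x !col_mxKu.
  (* The standard pair has [minor2] equal to 1 for every z0; antisymmetrizing both the functional
     and the vector counts it twice. *)
  rewrite [X in X != 0](_ : _ = 2%:R); first by rewrite pnatr_eq0.
  by rewrite !mxE /= !mulr1n; ring.
Qed.

End Factor.

(** The coefficient equals z0' - z0, the parameter z itself. This is why the base point must give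
    the two factors different parameters. *)
Lemma datum_mixed k pi u x y z0 k' pi' u' x' y' z0' lam :
  @symp_factor k pi u x y z0 -> @symp_factor k' pi' u' x' y' z0' -> z0' - z0 != 0 ->
  (forall s t, torus_pos s -> torus_pos t ->
     weight_val lam.1 s * weight_val lam.2 t = u s t ord0 ord0 * u' s t ord0 ord0) ->
  datum lam 0.
Proof.
move=> [rs hU hT hH [h0x h0y]] [rs' hU' hT' hH' [h0x' h0y']] zz lamE.
pose e := std_x R k; pose e' := std_x R k'.
exists ((k.+2 + k.+2) * (k'.+2 + k'.+2))%N, (fun X => pi X *t pi' X), (e *t e'),
  (twedge x y x' y'); split.
- exact: star_rep_tens.
- split=> [A B uA uB|s t sp tp].
    rewrite (tensmx_mul (pi _) (pi' _) e e') [pi _ *m e]unipotent_std_x; last exact: hU.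
    by rewrite [pi' _ *m e']unipotent_std_x //; apply: hU'.
  rewrite (tensmx_mul (pi _) (pi' _) e e') hT hT'.
  rewrite [torus_mx _ *m e]torus_std_x [torus_mx _ *m e']torus_std_x lamE //.
  by rewrite tens_scalel tens_scaler scalerA.
- move=> A D t z SA SD tn0; have [hx hy] := hH A D t z SA SD tn0.
  have [hx' hy'] := hH' A D t z SA SD tn0.
  by rewrite twedge_mul hx hy hx' hy' twedge_borel mulfV.
- rewrite -mulmxA twedge_mul h0x h0y h0x' h0y'.
  have -> : adj (e *t e') = (adj e *t adj e' : 'M_(1, _)) by rewrite -adj_tens.
  rewrite (twedge_pair (adj e) (adj e')) !adj_std_xM /std_y /std_x !col_mxKu.
  rewrite [X in X != 0](_ : _ = z0' - z0) //.
  by rewrite !mxE /= !mulr1n; ring.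
Qed.

End Data.

(** * Multiplicity one *)

Section MultiplicityOne.
Variables (R : realType) (m n : nat) (hm : (1 < m.+2)%N) (hn : (1 < n.+2)%N).
Local Notation C := (complex R).
Local Notation G := (@G R m.+2 n.+2).
Local Notation H := (@H R m.+2 n.+2 hm hn).
Local Notation N := ((m.+2 + m.+2) + (n.+2 + n.+2))%N.

Lemma adj_Sp k (A : 'M[C]_(k + k)) : Sp R k A -> Sp R k (adj A).
Proof.
move=> SA; apply: Sp_tr; rewrite /Sp /=.
have JE : map_mx Num.conj (symp_form R k) = symp_form R k.
  by rewrite /symp_form map_block_mx !map_mx0 map_mxN map_mx1.
by rewrite -{1}JE map_trmx -!map_mxM SA JE.
Qed.

Lemma adj_lowuni k (u : 'M[C]_(k + k)) : lowuni u -> unipotent R k (adj u).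
Proof.
move=> [Su u0 u1]; split.
- by apply: adj_Sp; move: Su => /Sp_tr; rewrite trmxK.
- rewrite /adj map_trmx; move: u0 => /(congr1 (map_mx (@Num.conj C))).
  by rewrite map_mx0 map_dlsubmx.
- move=> i j le_ji; have := u1 i j le_ji; rewrite !mxE => ->.
  by rewrite rmorph_nat.
Qed.

Lemma adj_torus k (t : 'rV[C]_k) : adj (torus_mx t) = torus_mx (map_mx Num.conj t).
Proof.
rewrite -[RHS]torus_tr /adj; congr (_^T).
rewrite /torus_mx map_block_mx !map_mx0 !map_diag_mx; congr block_mx.
by congr diag_mx; apply/rowP => i; rewrite !mxE fmorphV.
Qed.

Lemma conj_weight_val r (lam : 'rV[int]_r) (t : 'rV[C]_r) :
  weight_val lam (map_mx Num.conj t) = Num.conj (weight_val lam t).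
Proof.
rewrite /weight_val rmorph_prod; apply: eq_bigr => i _.
by rewrite mxE; case: (lam ord0 i) => e; rewrite /exprz /= ?fmorphV rmorphXn.
Qed.

Lemma adj_G_mx (A : 'M[C]_(m.+2 + m.+2)) (B : 'M[C]_(n.+2 + n.+2)) :
  adj (G_mx A B) = G_mx (adj A) (adj B).
Proof. by rewrite /adj /G_mx map_block_mx !map_mx0 tr_block_mx !trmx0. Qed.

Lemma adj_G X : G X -> G (adj X).
Proof.
by move=> /G_P[A [B [SA SB ->]]]; rewrite adj_G_mx; apply: mem_G; apply: adj_Sp.
Qed.

Lemma adj_cast_symp k r (e : k = r) (A : 'M[C]_(k + k)) :
  adj (cast_symp e A) = cast_symp e (adj A).
Proof. by case: r / e; rewrite /cast_symp !castmx_id. Qed.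

Lemma adj_symp_sum k l (A : 'M[C]_(k + k)) (B : 'M[C]_(l + l)) :
  adj (symp_sum A B) = symp_sum (adj A) (adj B).
Proof.
rewrite /adj -tr_symp_sum; congr (_^T); rewrite /symp_sum.
rewrite map_block_mx !map_block_mx !map_mx0.
by rewrite !map_ulsubmx !map_ursubmx !map_dlsubmx !map_drsubmx.
Qed.

Lemma adj_H X : H X -> H (adj X).
Proof.
move=> [A [B [D [SA SB SD ->]]]]; rewrite /H_mx adj_G_mx !adj_cast_symp !adj_symp_sum.
by exists (adj A), (adj B), (adj D); split=> //; apply: adj_Sp.
Qed.

(** The components of w in a direct sum of invariant subspaces are again semi-invariant, by
    uniqueness of the decomposition. Their coefficients add up to that of w, so one is nonzero. *)
Lemma component l d (rho : 'M[C]_N -> 'M[C]_d) r (W : 'I_r -> {vspace 'cV[C]_d})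
    (eta : 'rV[C]_d) (w : 'cV[C]_d) :
  (forall i, invariant_sub H rho (W i)) -> directv (\sum_(i < r) W i)%VS ->
  (\sum_(i < r) W i)%VS = fullv -> H_semi_invariant hm hn l rho w ->
  (eta *m w) ord0 ord0 != 0 ->
  exists i w', [/\ w' \in W i, H_semi_invariant hm hn l rho w'
    & (eta *m w') ord0 ord0 != 0].
Proof.
move=> invW dW sumW wH etaw; have : w \in (\sum_(i < r) W i)%VS by rewrite sumW memvf.
move=> /memv_sumP[ws wsW wE].
have [i etai] : exists i0, (eta *m ws i0) ord0 ord0 != 0.
  apply: contrapT => /forallNP none; move/eqP: etaw; apply.
  rewrite wE mulmx_sumr summxE big1 // => i _.
  by apply: contrapT => /eqP; apply: none.
exists i, (ws i); split=> //; first exact: wsW.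
move=> A D t z SA SD tn0; have Hh := mem_H hm hn SA (borel2_Sp z tn0) SD.
have := directv_sum_unique dW (fun i => rho (H_mx hm hn A (borel2 t z) D) *m ws i)
  (fun i => t ^+ l *: ws i).
move=> /(_ (fun j _ => invW j _ _ Hh (wsW j isT))).
move=> /(_ (fun j _ => memvZ _ (wsW j isT))).
rewrite -mulmx_sumr -scaler_sumr -wE wH // eqxx => /esym/forallP/(_ i)/eqP.
by [].
Qed.

Variables (P1 : 'M[C]_(m.+2 + m.+2, m.+1 + m.+1)) (Q1 : 'M[C]_(m.+2 + m.+2, 1 + 1)).
Variables (P2 : 'M[C]_(n.+2 + n.+2, n.+1 + n.+1)) (Q2 : 'M[C]_(n.+2 + n.+2, 1 + 1)).
Hypotheses (PQ1 : symp_split P1 Q1) (PQ2 : symp_split P2 Q2).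
Hypothesis HE : forall A B D,
  H_mx hm hn A B D = G_mx (symp_emb P1 Q1 A B) (symp_emb P2 Q2 D B).
Variables (s1 : 'M[C]_(m.+2 + m.+2)) (s2 : 'M[C]_(n.+2 + n.+2)).
Hypotheses (Ss1 : Sp R m.+2 s1) (Ss2 : Sp R n.+2 s2).
Hypotheses (s1e : s1 *m (Q1 *m col_e R) = std_x R m)
           (s1f : s1 *m (Q1 *m col_f R) = std_y m 0).
Hypotheses (s2e : s2 *m (Q2 *m col_e R) = std_x R n)
           (s2f : s2 *m (Q2 *m col_f R) = std_y n 0).

(** The pairs here have parameters 0 and 1, so a coefficient at this point is [psi 1], the value
    that determines the spherical function. *)
Definition base_point : 'M[C]_N := G_mx s1 (shear2 P2 Q2 s2 1).

Lemma base_point_G : G base_point.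
Proof. by apply: mem_G => //; apply: shear2_Sp. Qed.

Lemma sub_rep_H d (rho : 'M[C]_N -> 'M[C]_d) : is_rep G rho -> is_rep H rho.
Proof.
move=> [r1 rM rreg]; split=> // [A B HA HB|i j].
  by apply: rM; apply: H_sub_G.
by have [p pE] := rreg i j; exists p => A /H_sub_G; apply: pE.
Qed.

Lemma semi_invariant_highest l e (sigma : 'M[C]_N -> 'M[C]_e) (w : 'cV[C]_e) :
  w != 0 -> H_semi_invariant hm hn l sigma w ->
  highest_weightH hm hn sigma (muH m.+2 n.+2 l).
Proof.
move=> wn0 wH; exists w; split; first exact/eqP.
  move=> A B D uA uB uD; have BE : B = borel2 1 (ursubmx B ord0 ord0).
    case: uB => SB B0 B1; have dB : drsubmx B = 1%:M.
      apply/matrixP => i j; rewrite !ord1 unipotent_dr ?mxE //.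
    rewrite -{1}[B]submxK B0 dB /borel2 invr1 -mx11_scalar; congr block_mx.
    by apply/matrixP => i j; rewrite !ord1 B1 // mxE.
  by rewrite BE wH ?oner_neq0 ?expr1n ?scale1r //; apply: unipotent_Sp.
move=> s t u sp tp up; rewrite /= !weight_val0 weight_val_sl2 mul1r mulr1.
have -> : torus_mx t = borel2 (t ord0 ord0) 0.
  rewrite /torus_mx /borel2 raddf0; congr block_mx; apply/matrixP => i j;
    by rewrite !mxE !ord1.
by rewrite wH //; apply: Sp_torus.
Qed.

Lemma multiplicity_one l d (rho : 'M[C]_N -> 'M[C]_d) (P : 'M[C]_d) (xi : 'rV[C]_d)
    (w : 'cV[C]_d) (lam : weightG m.+2 n.+2) :
  dominantG lam -> irreducible_rep G rho -> highest_weightG rho lam ->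
  unitary_rep H P rho ->
  (forall u u', lowuni u -> lowuni u' -> xi *m rho (G_mx u u') = xi) ->
  (forall s t, torus_pos s -> torus_pos t ->
     xi *m rho (G_mx (torus_mx s) (torus_mx t)) =
       (weight_val lam.1 s * weight_val lam.2 t) *: xi) ->
  H_semi_invariant hm hn l rho w -> (xi *m rho base_point *m w) ord0 ord0 != 0 ->
  multiplicityGH R hm hn lam (muH m.+2 n.+2 l) 1.
Proof.
move=> [[c1 lam1] [c2 lam2]] irho hwrho uP xiU xiT wH xiw.
have [rrho _] := irho; have rH := sub_rep_H rrho.
have xin0 : xi != 0.
  by apply: contraNneq xiw => ->; rewrite !mul0mx mxE.
have std1 a : a != 0 -> weight_val lam.1 (std_torus m a) = a ^+ c1 ord0 :> C.
  by move=> an0; rewrite lam1 weight_val_std_torus.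
have std2 a : a != 0 -> weight_val lam.2 (std_torus n a) = a ^+ c2 ord0 :> C.
  by move=> an0; rewrite lam2 weight_val_std_torus.
(* If the coefficient of z vanishes at the base point, it vanishes on all of G by [psi1_eq0], which
   irreducibility forbids for z nonzero. *)
have inj z : H_semi_invariant hm hn l rho z ->
    (xi *m rho base_point *m z) ord0 ord0 = 0 -> z = 0.
  move=> zH z0; apply/eqP; apply: contraT => zn0.
  have [A [B [SA SB]]] := irreducible_coefficient irho xin0 zn0.
  have fsph := coefficient_spherical HE rrho zH xiU xiT.
  by rewrite (psi1_eq0 PQ1 PQ2 Ss1 Ss2 s1e s1f s2e s2f std1 std2 fsph z0 SA SB) eqxx.
have [r [W [irrW dirW sumW]]] := irreducible_decomposition uP.
have invW i : invariant_sub H rho (W i) by case: (irrW i).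
have [i [wi [wiW wiH xiwi]]] := component invW dirW sumW wH xiw.
have win0 : wi != 0.
  by apply: contraNneq xiwi => ->; rewrite mulmx0 mxE.
have [B [K [KB BW BK]]] := subspace_coordinates (W i).
pose sigma := subrep rho B K.
have isoW : sub_iso H rho (W i) sigma by apply: subrep_iso.
have KH : H_semi_invariant hm hn l sigma (K *m wi).
  move=> A D t z SA SD tn0; rewrite /sigma /subrep -!mulmxA BK //.
  by rewrite wiH // -scalemxAr.
exists d, (\dim (W i)), rho, sigma; split=> //.
- split; first exact: subrep_rep.
  exact: subrep_irreducible.
- apply: semi_invariant_highest KH.
  by apply: contraNneq win0 => Kw0; rewrite -(BK wi wiW) Kw0 mulmx0.
exists r, W; split=> //.
rewrite (@eq_card1 _ i) // => j; rewrite !inE.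
apply/asboolP/eqP => [[F [FH Finj FW]]|-> //].
apply: contrapT => /eqP nji; pose wj := F *m (K *m wi).
have wjW : wj \in W j by apply/FW; exists (K *m wi).
have wjH : H_semi_invariant hm hn l rho wj.
  move=> A D t z SA SD tn0; rewrite /wj mulmxA FH; last first.
    by apply: mem_H => //; apply: borel2_Sp.
  by rewrite -mulmxA KH // -scalemxAr.
have wjn0 : wj != 0.
  apply: contraNneq win0 => wj0; rewrite -(BK wi wiW).
  have -> : K *m wi = 0 by apply: Finj; rewrite mulmx0.
  by rewrite mulmx0.
pose eta := xi *m rho base_point.
pose a := (eta *m wi) ord0 ord0; pose b := (eta *m wj) ord0 ord0.
(* This combination is chosen so that its coefficient at the base point is a b - b a = 0. Hence wj
   is proportional to wi, although it lies in another summand. *)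
have zE : a *: wj + (- b) *: wi = 0.
  apply: inj.
    move=> A D t z SA SD tn0; rewrite mulmxDr -!scalemxAr wjH // wiH //.
    by rewrite scalerDr !scalerA [a * _]mulrC [- b * _]mulrC.
  rewrite -/eta mulmxDr -!scalemxAr; move: (eta *m wj) (eta *m wi) @a @b => p q a b.
  by rewrite /a /b !mxE mulNr mulrC subrr.
have wjWi : wj \in W i.
  have -> : wj = (a^-1 * b) *: wi.
    apply: (@scalerI _ _ a) => //; rewrite scalerA mulVKf //.
    by apply/eqP; rewrite -subr_eq0 -scaleNr zE.
  exact: memvZ.
have /directv_sumP/(_ i isT) cap0 := dirW.
have : wj \in (W i :&: \sum_(k < r | k != i) W k)%VS.
  rewrite memv_cap wjWi; apply: (subvP (sumv_sup j _ (subvv _))) => //.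
by rewrite cap0 memv0 (negPf wjn0).
Qed.

(** The component W i on which [adj v] has a nonzero coefficient with a semi-invariant vector must
    have highest weight [lam]: the projection of v to it is nonzero, since otherwise [adj v] would
    vanish on W i. *)
Lemma datum_multiplicity lam l : dominantG lam ->
  datum hm hn base_point lam l -> multiplicityGH R hm hn lam (muH m.+2 n.+2 l) 1.
Proof.
move=> dlam [d [rho [v [w [[rrho star] [vU vT] wH vw]]]]].
have uG : unitary_rep G 1%:M rho.
  split=> [A GA|x]; first by rewrite mulmx1 mul1mx star; split=> //; apply: adj_G.
  by rewrite mulmx1; apply: adj_sqr_eq0.
have [r [W [irrW dirW sumW]]] := irreducible_decomposition uG.
have invW i : invariant_sub G rho (W i) by case: (irrW i).
have HW i : invariant_sub H rho (W i) by move=> A x /H_sub_G; apply: invW.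
have [i [wi [wiW wiH xiwi]]] := component HW dirW sumW wH vw.
have [B [K [KB BW BK]]] := subspace_coordinates (W i).
pose tau := subrep rho B K; pose M := adj B *m 1%:M *m B.
have tauB A : G A -> rho A *m B = B *m tau A by apply: subrepE.
have uM : M \in unitmx := gram_unit KB BW BK (invW i) uG.
have utau : unitary_rep G M tau := subrep_unitary KB BW BK (invW i) uG.
(* the orthogonal projection onto W i, in the coordinates K *)
pose pr := invmx M *m adj B.
have prG A : G A -> pr *m rho A = tau A *m pr.
  move=> GA; have [GA' tA] := utau.1 _ (adj_G GA); rewrite adjK in tA.
  have BA : adj B *m rho A = adj (tau (adj A)) *m adj B.
    by rewrite -adjM -tauB ?adjM -?star ?adjK //; apply: adj_G.
  rewrite /pr -mulmxA BA !mulmxA; congr (_ *m _).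
  by apply: (canRL (mulmxK uM)); rewrite -mulmxA tA mulKmx.
have taurep : is_rep G tau by apply: subrep_rep.
have xiw' : (adj v *m B *m tau base_point *m (K *m wi)) ord0 ord0 != 0.
  have -> : adj v *m B *m tau base_point *m (K *m wi) = adj v *m rho base_point *m wi.
    rewrite -(mulmxA (adj v)) -tauB; last exact: base_point_G.
    by rewrite -!mulmxA BK.
  exact: xiwi.
apply: (@multiplicity_one l _ tau M (adj v *m B) (K *m wi)) => //.
- by split=> //; apply: subrep_irreducible.
- exists (pr *m v); split.
  + move=> prv0; move/eqP: xiw'; apply.
    suff -> : adj v *m B = 0 by rewrite !mul0mx mxE.
    rewrite -[adj v *m B]adjK adjM adjK.
    have -> : adj B *m v = M *m (pr *m v) by rewrite /pr -mulmxA mulKVmx.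
    by rewrite prv0 mulmx0 /adj map_mx0 trmx0.
  + move=> A A' uA uA'; rewrite mulmxA -prG; last by apply: mem_G; apply: unipotent_Sp.
    by rewrite -mulmxA vU.
  + move=> s t sp tp; rewrite mulmxA -prG; last by apply: mem_G; apply: Sp_torus.
    by rewrite -mulmxA vT // -scalemxAr.
- split; last exact: utau.2.
  move=> A HA; split; first exact: adj_H.
  by have [_ ->] := utau.1 _ (H_sub_G HA).
(* The adjoint of an element of U^- lies in U and fixes v; taking adjoints gives invariance of
   [adj v]. For the torus below, the two complex conjugations of the weight cancel. *)
- move=> u u' lu lu'; have gu : G (G_mx u u') by apply: mem_G; apply: lowuni_Sp.
  rewrite -(mulmxA (adj v)) -tauB // mulmxA; congr (_ *m _).
  rewrite -[rho _]adjK -star -adjM adj_G_mx vU //; exact: adj_lowuni.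
- move=> s t sp tp; have gt : G (G_mx (torus_mx s) (torus_mx t)).
    by apply: mem_G; apply: Sp_torus.
  rewrite -(mulmxA (adj v)) -tauB // mulmxA scalemxAl; congr (_ *m _).
  rewrite -[rho _]adjK -star -adjM adj_G_mx !adj_torus vT.
  + by rewrite adj_scale !conj_weight_val -rmorphM /= conjCK.
  + by move=> j; rewrite mxE conjC_eq0.
  + by move=> j; rewrite mxE conjC_eq0.
- move=> A D t z SA SD tn0; rewrite /tau /subrep -!mulmxA BK //.
  by rewrite wiH // -scalemxAr.
Qed.

End MultiplicityOne.

(** * All predicted weights occur; uniqueness of the decomposition *)

Section Sufficiency.
Variables (R : realType) (m n : nat) (hm : (1 < m.+2)%N) (hn : (1 < n.+2)%N).
Local Notation C := (complex R).
Local Notation G := (@G R m.+2 n.+2).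
Local Notation N := ((m.+2 + m.+2) + (n.+2 + n.+2))%N.

Lemma star_rep_left : star_rep (fun X : 'M[C]_N => ulsubmx X).
Proof.
split; last by move=> X; apply/matrixP => i j; rewrite !mxE.
split.
- by rewrite (@scalar_mx_block _ (m.+2 + m.+2) (n.+2 + n.+2)) block_mxKul.
- move=> X Y /G_P[A [B [_ _ ->]]] /G_P[A' [B' [_ _ ->]]].
  by rewrite G_mxM /G_mx !block_mxKul.
- move=> i j; apply: eq_regular (regular_entry G (lshift _ i) (lshift _ j)) => A _.
  by rewrite !mxE.
Qed.

Lemma star_rep_right : star_rep (fun X : 'M[C]_N => drsubmx X).
Proof.
split; last by move=> X; apply/matrixP => i j; rewrite !mxE.
split.
- by rewrite (@scalar_mx_block _ (m.+2 + m.+2) (n.+2 + n.+2)) block_mxKdr.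
- move=> X Y /G_P[A [B [_ _ ->]]] /G_P[A' [B' [_ _ ->]]].
  by rewrite G_mxM /G_mx !block_mxKdr.
- move=> i j; apply: eq_regular (regular_entry G (rshift _ i) (rshift _ j)) => A _.
  by rewrite !mxE.
Qed.

Lemma fund_multiplicity abc l1 l2 (lam := genG m.+2 n.+2 abc +
    (fund_weight m.+2 1 *+ l1, fund_weight n.+2 1 *+ l2)) :
  dominantG lam /\ multiplicityGH R hm hn lam (muH m.+2 n.+2 (l1 + l2)) 1.
Proof.
have dlam : dominantG lam.
  case: abc @lam => [[a b] c] /=; rewrite /dominantG /= !pairMnE /= !mul0rn !addr0.
  rewrite !(addrAC _ (fund_weight _ 2 *+ _)) -!mulrnDr.
  by split; apply: dominant_fund.
split=> //.
have [P1 [Q1 [P2 [Q2 [PQ1 PQ2 HE]]]]] := H_splitting R hm hn.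
have [s1 [Ss1 s1e s1f]] := Sp_transitive (omega_split PQ1).
have [s2 [Ss2 s2e s2f]] := Sp_transitive (omega_split PQ2).
apply: (datum_multiplicity PQ1 PQ2 HE Ss1 Ss2 s1e s1f s2e s2f) => //.
set g0 := base_point _ _ _ _.
have F1 : symp_factor hm hn g0 (fun X : 'M[C]_N => ulsubmx X) (fun s _ => s)
    (Q1 *m col_e R) (Q1 *m col_f R) 0.
  split; first exact: star_rep_left.
  - by move=> A B uA uB; rewrite /G_mx block_mxKul.
  - by move=> s t; rewrite /G_mx block_mxKul.
  - move=> A D t z SA SD tn0; rewrite HE /G_mx block_mxKul.
    by rewrite emb_borel_e // emb_borel_f.
  - by rewrite /g0 /base_point /G_mx block_mxKul.
have F2 : symp_factor hm hn g0 (fun X : 'M[C]_N => drsubmx X) (fun _ t => t)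
    (Q2 *m col_e R) (Q2 *m col_f R) 1.
  split; first exact: star_rep_right.
  - by move=> A B uA uB; rewrite /G_mx block_mxKdr.
  - by move=> s t; rewrite /G_mx block_mxKdr.
  - move=> A D t z SA SD tn0; rewrite HE /G_mx block_mxKdr.
    by rewrite emb_borel_e // emb_borel_f.
  - rewrite /g0 /base_point /G_mx block_mxKdr.
    by split; [apply: shear2_e | apply: shear2_f].
pose fm := fund_weight m.+2; pose fn := fund_weight n.+2.
have D1 : datum hm hn g0 (fm 1%N, 0) 1.
  apply: datum_standard F1 _ => s t sp tp.
  by rewrite /= weight_val0 mulr1 weight_val_fund1.
have D2 : datum hm hn g0 (0, fn 1%N) 1.
  apply: datum_standard F2 _ => s t sp tp.
  by rewrite /= weight_val0 mul1r weight_val_fund1.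
have D3 : datum hm hn g0 (fm 1%N, fn 1%N) 0.
  apply: datum_mixed F1 F2 _ _ => [|s t sp tp]; first by rewrite subr0 oner_neq0.
  by rewrite /= !weight_val_fund1.
have D4 : datum hm hn g0 (fm 2%N, 0) 0.
  apply: datum_wedge F1 _ => s t sp tp.
  by rewrite /= weight_val0 mulr1 weight_val_fund2.
have D5 : datum hm hn g0 (0, fn 2%N) 0.
  apply: datum_wedge F2 _ => s t sp tp.
  by rewrite /= weight_val0 mul1r weight_val_fund2.
have := datumD (datumD (datumD (datumMn abc.1.1 D3) (datumMn abc.1.2 D4))
  (datumMn abc.2 D5)) (datumD (datumMn l1 D1) (datumMn l2 D2)).
rewrite !mul0n !mul1n !add0n.
by rewrite [X in datum _ _ _ (_ + X)](_ : _ = (fm 1%N *+ l1, fn 1%N *+ l2)) //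
  !pairMnE /= !mul0rn; congr pair; rewrite /= ?addr0 ?add0r.
Qed.

Lemma PG_muH l : PG R hm hn (muH m.+2 n.+2 l) =
  [set lam | exists abc b, Bmu m.+2 n.+2 l b /\ lam = genG m.+2 n.+2 abc + b].
Proof.
apply/seteqP; split=> lam /=.
  move=> [dlam /(multiplicity_weights dlam)[abc [l1 [l2 [ll lamE]]]]].
  by exists abc, (fund_weight m.+2 1 *+ l1, fund_weight n.+2 1 *+ l2); split=> //; exists l1, l2.
move=> [abc [b [[l1 [l2 [<- ->]]] ->]]].
exact: fund_multiplicity.
Qed.

End Sufficiency.

Section WeightMonoid.
Variables m n : nat.

(** The first two coordinates of such a weight are a + b and b. *)
Lemma fund_weight_inj r a b a' b' :
  fund_weight r.+2 1 *+ a + fund_weight r.+2 2 *+ b =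
  fund_weight r.+2 1 *+ a' + fund_weight r.+2 2 *+ b' -> a = a' /\ b = b'.
Proof.
move=> E; have := congr1 (fun lam : 'rV_r.+2 => lam ord0 ord0) E.
have := congr1 (fun lam : 'rV_r.+2 => lam ord0 (lift ord0 ord0)) E.
rewrite !mxE !mulmxnE !mxE /= !mul0rn !add0r !mulr1n !natz => -[->] /eqP.
by rewrite -!PoszD eqz_nat eqn_add2r => /eqP.
Qed.

Lemma genG_Bmu_inj abc abc' l1 l2 l1' l2' : (l1 + l2 = l1' + l2')%N ->
  genG m.+2 n.+2 abc + (fund_weight m.+2 1 *+ l1, fund_weight n.+2 1 *+ l2) =
  genG m.+2 n.+2 abc' + (fund_weight m.+2 1 *+ l1', fund_weight n.+2 1 *+ l2') ->
  [/\ abc = abc', l1 = l1' & l2 = l2'].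
Proof.
case: abc abc' => [[a b] c] [[a' b'] c'] ll; rewrite /genG /= !pairMnE /= => -[].
rewrite !mul0rn !addr0 !(addrAC _ (fund_weight _ 2 *+ _)) -!mulrnDr.
move=> /fund_weight_inj[E1 ->] /fund_weight_inj[E2 ->].
(* E1 and E2 fix the sums of a with l1 and with l2. Adding them and using that l1 + l2 is the same
   on both sides leaves 2 a = 2 a'. *)
have -> : a = a' by lia.
by split=> //; lia.
Qed.

End WeightMonoid.

Theorem mainTheorem4 (R : realType) (m n : nat)
    (hm : (1 < m)%N) (hn : (1 < n)%N) :
  (PG R hm hn 0 = range (@genG m n) /\ injective (@genG m n))
  /\ forall l : nat,
       PG R hm hn (muH m n l) =
         [set p + b | p in PG R hm hn 0 & b in Bmu m n l]
       /\ set_bij (PG R hm hn 0 `*` Bmu m n l) (PG R hm hn (muH m n l))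
            (fun x => x.1 + x.2).
Proof.
(* Writing both ranks as successors of successors provides the indices 0 and 1 on which the standard
   pairs live. *)
case: m hm => [|[|m]] // hm; case: n hn => [|[|n]] // hn.
have mu0 : 0 = muH m.+2 n.+2 0 by rewrite /muH mulr0n.
have PG0 : PG R hm hn 0 = range (@genG m.+2 n.+2).
  rewrite mu0 PG_muH; apply/seteqP; split=> lam /=.
    move=> [abc [b [[l1 [l2 [/eqP ll ->]]] ->]]]; exists abc => //.
    move: ll; rewrite addn_eq0 => /andP[/eqP-> /eqP->].
    by rewrite !mulr0n addr0.
  move=> [abc _ <-]; exists abc, 0; split; last by rewrite addr0.
  by exists 0%N, 0%N; rewrite !mulr0n.
have PGl l : PG R hm hn (muH m.+2 n.+2 l) =
    [set p + b | p in PG R hm hn 0 & b in Bmu m.+2 n.+2 l].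
  rewrite PG_muH PG0; apply/seteqP; split=> lam /=.
    move=> [abc [b [Bb ->]]]; exists (genG m.+2 n.+2 abc); first by exists abc.
    by exists b.
  by move=> [_ [abc _ <-]] [b Bb <-]; exists abc, b.
split; first split=> //.
  move=> abc abc' E; have [] // := @genG_Bmu_inj m n abc abc' 0 0 0 0 erefl.
  by rewrite E.
move=> l; split; first exact: PGl.
rewrite PGl; split.
- by move=> [p b] [/= pP bB]; exists p => //; exists b.
- move=> [p b] [p' b'] /set_mem[/= + [l1 [l2 [ll ->]]]] /set_mem[/= + [l1' [l2' [ll' ->]]]].
  rewrite PG0 => -[abc _ <-] [abc' _ <-] /genG_Bmu_inj.
  by rewrite ll ll' => /(_ erefl)[-> -> ->].
- by move=> lam [p pP [b bB <-]]; exists (p, b).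
Qed.
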